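(* The elliptic system \[ \Delta P+\Big(\tfrac19 P^2+2Q^2\Big)P+\tfrac13 P^2Q=0,\qquad \Delta Q+(9Q^2+2P^2)Q+\tfrac19 P^3=0\qquad\text{in }\mathbb{R}^4 \] admits at least one ground state solution; that is, the set $\mathcal{G}$ of ground states is non-empty.
   Context: All functions are real-valued. $\dot H^1(\mathbb{R}^4)$ denotes the homogeneous Sobolev space. A pair $(P,Q)\in \dot H^1(\mathbb{R}^4)\times \dot H^1(\mathbb{R}^4)$ is a (weak) solution of the system if for all $(f,g)\in \dot H^1(\mathbb{R}^4)\times \dot H^1(\mathbb{R}^4)$: $\int \nabla P\cdot\nabla f=\int(\frac19P^3+2Q^2P+\frac13P^2Q)f$ and $\int\nabla Q\cdot\nabla g=\int(9Q^3+2P^2Q+\frac19P^3)g$. Set $K(P,Q)=\int(|\nabla P|^2+|\nabla Q|^2)\,dx$, $N(P,Q)=\int\big(\frac1{36}P^4+\frac94Q^4+P^2Q^2+\frac19P^3Q\big)dx$ and $S(P,Q)=\frac12K(P,Q)-N(P,Q)$. Let $\mathcal{C}$ be the set of all non-trivial (i.e. $(P,Q)\neq(0,0)$) solutions. A solution $(P_0,Q_0)$ is a ground state if $S(P_0,Q_0)=\inf\{S(P,Q):(P,Q)\in\mathcal{C}\}$; $\mathcal{G}$ denotes the set of ground states. *)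

(* Defs.v *)
From HB Require Import structures.
From mathcomp Require Import all_boot all_order all_algebra.
From mathcomp Require Import all_classical all_reals all_analysis.
Set Implicit Arguments. Unset Strict Implicit. Unset Printing Implicit Defensive.
Import Order.TTheory GRing.Theory Num.Theory.
Import numFieldNormedType.Exports.
Local Open Scope classical_set_scope.
Local Open Scope ring_scope.

Section R4.
Variable R : realType.

(* R^4 realised as (R * R) * (R * R) with the product Borel sigma-algebra *)
Definition R4 := ((R * R) * (R * R))%type.

Definition leb4 :=
  (((@lebesgue_measure R) \x (@lebesgue_measure R)) \x
   ((@lebesgue_measure R) \x (@lebesgue_measure R)))%E.

Definition coord (i : 'I_4) (x : R4) : R :=
  match val i with 0 => x.1.1 | 1 => x.1.2 | 2 => x.2.1 | _ => x.2.2 end.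

Definition shift (i : 'I_4) (t : R) (x : R4) : R4 :=
  ((x.1.1 + (val i == 0)%:R * t, x.1.2 + (val i == 1)%:R * t),
   (x.2.1 + (val i == 2)%:R * t, x.2.2 + (val i == 3)%:R * t)).

Definition pd (i : 'I_4) (phi : R4 -> R) : R4 -> R :=
  fun x => derive1 (fun t => phi (shift i t x)) 0.

Fixpoint dpart (s : seq 'I_4) (phi : R4 -> R) : R4 -> R :=
  match s with [::] => phi | i :: s' => pd i (dpart s' phi) end.

Definition test_fun (phi : R4 -> R) : Prop :=
  (forall (s : seq 'I_4) (i : 'I_4) (x : R4),
      derivable (fun t => dpart s phi (shift i t x)) 0 1) /\
  (forall s : seq 'I_4, continuous (dpart s phi)) /\
  (exists M : R, forall x : R4, (exists i : 'I_4, M < `|coord i x|) -> phi x = 0).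

(* u belongs to Hdot^1(R^4) = {u in L^4 : grad u in L^2}, with weak gradient g *)
Definition Hdot1 (u : R4 -> R) (g : 'I_4 -> R4 -> R) : Prop :=
  measurable_fun setT u /\
  (\int[leb4]_x (`|u x| ^+ 4)%:E < +oo)%E /\
  forall i : 'I_4,
    measurable_fun setT (g i) /\
    (\int[leb4]_x ((g i x) ^+ 2)%:E < +oo)%E /\
    forall phi, test_fun phi ->
      (\int[leb4]_x (u x * pd i phi x)%:E = - \int[leb4]_x (g i x * phi x)%:E)%E.

Definition is_solution (P : R4 -> R) (gP : 'I_4 -> R4 -> R)
    (Q : R4 -> R) (gQ : 'I_4 -> R4 -> R) : Prop :=
  Hdot1 P gP /\ Hdot1 Q gQ /\
  forall (f : R4 -> R) (gf : 'I_4 -> R4 -> R), Hdot1 f gf ->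
    (\int[leb4]_x (\sum_(i < 4) gP i x * gf i x)%:E =
       \int[leb4]_x ((P x ^+ 3 / 9 + 2 * Q x ^+ 2 * P x + P x ^+ 2 * Q x / 3)
                      * f x)%:E)%E /\
    (\int[leb4]_x (\sum_(i < 4) gQ i x * gf i x)%:E =
       \int[leb4]_x ((9 * Q x ^+ 3 + 2 * P x ^+ 2 * Q x + P x ^+ 3 / 9)
                      * f x)%:E)%E.

(* (P,Q) <> (0,0) in Hdot^1 x Hdot^1, i.e. not both zero almost everywhere *)
Definition nontrivial (P Q : R4 -> R) : Prop :=
  ~ ({ae leb4, forall x, P x = 0} /\ {ae leb4, forall x, Q x = 0}).

Definition Kfun (gP gQ : 'I_4 -> R4 -> R) : \bar R :=
  (\int[leb4]_x (\sum_(i < 4) (gP i x ^+ 2 + gQ i x ^+ 2))%:E)%E.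

Definition Nfun (P Q : R4 -> R) : \bar R :=
  (\int[leb4]_x (P x ^+ 4 / 36 + 9 / 4 * Q x ^+ 4 + P x ^+ 2 * Q x ^+ 2
                 + P x ^+ 3 * Q x / 9)%:E)%E.

Definition Sfun P gP Q gQ : \bar R := (2^-1%:E * Kfun gP gQ - Nfun P Q)%E.

Definition S_values : set (\bar R) :=
  [set s | exists (P : R4 -> R) (gP : 'I_4 -> R4 -> R)
                  (Q : R4 -> R) (gQ : 'I_4 -> R4 -> R),
     [/\ is_solution P gP Q gQ, nontrivial P Q & s = Sfun P gP Q gQ]].

Definition ground_state P gP Q gQ : Prop :=
  is_solution P gP Q gQ /\ nontrivial P Q /\
  Sfun P gP Q gQ = ereal_inf S_values.

End R4.

(* Main.v *)
Require Import Defs.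
From HB Require Import structures.
From mathcomp Require Import all_boot all_order all_algebra.
From mathcomp Require Import all_classical all_reals all_analysis.
From mathcomp Require Import measurable_realfun.
From mathcomp Require Import lra ring zify.
Set Implicit Arguments. Unset Strict Implicit. Unset Printing Implicit Defensive.
Import Order.TTheory GRing.Theory Num.Theory.
Import numFieldNormedType.Exports.
Require Import Defs.
Local Open Scope classical_set_scope.
Local Open Scope ring_scope.

(** The ground state is explicit: the pair (0, r w), where w(x) = 1 / (1 + |x|^2) is the
    Aubin-Talenti bubble and r^2 = 8/9. Since - Delta w = 8 w^3, the function Q = r w solves - Delta
    Q = 9 Q^3, which is the second equation when P = 0, and the first equation is then trivial. What
    has to be proved is minimality.

    Testing a solution with itself gives K = 4 N, hence S = K / 4 ([Sfun_solution]). The density of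
    N is at most 9/4 (P^2 + Q^2)^2 ([quartic_bound]), so by Cauchy-Schwarz K <= 9 A^2 with A =
    ||P||_4^2 + ||Q||_4^2 ([solution_identities]). The sharp Sobolev inequality 8 sqrt(I) ||u||_4^2
    <= ||grad u||_2^2, with I the integral of w^4 ([sobolev_Hdot1]), applied to P and to Q gives 8
    sqrt(I) A <= K. Together these force K >= 64 I / 9 for every non-trivial solution
    ([solution_lower_bound]), and (0, r w) attains this value.

    Most of the work is the sharp Sobolev inequality, proved by mass transport. For u regular and
    supported in a box, put f = sqrt(u^2 + eps^2) and transport the measure f^4 dx on the box, one
    coordinate after the other (Knothe map T), to a truncation of the measure (1 + |y|^2)^-4 dy. In
    the coordinates y_i = tan(theta_i) / (cos theta_1 ... cos theta_(i-1)) the target is a product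
    of laws cos^k with k = 3, 4, 5, 6, and 1 + |y|^2 = (cos theta_1 ... cos theta_4)^-2, so each
    stage is an explicit one-dimensional rearrangement. The arithmetic-geometric inequality bounds
    div T from below by the fourth root of its Jacobian; multiplying by f^3, integrating by parts
    and using Young's inequality gives the estimate ([divergence_ge], [box_sobolev]). Letting eps
    tend to 0 and the truncation disappear gives the sharp constant ([sobolev_box]).

    The inequality passes to compactly supported functions with a weak gradient by convolution with
    a product kernel, the kernel being removed one coordinate at a time by one-dimensional Lebesgue
    differentiation and Fatou ([sobolev_conv], [conv_fatou]), and to the whole space by cutoffs
    ([cut_energy]). *)

(** * Product measures, Tonelli and Fubini for real-valued functions *)

Section product_measure.
Local Open Scope ereal_scope.
Context d1 d2 (T1 : measurableType d1) (T2 : measurableType d2) (R : realType).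
Variable m1 : {sigma_finite_measure set T1 -> \bar R}.
Variable m2 : {sigma_finite_measure set T2 -> \bar R}.

(** A separate name for the product, so that a sigma-finite structure can be attached to it and
    products can be iterated. *)
Definition pmeasure : set (T1 * T2) -> \bar R := m1 \x m2.

HB.instance Definition _ := Measure.on pmeasure.

Lemma pmeasure_sigma_finite : sigma_finite setT pmeasure.
Proof.
have /sigma_finiteP[F [TF ndF Foo]] := sigma_finiteT m1.
have /sigma_finiteP[G [TG ndG Goo]] := sigma_finiteT m2.
exists (fun n => F n `*` G n); last first.
  move=> k; have [mF oF] := Foo k; have [mG oG] := Goo k.
  split; first exact: measurableX.
  by rewrite /pmeasure product_measure1E// lte_mul_pinfty// ge0_fin_numE.
apply/seteqP; split => [[x y] _|//].
have [n _ Fnx] : (\bigcup_n F n) x by rewrite -TF.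
have [k _ Gky] : (\bigcup_n G n) y by rewrite -TG.
exists (maxn n k) => //; split => /=.
  by apply: subsetPset (ndF _ _ (leq_maxl n k)) _ Fnx.
by apply: subsetPset (ndG _ _ (leq_maxr n k)) _ Gky.
Qed.

HB.instance Definition _ :=
  Measure_isSigmaFinite.Build _ _ _ pmeasure pmeasure_sigma_finite.

Lemma tonelli1 (f : T1 * T2 -> \bar R) : measurable_fun setT f ->
  (forall x, 0 <= f x) ->
  \int[pmeasure]_z f z = \int[m1]_x \int[m2]_y f (x, y).
Proof. by move=> mf f0; rewrite /pmeasure (fubini_tonelli1 f). Qed.

Lemma tonelli2 (f : T1 * T2 -> \bar R) : measurable_fun setT f ->
  (forall x, 0 <= f x) ->
  \int[pmeasure]_z f z = \int[m2]_y \int[m1]_x f (x, y).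
Proof. by move=> mf f0; rewrite /pmeasure (fubini_tonelli2 f). Qed.

(** The real-valued inner integral replaces an infinite value by 0, so it agrees with [fubini_F]
    only for almost every x; integrability and the value of the double integral are transferred
    along this almost-everywhere equality. *)
Lemma fubiniR1 (f : T1 * T2 -> R) : pmeasure.-integrable setT (EFin \o f) ->
  [/\ {ae m1, forall x, m2.-integrable setT (fun y => (f (x, y))%:E)},
      m1.-integrable setT (fun x => (\int[m2]_y f (x, y))%R%:E) &
      (\int[pmeasure]_z f z)%R = (\int[m1]_x \int[m2]_y f (x, y))%R].
Proof.
move=> fi; have ae := ae_integrable1 fi; have iF := integrable_fubini_F fi.
have mF := measurable_int _ iF.
have eqF : ae_eq m1 setT (fubini_F m2 (EFin \o f))
    (fun x => (\int[m2]_y f (x, y))%R%:E).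
  apply: filterS ae => x ix _.
  by rewrite /fubini_F /Rintegral fineK//; apply: integrable_fin_num.
have mF' : measurable_fun setT (fun x => (\int[m2]_y f (x, y))%R%:E).
  have : measurable_fun setT (fine \o fubini_F m2 (EFin \o f)).
    exact: measurableT_comp.
  by move/measurable_EFinP.
split=> //.
  apply/integrableP; split=> //.
  rewrite -(ge0_ae_eq_integral (f := abse \o fubini_F m2 (EFin \o f)))//.
  - by case/integrableP: iF.
  - exact: measurableT_comp.
  - exact: measurableT_comp.
  - by move=> x _ /=; exact: abse_ge0.
  - by apply: filterS eqF => x /(_ I) /= ->.
rewrite /Rintegral; congr fine.
by rewrite /pmeasure -(fubini1 fi); apply: ae_eq_integral.
Qed.

End product_measure.

(** * Joint measurability of functions measurable in one variable and continuous in the other *)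

Section caratheodory.
Context d (T : measurableType d) (R : realType).

(** Rounding the second variable down to a multiple of 1/(n+1) gives functions whose preimages are
    countable unions of measurable rectangles; by continuity in that variable they converge
    pointwise to f. *)
Lemma caratheodory_measurable (f : T * measurableTypeR R -> R) :
  (forall y, measurable_fun setT (fun x => f (x, y))) ->
  (forall x, continuous (fun y : R => f (x, y))) ->
  measurable_fun setT f.
Proof.
move=> mf cf.
pose r n (y : R) : R := (Num.floor (y * n.+1%:R))%:~R / n.+1%:R.
have rcvg y : r n y @[n --> \oo] --> y.
  apply/cvgrPdist_le => e e0; near=> n.
  have n0 : (0 : R) < n.+1%:R by rewrite ltr0n.
  have /andP[fl1 fl2] := floor_itv (y * n.+1%:R).
  have -> : y - r n y = (y * n.+1%:R - (Num.floor (y * n.+1%:R))%:~R) / n.+1%:R.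
    by rewrite mulrBl mulfK// gt_eqF.
  rewrite normrM normfV [X in _ / X]gtr0_norm// ler_pdivrMr// ger0_norm ?subr_ge0//.
  rewrite intrD in fl2.
  apply: (@le_trans _ _ 1); first by rewrite lerBlDl; exact: ltW.
  rewrite -ler_pdivrMl// mulr1.
  near: n; exists (Num.bound e^-1) => // k /= bk.
  apply/ltW/(lt_le_trans (archi_boundP _)); first by rewrite invr_ge0 ltW.
  by rewrite ler_nat (leq_trans bk).
pose g n (z : T * measurableTypeR R) := f (z.1, r n z.2).
apply: (measurable_fun_cvg (h := g)) => [n|[x y] _]; last first.
  exact: (cvg_comp (fun n => r n y) (fun y : R => f (x, y)) (rcvg y) (cf x y)).
move=> _ B mB; rewrite setTI.
pose D (k : int) : set (T * measurableTypeR R) :=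
  ((fun x => f (x, k%:~R / n.+1%:R)) @^-1` B) `*`
  `[(k%:~R / n.+1%:R : R), ((k + 1)%:~R / n.+1%:R)[%classic.
have n0 : (0 : R) < n.+1%:R by rewrite ltr0n.
have -> : g n @^-1` B = \bigcup_k D k.
  apply/seteqP; split => [[x y] /= Bxy|[x y] [k _ [/= Bxy]]].
    exists (Num.floor (y * n.+1%:R)) => //; split => //=.
    by rewrite in_itv/= ler_pdivrMr// ltr_pdivlMr// floor_itv.
  rewrite in_itv/= ler_pdivrMr// ltr_pdivlMr// => kx.
  by rewrite /g /r (floor_def kx).
apply: countable_bigcupT_measurable => [|k]; first exact: countableP.
apply: measurableX => //.
by rewrite -[X in measurable X]setTI; exact: mf.
Unshelve. all: by end_near. Qed.

End caratheodory.

(** * Powers of a measure on the line, and slicing of R^4 along one coordinate *)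

Section R4_measure.
Variable R : realType.
Local Notation mT := (measurableTypeR R).

Variable m : {sigma_finite_measure set mT -> \bar R}.

(** The factor [m] is kept general because these powers serve both for Lebesgue measure and for its
    restriction to [-L, L]. *)
Definition pow2 := pmeasure m m.
HB.instance Definition _ := SigmaFiniteMeasure.on pow2.
Definition pow3 := pmeasure pow2 m.
HB.instance Definition _ := SigmaFiniteMeasure.on pow3.
Definition pow4 := pmeasure pow2 pow2.
HB.instance Definition _ := SigmaFiniteMeasure.on pow4.

(* the point whose i-th coordinate is t and whose other coordinates are y *)
Definition ins (i : 'I_4) (t : R) (y : (R * R) * R) : R4 R :=
  match val i with
  | 0 => ((t, y.1.1), (y.1.2, y.2)) | 1 => ((y.1.1, t), (y.1.2, y.2))
  | 2 => ((y.1.1, y.1.2), (t, y.2)) | _ => ((y.1.1, y.1.2), (y.2, t)) end.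


Lemma measurable_ins i :
  measurable_fun setT (fun z : ((mT * mT) * mT) * mT => ins i z.2 z.1 : (mT * mT) * (mT * mT)).
Proof.
have m11 : measurable_fun setT (fun z : ((mT * mT) * mT) * mT => z.1.1.1).
  apply: (measurableT_comp (f := fst)) => //.
  by apply: (measurableT_comp (f := fst)).
have m12 : measurable_fun setT (fun z : ((mT * mT) * mT) * mT => z.1.1.2).
  apply: (measurableT_comp (f := snd)) => //.
  by apply: (measurableT_comp (f := fst)).
have m2 : measurable_fun setT (fun z : ((mT * mT) * mT) * mT => z.1.2).
  by apply: (measurableT_comp (f := snd)).
have m' : measurable_fun setT (fun z : ((mT * mT) * mT) * mT => z.2).
  exact: measurable_snd.
by case: i => -[|[|[|[|?]]]] // i4; rewrite /ins /=;
   apply: measurable_fun_pair => /=; apply: measurable_fun_pair.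
Qed.

(** The two sides group the coordinates differently, as 2 + 2 on the left and as (2 + 1) + 1 with
    the i-th coordinate innermost on the right. Unfolding both by Tonelli and exchanging integrals
    identifies them, separately for each of the four coordinates. *)
Lemma ge0_integral_ins i (G : R4 R -> \bar R) : measurable_fun setT G ->
  (forall x, 0 <= G x)%E ->
  (\int[pow4]_x G x = \int[pmeasure pow3 m]_z G (ins i z.2 z.1))%E.
Proof.
move=> mG G0.
have mGi := measurableT_comp mG (measurable_ins i).
rewrite [RHS]tonelli1; [|exact: mGi|by move=> x; exact: G0].
have mF2 : measurable_fun setT (fun y : (mT * mT) * mT => \int[m]_t G (ins i t y))%E.
  exact: (measurable_fun_fubini_tonelli_F _ mGi (fun z => G0 _)).
have F20 (y : (mT * mT) * mT) : (0 <= \int[m]_t G (ins i t y))%E.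
  by apply: integral_ge0 => t _; exact: G0.
rewrite [RHS]tonelli1; [|exact: mF2|exact: F20].
have mF3 := measurable_fun_fubini_tonelli_F (m2 := m) _ mF2 F20.
have F30 c : (0 <= \int[m]_s \int[m]_t G (ins i t (c, s)))%E.
  by apply: integral_ge0 => t _; exact: F20.
rewrite [LHS]tonelli1; [|exact: mG|exact: G0].
have mGa : measurable_fun setT (fun a : mT * mT => \int[pow2]_b G (a, b))%E.
  exact: (measurable_fun_fubini_tonelli_F (m2 := pow2) _ mG G0).
have Ga0 a : (0 <= \int[pow2]_b G (a, b))%E.
  by apply: integral_ge0 => t _; exact: G0.
have mG1 a : measurable_fun setT (fun b => G (a, b)) by exact: measurableT_comp.
have i03 : [\/ val i = 0%N, val i = 1%N, val i = 2%N | val i = 3%N].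
  by clear; case: i => -[|[|[|[|?]]]] //= _;
    [apply: Or41|apply: Or42|apply: Or43|apply: Or44].
case: i03 => iE.
- rewrite [LHS]tonelli2; [|exact: mGa|exact: Ga0].
  rewrite [RHS]tonelli1; [|exact: mF3|exact: F30].
  apply: eq_integral => a2 _.
  have mGs : measurable_fun setT (fun z : mT * (mT * mT) => G ((z.1, a2), z.2)).
    apply: (measurableT_comp mG) => /=.
    by apply: measurable_fun_pair => //; exact: measurable_fun_pair.
  have Gs0 (z : mT * (mT * mT)) : (0 <= G ((z.1, a2), z.2))%E by exact: G0.
  have -> := fubini_tonelli (m1 := m) (m2 := pow2) _ mGs Gs0.
  have mGs' := measurable_fun_fubini_tonelli_G (m1 := m) _ mGs Gs0.
  rewrite [LHS]tonelli1; [|exact: mGs'|by move=> b; apply: integral_ge0 => t _; exact: G0].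
  by apply: eq_integral => c _; apply: eq_integral => s _;
    apply: eq_integral => t _; rewrite /ins iE.
- rewrite [LHS]tonelli1; [|exact: mGa|exact: Ga0].
  rewrite [RHS]tonelli1; [|exact: mF3|exact: F30].
  apply: eq_integral => a1 _.
  have mGs : measurable_fun setT (fun z : mT * (mT * mT) => G ((a1, z.1), z.2)).
    apply: (measurableT_comp mG) => /=.
    by apply: measurable_fun_pair => //; exact: measurable_fun_pair.
  have Gs0 (z : mT * (mT * mT)) : (0 <= G ((a1, z.1), z.2))%E by exact: G0.
  have -> := fubini_tonelli (m1 := m) (m2 := pow2) _ mGs Gs0.
  have mGs' := measurable_fun_fubini_tonelli_G (m1 := m) _ mGs Gs0.
  rewrite [LHS]tonelli1; [|exact: mGs'|by move=> b; apply: integral_ge0 => t _; exact: G0].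
  by apply: eq_integral => c _; apply: eq_integral => s _;
    apply: eq_integral => t _; rewrite /ins iE.
- apply: eq_integral => -[a1 a2] _; rewrite [LHS]tonelli2; [|exact: mG1|by move=> ?; exact: G0].
  by apply: eq_integral => s _; apply: eq_integral => t _; rewrite /ins iE.
- apply: eq_integral => -[a1 a2] _; rewrite [LHS]tonelli1; [|exact: mG1|by move=> ?; exact: G0].
  by apply: eq_integral => s _; apply: eq_integral => t _; rewrite /ins iE.
Qed.

Lemma integral_ins i (G : R4 R -> \bar R) : measurable_fun setT G ->
  (\int[pow4]_x G x = \int[pmeasure pow3 m]_z G (ins i z.2 z.1))%E.
Proof.
move=> mG; rewrite integralE [RHS]integralE.
congr (_ - _)%E.
  rewrite (ge0_integral_ins i (measurable_funepos mG) (funepos_ge0 _)).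
  by apply: eq_integral => z _; rewrite !funeposE.
rewrite (ge0_integral_ins i (measurable_funeneg mG) (funeneg_ge0 _)).
by apply: eq_integral => z _; rewrite !funenegE.
Qed.

Lemma tonelli_ins i (G : R4 R -> \bar R) : measurable_fun setT G ->
  (forall x, 0 <= G x)%E ->
  (\int[pow4]_x G x = \int[pow3]_y \int[m]_t G (ins i t y))%E.
Proof.
move=> mG G0; rewrite (integral_ins i mG) tonelli1; [by []| |].
  exact: (measurableT_comp mG (measurable_ins i)).
by move=> x; exact: G0.
Qed.

Lemma integrable_ins i (F : R4 R -> R) : pow4.-integrable setT (EFin \o F) ->
  (pmeasure pow3 m).-integrable setT (fun z => (F (ins i z.2 z.1))%:E).
Proof.
case/integrableP => mF iF; apply/integrableP; split.
  exact: (measurableT_comp mF (measurable_ins i)).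
by move: iF; rewrite (integral_ins i) //; exact: measurableT_comp.
Qed.

Lemma fubini_ins i (F : R4 R -> R) : pow4.-integrable setT (EFin \o F) ->
  [/\ {ae pow3, forall y, m.-integrable setT (fun t => (F (ins i t y))%:E)},
      pow3.-integrable setT (fun y => (\int[m]_t F (ins i t y))%:E) &
      \int[pow4]_x F x = \int[pow3]_y \int[m]_t F (ins i t y)].
Proof.
move=> iF; have [h1 h2 h3] := fubiniR1 (integrable_ins i iF).
split; [exact: h1|exact: h2|rewrite -h3 /Rintegral (integral_ins i)//].
by case/integrableP: iF.
Qed.


Definition del (i : 'I_4) (x : R4 R) : (R * R) * R :=
  match val i with
  | 0 => ((x.1.2, x.2.1), x.2.2) | 1 => ((x.1.1, x.2.1), x.2.2)
  | 2 => ((x.1.1, x.1.2), x.2.2) | _ => ((x.1.1, x.1.2), x.2.1) end.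

Lemma del_ins i t y : del i (ins i t y) = y.
Proof. by case: i => -[|[|[|[|?]]]] // i4; case: y => [[a b] c]. Qed.

Lemma coord_ins i t y : coord i (ins i t y) = t.
Proof. by case: i => -[|[|[|[|?]]]] // i4. Qed.

Lemma shift_ins i t s y : shift i s (ins i t y) = ins i (t + s) y.
Proof.
by case: i => -[|[|[|[|?]]]] // i4; rewrite /shift /ins /= !(mul0r, mul1r, addr0).
Qed.

Lemma ins_coord_del i x : ins i (coord i x) (del i x) = x.
Proof. by case: i => -[|[|[|[|?]]]] // i4; case: x => [[a b] [c e]]. Qed.

Lemma shiftE i s x : shift i s x = ins i (coord i x + s) (del i x).
Proof. by rewrite -{1}(ins_coord_del i x) shift_ins. Qed.

End R4_measure.

(** The reference measure unfolds to [pow4] of Lebesgue measure, so facts about [pow4] apply by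
    conversion to the integrals in [Hdot1], [Kfun] and [Nfun]. *)
Lemma leb4E (R : realType) : @leb4 R = pow4 (@lebesgue_measure R) :> (set _ -> _).
Proof. by []. Qed.

(** * Integrals against restricted measures *)

Section integral_restr.
Context d (T : measurableType d) (R : realType).
Variables (m : {measure set T -> \bar R}) (D : set T) (mD : measurable D).

Lemma integral_mrestr (f : T -> \bar R) : measurable_fun setT f ->
  (\int[mrestr m mD]_x f x = \int[m]_(x in D) f x)%E.
Proof.
move=> mf.
have -> : (\int[m]_(x in D) f x = \int[mrestr m mD]_(x in D) f x)%E.
  by apply: eq_measure_integral => A mA AD; rewrite /= /mrestr setIidl.
rewrite -(setUv D) integral_setU//.
- rewrite [X in (_ + X)%E]null_set_integral ?adde0//.
  + exact: measurableC.
  + exact: measurable_funTS.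
  + by rewrite /= /mrestr setICl measure0.
- exact: measurableC.
- exact: measurable_funTS.
- by apply/disj_setPS; rewrite setICr.
Qed.

Lemma Rintegral_mrestr (f : T -> R) : measurable_fun setT f ->
  \int[mrestr m mD]_x f x = \int[m]_(x in D) f x.
Proof.
by move=> mf; rewrite /Rintegral integral_mrestr//; exact/measurable_EFinP.
Qed.

End integral_restr.

(** * Rules for derivatives in one variable *)

Section pointwise_derivatives.
Variable R : realType.
Implicit Types (f g : R -> R) (x df dg c : R).

Lemma der_cst c x : is_derive x 1 (fun _ : R => c) 0.
Proof. exact: is_derive_cst. Qed.

Lemma der_id x : is_derive x 1 (fun s : R => s) 1.
Proof. exact: is_derive_id. Qed.

Lemma derD f g x df dg : is_derive x 1 f df -> is_derive x 1 g dg ->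
  is_derive x 1 (fun s => f s + g s) (df + dg).
Proof. by move=> hf hg; exact: is_deriveD. Qed.

Lemma derN f x df : is_derive x 1 f df -> is_derive x 1 (fun s => - f s) (- df).
Proof. by move=> hf; exact: is_deriveN. Qed.

Lemma derB f g x df dg : is_derive x 1 f df -> is_derive x 1 g dg ->
  is_derive x 1 (fun s => f s - g s) (df - dg).
Proof. by move=> hf hg; exact: is_deriveB. Qed.

Lemma derM f g x df dg : is_derive x 1 f df -> is_derive x 1 g dg ->
  is_derive x 1 (fun s => f s * g s) (df * g x + f x * dg).
Proof.
move=> hf hg; have := is_deriveM hf hg.
by rewrite /GRing.scale /= addrC (mulrC (g x)).
Qed.

Lemma derMl c f x df : is_derive x 1 f df ->
  is_derive x 1 (fun s => c * f s) (c * df).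
Proof.
by move=> hf; have := derM (der_cst c x) hf; rewrite mul0r add0r.
Qed.

Lemma derMr c f x df : is_derive x 1 f df ->
  is_derive x 1 (fun s => f s * c) (df * c).
Proof.
by move=> hf; have := derM hf (der_cst c x); rewrite mulr0 addr0.
Qed.

Lemma derX n f x df : is_derive x 1 f df ->
  is_derive x 1 (fun s => f s ^+ n) (n%:R * f x ^+ n.-1 * df).
Proof.
move=> hf; elim: n => [|n IH].
  by rewrite !mul0r; exact: der_cst.
have -> : (fun s => f s ^+ n.+1) = (fun s => f s * f s ^+ n).
  by apply/funext => s; rewrite exprS.
apply: (is_derive_eq (derM hf IH)).
case: n {IH} => [|n] /=; first by rewrite !(expr0, mul0r, mulr0, addr0, mulr1, mul1r).
by rewrite -[in RHS]natr1 !exprS; ring.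
Qed.

Lemma derV f x df : f x != 0 -> is_derive x 1 f df ->
  is_derive x 1 (fun s => (f s)^-1) (- df / f x ^+ 2).
Proof.
move=> fx0 hf; have := is_deriveV fx0 hf.
by rewrite /GRing.scale /= -exprVn mulNr mulNr mulrC.
Qed.

Lemma der_comp g f x df dg : is_derive (f x) 1 g dg -> is_derive x 1 f df ->
  is_derive x 1 (fun s => g (f s)) (dg * df).
Proof. by move=> hg hf; exact: is_derive1_comp. Qed.

Lemma der_continuous f x df : is_derive x 1 f df -> {for x, continuous f}.
Proof. by move=> [h _]; exact/differentiable_continuous/derivable1_diffP. Qed.

Lemma der_derive1 f x df : is_derive x 1 f df -> derivable f x 1 /\ derive1 f x = df.
Proof. by move=> h; split; [apply: ex_derive|rewrite derive1E derive_val]. Qed.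

End pointwise_derivatives.

(** * Primitives of powers of the cosine and their inverses *)

Section cos_primitive.
Variable R : realType.
Implicit Types (k : nat) (t a v : R).

(* [primcos k] is the odd primitive of [cos ^+ k] *)
Fixpoint primcos k t : R :=
  match k with
  | 0 => t
  | 1 => sin t
  | (k'.+1 as k1).+1 => (cos t ^+ k1 * sin t + k1%:R * primcos k' t) / k1.+1%:R
  end.

Arguments primcos : simpl never.

Lemma primcosSS k t : primcos k.+2 t =
  (cos t ^+ k.+1 * sin t + k.+1%:R * primcos k t) / k.+2%:R.
Proof. by []. Qed.

(** This is the reduction formula for the integral of cos^k. The recursion goes down by two, so the
    induction carries two consecutive exponents. *)
Lemma der_primcos k t : is_derive t 1 (primcos k) (cos t ^+ k).
Proof.
suff [] : is_derive t 1 (primcos k) (cos t ^+ k) /\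
          is_derive t 1 (primcos k.+1) (cos t ^+ k.+1) by [].
elim: k => [|k [IH1 IH2]].
  by split; [exact: der_id|rewrite expr1; exact: is_derive_sin].
split => //.
have h := derMr k.+2%:R^-1 (derD (derM (derX k.+1 (is_derive_cos t))
  (is_derive_sin t)) (derMl k.+1%:R IH1)).
apply: (is_derive_eq h) => {h IH1 IH2}; rewrite /= !exprS.
have k2 : (k.+2%:R : R) != 0 by rewrite pnatr_eq0.
apply: (mulIf k2); rewrite mulfVK//.
have -> : (k.+2%:R : R) = k.+1%:R + 1 by rewrite natr1.
have : cos t ^+ 2 + sin t ^+ 2 = 1 by exact: cos2Dsin2.
move: (cos t) (sin t) (k.+1%:R : R) (cos t ^+ k) => c s K ck h.
have hs : s * s = 1 - c * c :> R by rewrite -!expr2 -h addrC addKr.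
transitivity (c * ck * c - K * ck * (s * s) + K * ck); first by ring.
by rewrite hs; ring.
Qed.

Lemma primcosN k t : primcos k (- t) = - primcos k t.
Proof.
suff [] : primcos k (- t) = - primcos k t /\ primcos k.+1 (- t) = - primcos k.+1 t by [].
elim: k => [|k [IH1 IH2]]; first by rewrite /primcos sinN.
split => //; rewrite !primcosSS cosN sinN IH1; ring.
Qed.

Lemma primcos_cont k : continuous (primcos k).
Proof. by move=> t; exact: der_continuous (der_primcos k t). Qed.

Lemma primcos_lt k s t : - (pi / 2) <= s -> s < t -> t <= pi / 2 ->
  primcos k s < primcos k t.
Proof.
move=> ps st tp.
have d x : derivable (primcos k) x 1 by case: (der_primcos k x).
apply: (gtr0_derive1_lt_cc (a := s) (b := t)) => //.
- move=> x; rewrite in_itv/= => /andP[sx xt].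
  rewrite (der_derive1 (der_primcos k x)).2 exprn_gt0// cos_gt0_pihalf//.
  by rewrite (le_lt_trans ps)//= (lt_le_trans xt).
- by apply: continuous_subspaceT; exact: primcos_cont.
- by rewrite in_itv/= lexx ltW.
- by rewrite in_itv/= lexx ltW.
Qed.

Lemma primcos0 k : primcos k 0 = 0.
Proof.
by have := primcosN k 0; rewrite oppr0 => h; lra.
Qed.

Lemma pihalf_gt0 : 0 < pi / 2 :> R.
Proof. by rewrite divr_gt0// pi_gt0. Qed.

Lemma primcos_gt0 k t : 0 < t -> t <= pi / 2 -> 0 < primcos k t.
Proof.
move=> t0 tp; rewrite -(primcos0 k) primcos_lt// oppr_le0 ltW//.
exact: pihalf_gt0.
Qed.

(** Inverse of [primcos k] on (-pi/2, pi/2), where [primcos k] is strictly increasing; the default 0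
    is only returned outside the image of that interval. *)
Definition arcprim k v : R :=
  xget 0 [set t | - (pi / 2) < t < pi / 2 /\ primcos k t = v].

Lemma arcprimK k t : - (pi / 2) < t < pi / 2 -> arcprim k (primcos k t) = t.
Proof.
move=> tpi; rewrite /arcprim; case: xgetP => [u uE [/andP[u1 u2] utE]|/(_ t)]; last first.
  by move=> /(_ (conj tpi erefl)).
have /andP[t1 t2] := tpi.
case: (ltgtP u t) => // ut.
  by have := primcos_lt k (ltW u1) ut (ltW t2); rewrite utE ltxx.
by have := primcos_lt k (ltW t1) ut (ltW u2); rewrite utE ltxx.
Qed.

Lemma der_arcprim k t : - (pi / 2) < t < pi / 2 ->
  is_derive (primcos k t) 1 (arcprim k) (cos t ^+ k)^-1.
Proof.
move=> tpi; apply: is_derive_inverse.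
- have : t \in `](- (pi / 2)), (pi / 2)[ by rewrite in_itv.
  move=> /near_in_itvoo; apply: filterS => u.
  by rewrite in_itv/= => ?; exact: arcprimK.
- by near=> u; exact: primcos_cont.
- exact: der_primcos.
- by rewrite gt_eqF// exprn_gt0// cos_gt0_pihalf.
Unshelve. all: by end_near. Qed.

Variables (k : nat) (a : R).
Hypothesis (a0 : 0 < a) (api : a < pi / 2).

Let A := primcos k a.
(** Clamping to [-A, A] makes [qcos] continuous on the whole line with values in [-a, a], and a <
    pi/2 keeps cosines away from 0 there. Up to the parametrisation by [-A, A] instead of [0, 1],
    [qcos] is the quantile function of the law on [-a, a] with density proportional to cos^k. *)
Definition qclamp v := Num.max (- A) (Num.min A v).
Definition qcos v := arcprim k (qclamp v).

Let A0 : 0 < A. Proof. by rewrite primcos_gt0// ltW. Qed.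

Lemma qclamp_id v : - A <= v <= A -> qclamp v = v.
Proof. by move=> /andP[? ?]; rewrite /qclamp min_r// max_r. Qed.

Lemma qcos_ex v : exists2 t, - a <= t <= a & primcos k t = qclamp v.
Proof.
have aa : - a <= a by rewrite ge0_cp// ltW.
have := @IVT R (primcos k) (- a) a (qclamp v) aa.
case.
- by apply: continuous_subspaceT; exact: primcos_cont.
- rewrite primcosN -/A min_l ?max_r; try by rewrite ge0_cp// ltW.
  rewrite /qclamp le_max lexx/= ge_max ge_min lexx andbT.
  by rewrite ge0_cp// ltW.
- by move=> t; rewrite in_itv/= => ? ?; exists t.
Qed.

Lemma in_pihalf t : - a <= t <= a -> - (pi / 2) < t < pi / 2.
Proof.
move=> /andP[t1 t2]; rewrite (le_lt_trans t2)// andbT.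
by rewrite (lt_le_trans _ t1)// ltrN2.
Qed.

Lemma qcosP v : - a <= qcos v <= a /\ primcos k (qcos v) = qclamp v.
Proof.
have [t ta tE] := qcos_ex v.
by rewrite /qcos -tE arcprimK//; exact: in_pihalf.
Qed.

Lemma qcos_cont : continuous qcos.
Proof.
move=> v; have hq : qclamp u @[u --> v] --> qclamp v.
  apply: (@continuous_max _ _ (cst (- A)) (fun u => Num.min A u) v).
    exact: cvg_cst.
  apply: (@continuous_min _ _ (cst A) id v); first exact: cvg_cst.
  exact: cvg_id.
have hc : {for qclamp v, continuous (arcprim k)}.
  have [t ta tE] := qcos_ex v; rewrite -tE.
  exact: (der_continuous (der_arcprim k (in_pihalf ta))).
exact: (cvg_comp qclamp (arcprim k) hq hc).
Qed.

Lemma der_qcos v : - A < v < A ->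
  is_derive v 1 qcos (cos (qcos v) ^+ k)^-1.
Proof.
move=> vA; have /andP[v1 v2] := vA.
have [qa qE] := qcosP v.
have h := der_arcprim k (in_pihalf qa).
rewrite qE qclamp_id in h; last by rewrite !ltW.
apply: near_eq_is_derive h.
have /near_in_itvoo : v \in `](- A), A[ by rewrite in_itv.
apply: filterS => u; rewrite in_itv/= => /andP[u1 u2].
by rewrite /qcos qclamp_id// !ltW.
Qed.

Lemma qcosA : qcos A = a /\ qcos (- A) = - a.
Proof.
have aa : - a <= a by rewrite ge0_cp// ltW.
have AA : - A <= A by rewrite ge0_cp// ltW.
rewrite /qcos !qclamp_id ?lexx ?AA//.
by rewrite -primcosN !arcprimK//; apply: in_pihalf; rewrite lexx aa.
Qed.

End cos_primitive.

Arguments primcos {R} k t : simpl never.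

(** The continuous functions y / (y^2 + 1/(n+1)) converge to the inverse at every point, including y
    = 0, where the convention 0^-1 = 0 matches their common value. *)
Lemma measurable_funVr d (T : measurableType d) (R : realType) (f : T -> R) :
  measurable_fun setT f -> measurable_fun setT (fun x => (f x)^-1).
Proof.
move=> mf; pose g n (y : R) : R := y / (y ^+ 2 + n.+1%:R^-1).
have e0 n : (0 : R) < n.+1%:R^-1 by rewrite invr_gt0 ltr0n.
have cg n : continuous (g n).
  move=> y; have y0 : y ^+ 2 + n.+1%:R^-1 != 0 by rewrite gt_eqF// ltr_wpDl// sqr_ge0.
  have h := derD (derX 2 (der_id y)) (der_cst n.+1%:R^-1 y).
  have {h} := derM (der_id y) (derV (f := fun y => y ^+ 2 + n.+1%:R^-1) y0 h).
  exact: der_continuous.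
apply: (measurable_fun_cvg (h := fun n x => g n (f x))) => [n|x _].
  exact: (measurableT_comp (continuous_measurable_fun (cg n))).
have [->|fx0] := eqVneq (f x) 0.
  by rewrite /g invr0; under eq_fun do rewrite mul0r; exact: cvg_cst.
have -> : (f x)^-1 = f x / (f x ^+ 2 + 0) by rewrite addr0; field.
apply: cvgM; first exact: cvg_cst.
apply: cvgV; first by rewrite addr0 expf_neq0.
by apply: cvgD; [exact: cvg_cst|exact: cvg_harmonic].
Qed.

(** * Fundamental theorem of calculus on compact intervals *)

Section interval_calculus.
Variable R : realType.
Local Notation mu := (@lebesgue_measure R).
Implicit Types (f F : R -> R) (a b s : R).

Lemma itv_continuous f a b : (forall s, a <= s <= b -> {for s, continuous f}) ->
  {within `[a, b], continuous f}.
Proof.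
by move=> cf; apply: continuous_in_subspaceT => s; rewrite inE/= in_itv/= => /cf.
Qed.

Lemma FTC2_itv F f a b : a <= b ->
  (forall s, a < s < b -> is_derive s 1 F (f s)) ->
  (forall s, a <= s <= b -> {for s, continuous F}) ->
  (forall s, a <= s <= b -> {for s, continuous f}) ->
  \int[mu]_(s in `[a, b]) f s = F b - F a.
Proof.
rewrite le_eqVlt => /predU1P[<- _ _ _|ab dF cF cf].
  by rewrite set_itv1 Rintegral_set1 subrr.
rewrite /Rintegral (@continuous_FTC2 _ _ F)//; first exact: itv_continuous.
- split.
  + by move=> s; rewrite in_itv/= => /dF [].
  + by apply: cvg_at_right_filter; apply: cF; rewrite lexx ltW.
  + by apply: cvg_at_left_filter; apply: cF; rewrite lexx ltW.
- by move=> s; rewrite in_itv/= => /dF/der_derive1[].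
Qed.

Lemma itv_integrable f a b : (forall s, a <= s <= b -> {for s, continuous f}) ->
  mu.-integrable `[a, b] (EFin \o f).
Proof.
move=> cf; apply: continuous_compact_integrable; first exact: segment_compact.
exact: itv_continuous.
Qed.

Lemma FTC1_itv f a s : a < s -> continuous f ->
  is_derive s 1 (fun s => \int[mu]_(t in `[a, s]) f t) (f s).
Proof.
move=> a_s cf.
have i1 : mu.-integrable `[a, s + 1] (EFin \o f).
  by apply: itv_integrable => t _; exact: cf.
have [] := @continuous_FTC1_closed R f a s (s + 1) _ i1 a_s (cf s).
  by rewrite ltrDl.
by move=> d dE; exact: (DeriveDef d (etrans (esym (derive1E _ _)) dE)).
Qed.

Lemma cos_ge a s : a < pi / 2 -> - a <= s <= a -> cos a <= cos s.
Proof.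
move=> api /andP[s1 s2].
have na : `|s| <= a by rewrite ler_norml s1.
have a0 : 0 <= a by exact: le_trans na.
have ap : a <= pi by have := pi_gt0 R; lra.
by rewrite -(cos_norm s) leNgt ltr_cos -?leNgt// in_itv/= ?normr_ge0 ?a0 ?(le_trans na).
Qed.

End interval_calculus.

(** * One stage of the transport: monotone rearrangement of a conditional density *)

Section transport_stage.
Context d (X : measurableType d) (R : realType).
Local Notation mu := (@lebesgue_measure R).
Local Notation mT := (measurableTypeR R).
Variables (p : X * mT -> R) (c L a : R) (j : nat).
Hypothesis mp : measurable_fun setT p.
Hypothesis cp : forall x, continuous (fun s : R => p (x, s)).
Hypothesis c0 : 0 < c.
Hypothesis pc : forall z, c <= p z.
Hypothesis L0 : 0 < L.
Hypothesis (a0 : 0 < a) (api : a < pi / 2).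

(** The integral starts one unit to the left of -L, so that [W x] is differentiable at -L too; only
    differences of its values on [-L, L] matter. *)
Let W x s := \int[mu]_(t in `[- L - 1, s]) p (x, t).
Let A := primcos j.+2 a.

Definition marginal x := \int[mu]_(t in `[- L, L]) p (x, t).
(** The monotone map carrying the conditional law p(x, .) / [marginal] x on [-L, L] to the law
    proportional to cos^(j+2) on [-a, a]: the quotient is the conditional distribution function,
    rescaled from [0, 1] to [-A, A] before the quantile function is applied. *)
Definition angle (z : X * mT) : R :=
  qcos j.+2 a (A * (2 * ((W z.1 z.2 - W z.1 (- L)) / marginal z.1) - 1)).

Let der_W x s : - L - 1 < s -> is_derive s 1 (W x) (p (x, s)).
Proof. by move=> Ls; exact: FTC1_itv. Qed.

Let W_lt x s t : - L <= s -> s < t -> W x s < W x t.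
Proof.
move=> Ls st.
have Ls' u : s <= u -> - L - 1 < u.
  by move=> su; rewrite ltrBlDr (le_lt_trans (le_trans Ls su))// ltrDl.
apply: (gtr0_derive1_lt_cc (a := s) (b := t)); rewrite ?in_itv/= ?lexx ?ltW//.
- by move=> u; rewrite in_itv/= => /andP[/ltW/Ls' su _]; case: (der_W x su).
- move=> u; rewrite in_itv/= => /andP[/ltW/Ls' su _].
  by rewrite (der_derive1 (der_W x su)).2 (lt_le_trans c0).
- by apply: itv_continuous => u /andP[/Ls' su _]; exact: der_continuous (der_W x su).
Qed.

Lemma marginalE x : marginal x = W x L - W x (- L).
Proof.
apply: (FTC2_itv (F := W x)).
- by rewrite ge0_cp// ltW.
- by move=> s /andP[Ls _]; apply: der_W; rewrite ltrBlDr (lt_trans Ls)// ltrDl.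
- move=> s /andP[Ls _]; apply: der_continuous; apply: der_W.
  by rewrite ltrBlDr (le_lt_trans Ls)// ltrDl.
- by move=> s _; exact: cp.
Qed.

Lemma marginal_gt0 x : 0 < marginal x.
Proof. by rewrite marginalE subr_gt0 W_lt// gtrN. Qed.

Let V x s := A * (2 * ((W x s - W x (- L)) / marginal x) - 1).

Let A0 : 0 < A. Proof. by rewrite primcos_gt0// ltW. Qed.

Let V_in x s : - L < s < L -> - A < V x s < A.
Proof.
move=> /andP[Ls sL]; have m0 := marginal_gt0 x.
set q := (W x s - W x (- L)) / marginal x.
have q0 : 0 < q by rewrite divr_gt0// subr_gt0 W_lt.
have q1 : q < 1 by rewrite ltr_pdivrMr// mul1r marginalE ltrD2r W_lt// ltW.
rewrite /V -/q; have h1 : 0 < A * q by rewrite mulr_gt0.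
have h2 : 0 < A * (1 - q) by rewrite mulr_gt0// subr_gt0.
by apply/andP; split; lra.
Qed.

Let V_L x : V x L = A.
Proof. by rewrite /V -marginalE divff ?gt_eqF ?marginal_gt0//; lra. Qed.

Let V_NL x : V x (- L) = - A.
Proof. by rewrite /V subrr mul0r mulr0 sub0r mulrN1. Qed.

Let der_V x s : - L <= s ->
  is_derive s 1 (V x) (2 * A * p (x, s) / marginal x).
Proof.
move=> Ls; have h : is_derive s 1 (W x) (p (x, s)).
  by apply: der_W; rewrite ltrBlDr (le_lt_trans Ls)// ltrDl.
have := derMl A (derB (derMl 2 (derMr (marginal x)^-1 (derB h (der_cst (W x (- L)) s))))
  (der_cst 1 s)).
by move=> {}h; apply: (is_derive_eq h); rewrite !subr0; ring.
Qed.

Lemma angle_itv z : - a <= angle z <= a.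
Proof. by have [] := qcosP j.+2 a0 api (V z.1 z.2). Qed.

Lemma cos_angle z : 0 < cos a <= cos (angle z).
Proof.
rewrite cos_ge//; last exact: angle_itv.
by rewrite andbT cos_gt0_pihalf// api andbT (lt_trans _ a0)// oppr_lt0 pihalf_gt0.
Qed.

Lemma angle_cont x s : - L <= s -> {for s, continuous (fun s : R => angle (x, s))}.
Proof.
move=> Ls; have cV : V x t @[t --> s] --> V x s by exact: der_continuous (der_V x Ls).
have h : qcos j.+2 a (V x t) @[t --> s] --> qcos j.+2 a (V x s).
  have h2 := qcos_cont (k := j.+2) a0 api (x := V x s).
  exact: (cvg_comp (V x) (qcos j.+2 a) cV h2).
exact: h.
Qed.

(** The transport equation of this stage, cos^(j+2)(theta) theta' = 2 A p / [marginal]. The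
    endpoints are excluded because the derivative of [qcos] is known only strictly inside the
    clamping range. *)
Lemma der_angle x s : - L < s < L ->
  is_derive s 1 (fun s : R => angle (x, s))
    (2 * A * p (x, s) / (marginal x * cos (angle (x, s)) ^+ j.+2)).
Proof.
move=> sL; have h1 := der_qcos a0 api (V_in x sL).
have /andP[/ltW sL' _] := sL.
have h := der_comp h1 (der_V x sL').
apply: (is_derive_eq h); rewrite [in RHS]invfM -[angle (x, s)]/(qcos j.+2 a (V x s)).
by move: (_ ^-1) (marginal x)^-1 => u v; ring.
Qed.

Lemma measurable_angle : measurable_fun setT angle.
Proof.
have mW : measurable_fun setT (fun z : X * mT => W z.1 z.2).
  (* Joint measurability of W in (x, s): the moving endpoint s is put into the integrand, so that W
     becomes an integral over the whole line of a non-negative jointly measurable function. *)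
  pose f (w : (X * mT) * mT) : R :=
    if (- L - 1 <= w.2) && (w.2 <= w.1.2) then p (w.1.1, w.2) else 0.
  have mf : measurable_fun setT f.
    apply: measurable_fun_ifT => //.
    - apply: measurable_and; apply: measurable_fun_ler => //.
      exact: (measurableT_comp measurable_snd measurable_fst).
    - apply: (measurableT_comp mp); apply: measurable_fun_pair => //.
      exact: (measurableT_comp measurable_fst measurable_fst).
  have f0 w : (0 <= (f w)%:E)%E.
    by rewrite lee_fin /f; case: ifP => // _; rewrite (le_trans _ (pc _))// ltW.
  have mf' : measurable_fun setT (EFin \o f) by exact/measurable_EFinP.
  have mF := measurable_fun_fubini_tonelli_F (m2 := mu) (EFin \o f) mf' f0.
  have : measurable_fun setT (fine \o fubini_F mu (EFin \o f)) by exact: measurableT_comp.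
  congr measurable_fun; apply/funext => -[x s]; rewrite /W /=.
  rewrite Rintegral_mkcond /Rintegral /fubini_F; congr fine.
  apply: eq_integral => t _ /=; rewrite /f patchE /=.
  by rewrite mem_setE /= in_itv.
have mWL : measurable_fun setT (fun z : X * mT => W z.1 (- L)).
  apply: (measurableT_comp mW (g := fun z => (z.1, - L))).
  exact: measurable_fun_pair.
have mm : measurable_fun setT (fun z : X * mT => marginal z.1).
  under eq_fun do rewrite marginalE.
  apply: measurable_funB => //.
  apply: (measurableT_comp mW (g := fun z => (z.1, L))).
  exact: measurable_fun_pair.
apply: (measurableT_comp (continuous_measurable_fun (qcos_cont a0 api))).
apply: measurable_funM => //; apply: measurable_funB => //.
apply: measurable_funM => //; apply: measurable_funM; first exact: measurable_funB.
exact: measurable_funVr.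
Qed.

(** By the transport equation p / cos^2(theta) is a multiple of cos^j(theta) theta', so [primcos j]
    of the angle is a primitive up to a constant. In transport terms, the mean of cos^-2 under the
    law cos^(j+2) on [-a, a] is a quotient of two normalising constants. *)
Lemma angle_moment x :
  \int[mu]_(s in `[- L, L]) (p (x, s) / cos (angle (x, s)) ^+ 2) =
  marginal x * (primcos j a / primcos j.+2 a).
Proof.
have cN0 s : cos (angle (x, s)) != 0.
  by have /andP[h1 h2] := cos_angle (x, s); rewrite gt_eqF// (lt_le_trans h1).
pose F s := marginal x / (2 * A) * primcos j (angle (x, s)).
transitivity (F L - F (- L)); last first.
  have [qa qna] := qcosA j.+2 a0 api.
  have aL : angle (x, L) = a by rewrite -[RHS]qa -/A -(V_L x).
  have aNL : angle (x, - L) = - a by rewrite -[RHS]qna -/A -(V_NL x).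
  rewrite /F aL aNL primcosN -/A.
  by have := gt_eqF A0; move: A => B /negbT B0; field.
apply: (FTC2_itv (F := F)).
- by rewrite ge0_cp// ltW.
- move=> s sL; have h := derMl (marginal x / (2 * A))
    (der_comp (f := fun s : R => angle (x, s)) (der_primcos j (angle (x, s)))
      (der_angle x sL)).
  apply: (is_derive_eq h); rewrite !exprS.
  by field; rewrite expf_neq0 ?cN0//= gt_eqF ?marginal_gt0//= gt_eqF.
- move=> s /andP[sL _]; apply: cvgMr => //.
  apply: (cvg_comp (fun s : R => angle (x, s)) (primcos j)); first exact: angle_cont.
  exact: primcos_cont.
- move=> s /andP[sL _]; apply: cvgM; first exact: cp.
  apply: cvgV; first by rewrite expf_neq0.
  apply: (cvg_comp (fun s : R => angle (x, s)) (fun t => cos t ^+ 2)).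
    exact: angle_cont.
  exact: (der_continuous (derX 2 (is_derive_cos _))).
Qed.

End transport_stage.

(** * Bounded measurable functions *)

Section bounded_measurable.
Context d (T : measurableType d) (R : realType).
Implicit Types f g : T -> R.

(** A class stable under the algebra used below and integrable for every finite measure; it settles
    the integrability of all integrands on the box. *)
Definition bmeas f := measurable_fun setT f /\ exists B, forall x, `|f x| <= B.

Lemma bmeas_cst (r : R) : bmeas (fun _ => r).
Proof. by split => //; exists `|r|. Qed.

Lemma bmeasD f g : bmeas f -> bmeas g -> bmeas (fun x => f x + g x).
Proof.
move=> [mf [B fB]] [mg [C gC]]; split; first exact: measurable_funD.
by exists (B + C) => x; rewrite (le_trans (ler_normD _ _))// lerD.
Qed.

Lemma bmeasN f : bmeas f -> bmeas (fun x => - f x).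
Proof.
move=> [mf [B fB]]; split; first exact: measurableT_comp.
by exists B => x; rewrite normrN.
Qed.

Lemma bmeasB f g : bmeas f -> bmeas g -> bmeas (fun x => f x - g x).
Proof. by move=> hf hg; apply: bmeasD => //; exact: bmeasN. Qed.

Lemma bmeasM f g : bmeas f -> bmeas g -> bmeas (fun x => f x * g x).
Proof.
move=> [mf [B fB]] [mg [C gC]]; split; first exact: measurable_funM.
by exists (B * C) => x; rewrite normrM ler_pM.
Qed.

Lemma bmeasX f n : bmeas f -> bmeas (fun x => f x ^+ n).
Proof.
move=> hf; elim: n => [|n IH].
  by under eq_fun do rewrite expr0; exact: bmeas_cst.
by under eq_fun do rewrite exprS; exact: bmeasM.
Qed.

Lemma bmeasV f (c : R) : 0 < c -> (forall x, c <= f x) -> bmeas f ->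
  bmeas (fun x => (f x)^-1).
Proof.
move=> c0 cf [mf _]; split; first exact: measurable_funVr.
exists c^-1 => x; have fx0 : 0 < f x by rewrite (lt_le_trans c0).
by rewrite ger0_norm ?invr_ge0 ?(ltW fx0)// lef_pV2.
Qed.

Lemma bmeas_integrable (m : {measure set T -> \bar R}) f : (m setT < +oo)%E ->
  bmeas f -> m.-integrable setT (EFin \o f).
Proof.
move=> moo [mf [B fB]]; apply: measurable_bounded_integrable => //.
exists B; split; first exact: num_real.
by move=> M BM x _; exact: le_trans (fB x) (ltW BM).
Qed.

End bounded_measurable.

Lemma bmeas_comp d d' (T : measurableType d) (T' : measurableType d')
    (R : realType) (f : T -> R) (h : T' -> T) :
  measurable_fun setT h -> bmeas f -> bmeas (fun x => f (h x)).
Proof.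
move=> mh [mf [B fB]]; split; first exact: measurableT_comp.
by exists B => x; exact: fB.
Qed.

(** * Arithmetic-geometric mean inequality for four numbers *)

Section AGM.
Variable R : realType.

(** The two-term inequality is used on the pairs (a, b) and (c, d), giving 4 t^2 <= (a + b)(c + d),
    and then on the two sums. The geometric mean enters as a number t with t^4 = abcd, which avoids
    fourth roots. *)
Lemma AGM4 (a b c d t : R) : 0 <= a -> 0 <= b -> 0 <= c -> 0 <= d -> 0 <= t ->
  t ^+ 4 = a * b * c * d -> 4 * t <= a + b + c + d.
Proof.
move=> a0 b0 c0 d0 t0 tE.
have h1 : (a * b) * 4 <= (a + b) ^+ 2 by have := sqr_ge0 (a - b); lra.
have h2 : (c * d) * 4 <= (c + d) ^+ 2 by have := sqr_ge0 (c - d); lra.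
have h3 : 4 * t ^+ 2 <= (a + b) * (c + d).
  rewrite -(@ler_pXn2r _ 2)// ?nnegrE ?mulr_ge0 ?addr_ge0// ?exprn_ge0//.
  have -> : (4 * t ^+ 2) ^+ 2 = 16 * t ^+ 4 by ring.
  have -> : ((a + b) * (c + d)) ^+ 2 = (a + b) ^+ 2 * (c + d) ^+ 2 by ring.
  rewrite tE; apply: le_trans (ler_pM _ _ h1 h2); try by rewrite !mulr_ge0.
  by lra.
rewrite -(@ler_pXn2r _ 2)// ?nnegrE ?mulr_ge0 ?addr_ge0//.
by have := sqr_ge0 ((a + b) - (c + d)); lra.
Qed.

End AGM.

(** * Lebesgue measure restricted to [-L, L], its powers and its marginals *)

Section restricted_lebesgue.
Variables (R : realType) (L : R).
Local Notation mu := (@lebesgue_measure R).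
Local Notation mT := (measurableTypeR R).

Definition muL := mrestr mu (measurable_itv `[- L, L]).
HB.instance Definition _ := Measure.on muL.

Lemma muL_sigma_finite : sigma_finite setT muL.
Proof.
exists (fun=> setT); first by rewrite bigcup_const//; exists 0%N.
move=> _; split => //; rewrite /muL /mrestr setTI lebesgue_measure_itv/=.
by case: ifP => // _; rewrite -EFinD ltry.
Qed.

HB.instance Definition _ :=
  Measure_isSigmaFinite.Build _ _ _ muL muL_sigma_finite.

Lemma muLT : 0 < L -> muL setT = (2 * L)%:E.
Proof.
move=> L0; rewrite /muL /mrestr setTI lebesgue_measure_itv/= lte_fin gtrN//.
by rewrite -EFinD; congr EFin; lra.
Qed.

Lemma integral_muL (f : R -> R) : measurable_fun setT f ->
  \int[muL]_x f x = \int[mu]_(x in `[- L, L]) f x.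
Proof. by move=> mf; rewrite /muL Rintegral_mrestr. Qed.

Lemma pow2_muL : 0 < L -> pow2 muL setT = ((2 * L) ^+ 2)%:E.
Proof.
move=> L0; have -> : pow2 muL setT = (muL setT * muL setT)%E.
  by rewrite -setXTT; exact: product_measure1E.
by rewrite muLT// -EFinM.
Qed.

Lemma pow3_muL : 0 < L -> pow3 muL setT = ((2 * L) ^+ 3)%:E.
Proof.
move=> L0; have -> : pow3 muL setT = (pow2 muL setT * muL setT)%E.
  by rewrite -setXTT; exact: product_measure1E.
by rewrite muLT// pow2_muL// -EFinM -exprSr.
Qed.

Lemma pow4_muL : 0 < L -> pow4 muL setT = ((2 * L) ^+ 4)%:E.
Proof.
move=> L0; have -> : pow4 muL setT = (pow2 muL setT * pow2 muL setT)%E.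
  by rewrite -setXTT; exact: product_measure1E.
by rewrite pow2_muL// -EFinM -exprD.
Qed.

(** Dominated convergence with a constant majorant on [-L, L]. It hands the continuity of the
    density in each variable down to the successive marginals. *)
Lemma continuous_marginal (g : R -> mT -> R) (B : R) :
  (forall s, measurable_fun setT (g s)) -> (forall s t, `|g s t| <= B) ->
  (forall t, continuous (g ^~ t)) ->
  continuous (fun s => \int[mu]_(t in `[- L, L]) g s t).
Proof.
move=> mg gB cg s.
have bi (f : mT -> R) : measurable_fun setT f -> (forall t, `|f t| <= B) ->
    mu.-integrable `[- L, L] (EFin \o f).
  move=> mf fB; apply: measurable_bounded_integrable => //.
  - by rewrite /= lebesgue_measure_itv/=; case: ifP => // _; rewrite -EFinD ltry.
  - exact: measurable_funTS.
  - exists B; split; first exact: num_real.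
    by move=> M BM x _; exact: le_trans (fB x) (ltW BM).
have := @continuity_under_integral R _ mT mu g `[- L, L] _ (s - 1) (s + 1) _ _ (cst B).
apply => //.
- by move=> x _; exact: bi.
- by apply: aeW => y _ x _; exact: cg.
- by apply: bi => // t; rewrite ger0_norm ?lexx// (le_trans _ (gB 0 0)).
- by move=> x _; apply: aeW => y _; exact: gB.
- by rewrite inE/= in_itv/= ltrBlDr ltrDl ltr01.
Qed.

Lemma pow2_muL_fin : 0 < L -> (pow2 muL setT < +oo)%E.
Proof. by move=> L0; rewrite pow2_muL// ltry. Qed.

Lemma pow3_muL_fin : 0 < L -> (pow3 muL setT < +oo)%E.
Proof. by move=> L0; rewrite pow3_muL// ltry. Qed.

Lemma pow4_muL_fin : 0 < L -> (pow4 muL setT < +oo)%E.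
Proof. by move=> L0; rewrite pow4_muL// ltry. Qed.

Section marginal_bounds.
Context d (X : measurableType d).
Variables (p : X * mT -> R) (c B : R).
Hypotheses (L0 : 0 < L) (c0 : 0 < c) (mp : measurable_fun setT p).
Hypothesis pcB : forall z, c <= p z <= B.

Lemma marginal_muL x : marginal p L x = \int[muL]_t p (x, t).
Proof. by rewrite integral_muL//; exact: measurableT_comp. Qed.

Lemma marginal_bounds x : 2 * L * c <= marginal p L x <= 2 * L * B.
Proof.
have muLfin : (muL setT < +oo)%E by rewrite muLT// ltry.
have ic r : muL.-integrable setT (EFin \o (fun=> r)).
  exact/bmeas_integrable/bmeas_cst.
have ip : muL.-integrable setT (EFin \o (fun t => p (x, t))).
  apply: bmeas_integrable => //; split; first exact: measurableT_comp.
  exists B => t; have /andP[h1 h2] := pcB (x, t).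
  by rewrite ger0_norm// (le_trans _ h1)// ltW.
have cst r : \int[muL]_t r = 2 * L * r by rewrite Rintegral_cst//= muLT// mulrC.
rewrite marginal_muL -!cst; apply/andP; split; apply: le_Rintegral => // t _;
  by have /andP[] := pcB (x, t).
Qed.

Lemma bmeas_marginal : bmeas (marginal p L).
Proof.
split; last first.
  exists (2 * L * B) => x; have /andP[h1 h2] := marginal_bounds x.
  by rewrite ger0_norm// (le_trans _ h1)// !mulr_ge0// ltW.
have p0 z : (0 <= (p z)%:E)%E.
  by rewrite lee_fin; have /andP[h _] := pcB z; rewrite (le_trans _ h)// ltW.
have mp' : measurable_fun setT (EFin \o p) by exact/measurable_EFinP.
have mF := measurable_fun_fubini_tonelli_F (m2 := muL) (EFin \o p) mp' p0.
have : measurable_fun setT (fine \o fubini_F muL (EFin \o p)) by exact: measurableT_comp.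
by congr measurable_fun; apply/funext => x; rewrite marginal_muL.
Qed.

End marginal_bounds.

(** Slicing by Fubini; the factor (2L)^3 is the mass of the cube transverse to the i-th
    direction. *)
Lemma box_line i (E : R4 R -> R) (b : R) : 0 < L -> bmeas E ->
  (forall y, \int[mu]_(t in `[- L, L]) E (ins i t y) <= b) ->
  \int[pow4 muL]_x E x <= b * (2 * L) ^+ 3.
Proof.
move=> L0 bE Eb; have iE : (pow4 muL).-integrable setT (EFin \o E).
  exact: bmeas_integrable (pow4_muL_fin L0) bE.
have [_ h1 ->] := fubini_ins i iE.
have -> : b * (2 * L) ^+ 3 = \int[pow3 muL]_y b by rewrite Rintegral_cst//= pow3_muL.
apply: le_Rintegral => //.
  by apply: bmeas_integrable; [exact: pow3_muL_fin|exact: bmeas_cst].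
move=> y _; rewrite integral_muL; first exact: Eb.
apply: (measurableT_comp (f := fun z => E (ins i z.2 z.1)) (g := fun t => (y, t))).
  by apply: (measurableT_comp bE.1); exact: measurable_ins.
exact: measurable_fun_pair.
Qed.

End restricted_lebesgue.

(** * Flux of the transport field along a coordinate line *)

Section line_bound.
Context d (X : measurableType d) (R : realType).
Local Notation mu := (@lebesgue_measure R).
Local Notation mT := (measurableTypeR R).
Variables (p : X * mT -> R) (c L a : R) (j : nat).
Hypothesis cp : forall x, continuous (fun s : R => p (x, s)).
Hypothesis c0 : 0 < c.
Hypothesis pc : forall z, c <= p z.
Hypothesis L0 : 0 < L.
Hypothesis (a0 : 0 < a) (api : a < pi / 2).

(** The integrand is the derivative of h kap tan(theta), because tan(theta)' = theta' / cos^2(theta)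
    and theta' is given by [der_angle]. Only the two boundary values remain; there h = e, kap <= b
    and |tan(theta)| <= 1 / cos a. In use h is f^3 and kap collects the inverse cosines of the
    earlier angles, which are constant along the line. *)
Lemma line_bound (x : X) (kap e b : R) (h dh : R -> R) : 0 <= kap -> kap <= b -> 0 <= e ->
  (forall t : R, is_derive t 1 h (dh t)) -> continuous dh -> h L = e -> h (- L) = e ->
  \int[mu]_(t in `[- L, L]) (h t * (kap * (2 * primcos j.+2 a * p (x, t) /
      (marginal p L x * cos (angle p L a j (x, t)) ^+ j.+4)))
    + dh t * (kap * (sin (angle p L a j (x, t)) / cos (angle p L a j (x, t))))) <=
  2 * e * (b / cos a).
Proof.
move=> k0 kb e0 dh_h cdh hL hNL.
have ca z : 0 < cos a <= cos (angle p L a j z) by exact: cos_angle.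
have ca0 : 0 < cos a by have /andP[] := ca (x, 0).
have cN0 z : cos (angle p L a j z) != 0.
  by have /andP[h1 h2] := ca z; rewrite gt_eqF// (lt_le_trans h1).
have m0 : marginal p L x != 0 by rewrite gt_eqF// (marginal_gt0 cp c0 pc).
pose th (t : R) := angle p L a j (x, t).
pose F t := h t * (kap * (sin (th t) / cos (th t))).
have tanb t : `|sin (th t) / cos (th t)| <= (cos a)^-1.
  have /andP[_ h2] := ca (x, t).
  rewrite normrM normfV [X in _ / X]gtr0_norm; last exact: lt_le_trans h2.
  rewrite ler_pdivrMr; last exact: lt_le_trans h2.
  apply: (le_trans (sin_max _)); rewrite mulrC ler_pdivlMr// mul1r.
  exact: h2.
have Fb t : h t = e -> `|F t| <= e * (b / cos a).
  move=> hte; rewrite /F hte normrM (ger0_norm e0) ler_wpM2l//.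
  by rewrite normrM (ger0_norm k0) ler_pM.
have cth t : - L <= t -> {for t, continuous th}.
  by move=> Lt; exact: (angle_cont cp a0 api).
have c1 t : - L <= t -> {for t, continuous (fun t => cos (th t))}.
  move=> Lt; apply: (cvg_comp th cos); first exact: cth.
  exact: continuous_cos.
have c2 t : - L <= t -> {for t, continuous (fun t => sin (th t))}.
  move=> Lt; apply: (cvg_comp th sin); first exact: cth.
  exact: continuous_sin.
have c3 t : - L <= t -> {for t, continuous (fun t => sin (th t) / cos (th t))}.
  by move=> Lt; apply: cvgM; [exact: c2|apply: cvgV; [exact: cN0|exact: c1]].
have ch t : {for t, continuous h} by exact: der_continuous (dh_h t).
have -> : \int[mu]_(t in `[- L, L]) (h t * (kap * (2 * primcos j.+2 a * p (x, t) /
      (marginal p L x * cos (th t) ^+ j.+4)))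
    + dh t * (kap * (sin (th t) / cos (th t)))) = F L - F (- L).
  apply: (FTC2_itv (F := F)).
  - by rewrite ge0_cp// ltW.
  - move=> t tL; have dth := der_angle j cp c0 pc L0 a0 api x tL.
    have h1 := der_comp (f := th) (is_derive_sin (th t)) dth.
    have h2 := der_comp (f := th) (is_derive_cos (th t)) dth.
    have h3 := derMl kap (derM h1 (derV (f := fun t => cos (th t)) (cN0 (x, t)) h2)).
    have := derM (dh_h t) h3.
    move=> {}h3; apply: (is_derive_eq h3).
    have sc : sin (th t) * sin (th t) = 1 - cos (th t) * cos (th t).
      by rewrite -!expr2 -(cos2Dsin2 (th t)); ring.
    rewrite addrC; congr (_ * _ + _); congr (_ * _).
    rewrite -/(th t).
    set q := 2 * _ * _ / _.
    transitivity (q * (cos (th t) * cos (th t) + sin (th t) * sin (th t)) / cos (th t) ^+ 2).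
      by field; exact: (cN0 (x, t)).
    rewrite sc /q !exprS expr0 !mulr1.
    have : cos (th t) != 0 by exact: (cN0 (x, t)).
    move: (cos (th t)) => k kN0.
    by field; rewrite m0 kN0 /= expf_neq0.
  - by move=> t /andP[Lt _]; apply: cvgM; [exact: ch|apply: cvgMr; exact: c3].
  - move=> t /andP[Lt _]; apply: cvgD; apply: cvgM; [exact: ch| |exact: cdh|].
      apply: cvgMr; apply: cvgM; first by apply: cvgMr; exact: cp.
      apply: cvgV; first by rewrite mulf_neq0// expf_neq0//; exact: (cN0 (x, t)).
      apply: cvgMr.
      apply: (cvg_comp (fun t => cos (th t)) (fun z => z ^+ j.+4)); first exact: c1.
      exact: (der_continuous (derX j.+4 (der_id _))).
    by apply: cvgMr; exact: c3.
have := Fb L hL; have := Fb (- L) hNL.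
rewrite !ler_norml => /andP[h1 h2] /andP[h3 h4]; lra.
Qed.

End line_bound.

(** * The pointwise inequality behind the transport argument *)

Section pointwise_inequality.
Variable R : realType.

(** Young's inequality with weight l for the product of the derivative d and f u T, followed by u^2
    <= f^2. *)
Lemma young_line (f u d T l : R) : 0 < f -> u ^+ 2 <= f ^+ 2 -> 0 < l ->
  - (3 / 2 * (l * d ^+ 2 + l^-1 * (f ^+ 4 * T ^+ 2))) <= 3 * f * u * d * T.
Proof.
move=> f0 uf l0.
have h1 : 0 <= l * d ^+ 2 + l^-1 * (f ^+ 2 * (u ^+ 2) * T ^+ 2) + 2 * (f * u * d * T).
  have -> : l * d ^+ 2 + l^-1 * (f ^+ 2 * (u ^+ 2) * T ^+ 2) + 2 * (f * u * d * T) =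
    l^-1 * (l * d + f * u * T) ^+ 2 by field; rewrite gt_eqF.
  by rewrite mulr_ge0 ?sqr_ge0// invr_ge0 ltW.
have h2 : l^-1 * (f ^+ 2 * (u ^+ 2) * T ^+ 2) <= l^-1 * (f ^+ 4 * T ^+ 2).
  rewrite ler_wpM2l ?invr_ge0 ?(ltW l0)// ler_wpM2r ?sqr_ge0//.
  by rewrite -[4%N]/(2 + 2)%N exprD ler_wpM2l// sqr_ge0.
by lra.
Qed.

(** The right-hand side is div(f^3 T) written out for a triangular map T whose i-th component is s_i
    / (c_1 ... c_i). The arithmetic-geometric inequality bounds f^3 div T from below and Young's
    inequality bounds the terms containing grad f^3. Here c_i and s_i stand for the cosine and sine
    of the i-th angle, P_i for the marginals of the density f^4, M for its total mass, and d_i for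
    the partial derivatives of u. *)
Lemma divergence_ge (c1 c2 c3 c4 s1 s2 s3 s4 A1 A2 A3 A4 P1 P2 P3 M f u
    d1 d2 d3 d4 k l : R) :
  0 < c1 -> 0 < c2 -> 0 < c3 -> 0 < c4 ->
  s1 ^+ 2 = 1 - c1 ^+ 2 -> s2 ^+ 2 = 1 - c2 ^+ 2 ->
  s3 ^+ 2 = 1 - c3 ^+ 2 -> s4 ^+ 2 = 1 - c4 ^+ 2 ->
  0 < A1 -> 0 < A2 -> 0 < A3 -> 0 < A4 -> 0 < P1 -> 0 < P2 -> 0 < P3 -> 0 < M ->
  0 < f -> u ^+ 2 <= f ^+ 2 -> 0 < k -> 0 < l ->
  k ^+ 4 = A1 * A2 * A3 * A4 / M ->
  4 * k * (f ^+ 4 * (c1 * c2 * c3 * c4) ^- 2) -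
  3 / 2 * (l * (d1 ^+ 2 + d2 ^+ 2 + d3 ^+ 2 + d4 ^+ 2) +
    l^-1 * (f ^+ 4 * ((c1 * c2 * c3 * c4) ^- 2 - 1))) <=
  f ^+ 3 * (1 * (A1 * P1 / (M * c1 ^+ 5))) + 3 * f * u * d1 * (1 * (s1 / c1)) +
  (f ^+ 3 * (c1^-1 * (A2 * P2 / (P1 * c2 ^+ 6))) +
    3 * f * u * d2 * (c1^-1 * (s2 / c2))) +
  (f ^+ 3 * ((c1 * c2)^-1 * (A3 * P3 / (P2 * c3 ^+ 7))) +
    3 * f * u * d3 * ((c1 * c2)^-1 * (s3 / c3))) +
  (f ^+ 3 * ((c1 * c2 * c3)^-1 * (A4 * f ^+ 4 / (P3 * c4 ^+ 8))) +
    3 * f * u * d4 * ((c1 * c2 * c3)^-1 * (s4 / c4))).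
Proof.
move=> c10 c20 c30 c40 e1 e2 e3 e4 A10 A20 A30 A40 P10 P20 P30 M0 f0 uf k0 l0 kE.
set D1 := 1 * (A1 * P1 / _); set D2 := c1^-1 * (A2 * P2 / _).
set D3 := (c1 * c2)^-1 * (A3 * P3 / _); set D4 := (c1 * c2 * c3)^-1 * (A4 * _ / _).
set T1 := 1 * (s1 / c1); set T2 := c1^-1 * (s2 / c2).
set T3 := (c1 * c2)^-1 * (s3 / c3); set T4 := (c1 * c2 * c3)^-1 * (s4 / c4).
set Y := (c1 * c2 * c3 * c4) ^- 2.
have D10 : 0 < D1 by rewrite /D1 mul1r !(mulr_gt0, invr_gt0, exprn_gt0).
have D20 : 0 < D2.
  by rewrite /D2 !(mulr_gt0, invr_gt0, exprn_gt0).
have D30 : 0 < D3.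
  by rewrite /D3 !(mulr_gt0, invr_gt0, exprn_gt0).
have D40 : 0 < D4.
  by rewrite /D4 !(mulr_gt0, invr_gt0, exprn_gt0).
have Y0 : 0 < Y by rewrite /Y !(mulr_gt0, invr_gt0, exprn_gt0).
(* |T|^2 = Y - 1: with s_i^2 = 1 - c_i^2 the sum telescopes. *)
have TY : T1 ^+ 2 + T2 ^+ 2 + T3 ^+ 2 + T4 ^+ 2 = Y - 1.
  transitivity (s1 ^+ 2 / c1 ^+ 2 + s2 ^+ 2 / (c1 * c2) ^+ 2 +
      s3 ^+ 2 / (c1 * c2 * c3) ^+ 2 + s4 ^+ 2 / (c1 * c2 * c3 * c4) ^+ 2).
    by rewrite /T1 /T2 /T3 /T4; field; rewrite !gt_eqF.
  by rewrite e1 e2 e3 e4 /Y; field; rewrite !gt_eqF.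
(* Jacobian of the triangular map: the intermediate marginals P_i cancel in the product and every
   cosine collects the exponent -8. *)
have DE : (k * f * Y) ^+ 4 = D1 * D2 * D3 * D4.
  rewrite !exprMn kE /D1 /D2 /D3 /D4 /Y.
  by field; rewrite !gt_eqF.
have AG : 4 * (k * f * Y) <= D1 + D2 + D3 + D4.
  by apply: AGM4 => //; try exact: ltW; rewrite !mulr_ge0// ltW.
have AG' : 4 * k * (f ^+ 4 * Y) <= f ^+ 3 * (D1 + D2 + D3 + D4).
  have -> : 4 * k * (f ^+ 4 * Y) = f ^+ 3 * (4 * (k * f * Y)) by ring.
  by rewrite ler_wpM2l// exprn_ge0// ltW.
have Z1 := young_line d1 T1 f0 uf l0; have Z2 := young_line d2 T2 f0 uf l0.
have Z3 := young_line d3 T3 f0 uf l0; have Z4 := young_line d4 T4 f0 uf l0.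
have -> : l^-1 * (f ^+ 4 * (Y - 1)) = l^-1 * (f ^+ 4 * T1 ^+ 2) +
    l^-1 * (f ^+ 4 * T2 ^+ 2) + l^-1 * (f ^+ 4 * T3 ^+ 2) + l^-1 * (f ^+ 4 * T4 ^+ 2).
  by rewrite -TY; ring.
by move: AG' Z1 Z2 Z3 Z4; clearbody Y D1 D2 D3 D4 T1 T2 T3 T4; lra.
Qed.

Lemma sum4_le (e1 e2 e3 e4 b : R) : e1 <= b -> e2 <= b -> e3 <= b -> e4 <= b ->
  e1 + e2 + e3 + e4 <= 4 * b.
Proof. by move=> *; lra. Qed.

(** Bookkeeping for the Young weight l = 1 / (2k): of the 4 k M m gained from the divergence, 3 k M
    m is spent on the |T|^2 term. *)
Lemma collect_terms (k M m K b : R) : 0 < k ->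
  4 * k * (M * m) - 3 / 2 * ((2 * k)^-1 * K + 2 * k * (M * m - M)) <= b ->
  k * M * (m + 3) - 3 / (4 * k) * K <= b.
Proof.
move=> k0; apply: le_trans; rewrite le_eqVlt; apply/orP; left; apply/eqP.
by field; rewrite gt_eqF.
Qed.

End pointwise_inequality.

(** * Mass and moment of a density through one stage *)

Section stage_integral.
Context d (X : measurableType d) (R : realType).
Local Notation mT := (measurableTypeR R).
Variable m : {sigma_finite_measure set X -> \bar R}.
Variables (L a : R) (p : X * mT -> R) (w : X -> R) (j : nat).
Hypotheses (L0 : 0 < L) (a0 : 0 < a) (api : a < pi / 2).
Hypothesis cp : forall x, continuous (fun s : R => p (x, s)).
Hypothesis bp : exists c C, 0 < c /\ forall z, c <= p z <= C.
Hypothesis mp : measurable_fun setT p.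
Hypothesis bw : bmeas w.
Hypothesis mfin : (m setT < +oo)%E.

Let pm := pmeasure m (muL L).

Let pm_fin : (pm setT < +oo)%E.
Proof.
have -> : pm setT = (m setT * muL L setT)%E.
  by rewrite -setXTT; exact: product_measure1E.
have m0 : (0 <= m setT)%E by [].
by rewrite muLT//; apply: lte_mul_pinfty => //; [rewrite ge0_fin_numE|rewrite ltry].
Qed.

Let bpp : bmeas p.
Proof.
split=> //; have [c [C [c0 h]]] := bp; exists C => z; have /andP[h1 h2] := h z.
by rewrite ger0_norm// (le_trans (ltW c0)).
Qed.

Let bmarg : bmeas (marginal p L).
Proof. by have [c [C [c0 h]]] := bp; exact: (bmeas_marginal L0 c0 mp h). Qed.

Lemma stage_mass :
  \int[pm]_z (w z.1 * p z) = \int[m]_x (w x * marginal p L x).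
Proof.
have bwp : bmeas (fun z : X * mT => w z.1 * p z).
  exact: bmeasM (bmeas_comp measurable_fst bw) bpp.
have [_ _ ->] := fubiniR1 (bmeas_integrable pm_fin bwp).
apply: eq_Rintegral => x _ /=; rewrite RintegralZl//; last first.
  apply: bmeas_integrable; first by rewrite /= muLT// ltry.
  by apply: bmeas_comp bpp; exact: measurable_fun_pair.
by rewrite marginal_muL.
Qed.

(** [angle_moment] holds for every x with the same constant, so a weight depending only on the
    earlier coordinates passes through and the constants multiply from stage to stage. *)
Lemma stage_moment :
  \int[pm]_z (w z.1 * (p z / cos (angle p L a j z) ^+ 2)) =
  \int[m]_x (w x * marginal p L x) * (primcos j a / primcos j.+2 a).
Proof.
have [c [C [c0 h]]] := bp.
have pc z : c <= p z by have /andP[] := h z.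
have ca z : 0 < cos a <= cos (angle p L a j z) by exact: cos_angle.
have bq : bmeas (fun z : X * mT => p z / cos (angle p L a j z) ^+ 2).
  apply: bmeasM => //; under eq_fun do rewrite -exprVn; apply: bmeasX.
  have ca0 : 0 < cos a.
    by rewrite cos_gt0_pihalf// api andbT (lt_trans _ a0)// oppr_lt0 pihalf_gt0.
  apply: (bmeasV ca0); first by move=> z; have /andP[] := ca z.
  split; last by exists 1 => z; exact: cos_max.
  apply: (measurableT_comp (continuous_measurable_fun (@continuous_cos R))).
  exact: (measurable_angle j mp cp c0 pc).
have bwq : bmeas (fun z : X * mT => w z.1 * (p z / cos (angle p L a j z) ^+ 2)).
  exact: bmeasM (bmeas_comp measurable_fst bw) bq.
have [_ _ ->] := fubiniR1 (bmeas_integrable pm_fin bwq).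
rewrite -RintegralZr//; last exact: bmeas_integrable mfin (bmeasM bw bmarg).
have bqx x : bmeas (fun s : mT => p (x, s) / cos (angle p L a j (x, s)) ^+ 2).
  by apply: (bmeas_comp _ bq); exact: measurable_fun_pair.
apply: eq_Rintegral => x _ /=; rewrite RintegralZl//; last first.
  by apply: bmeas_integrable (bqx x); rewrite /= muLT// ltry.
rewrite integral_muL; last exact: (bqx x).1.
by rewrite (angle_moment j cp c0 pc L0 a0 api x); exact: mulrA.
Qed.

End stage_integral.

(** * The Knothe map on a box and the resulting inequality *)

Section box_inequality.
Variable R : realType.
Local Notation mu := (@lebesgue_measure R).
Local Notation mT := (measurableTypeR R).
Variables (u : R4 R -> R) (du : 'I_4 -> R4 R -> R) (B L eps a : R).
Hypothesis meas_u : measurable_fun setT u.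
Hypothesis meas_du : forall i, measurable_fun setT (du i).
Hypothesis u_B : forall x, `|u x| <= B.
Hypothesis du_B : forall i x, `|du i x| <= B.
Hypothesis der_u : forall i y (t : R),
  is_derive t 1 (fun t => u (ins i t y)) (du i (ins i t y)).
Hypothesis cont_du : forall i y, continuous (fun t : R => du i (ins i t y)).
Hypothesis supp_u : forall i y t, L <= `|t| -> u (ins i t y) = 0.
Hypotheses (L0 : 0 < L) (eps0 : 0 < eps) (a0 : 0 < a) (api : a < pi / 2).

Let o0 : 'I_4 := @Ordinal 4 0 isT.
Let o1 : 'I_4 := @Ordinal 4 1 isT.
Let o2 : 'I_4 := @Ordinal 4 2 isT.
Let o3 : 'I_4 := @Ordinal 4 3 isT.

(** f = sqrt(u^2 + eps^2) is a differentiable substitute for |u| that stays above eps, so that the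
    density rho = f^4 and its marginals are bounded away from 0 and all quotients make sense. *)
Let g x := u x ^+ 2 + eps ^+ 2.
Let f x := Num.sqrt (g x).
Let rho x := g x ^+ 2.

Let g_gt0 x : 0 < g x.
Proof. by rewrite ltr_wpDl// ?sqr_ge0// exprn_gt0. Qed.

Let f_gt0 x : 0 < f x. Proof. by rewrite sqrtr_gt0. Qed.

Let f2 x : f x ^+ 2 = g x. Proof. by rewrite sqr_sqrtr// ltW. Qed.

Let rhoE x : rho x = f x ^+ 4. Proof. by rewrite /rho -f2 -exprM. Qed.

Let bu : bmeas u. Proof. by split => //; exists B. Qed.
Let bdu i : bmeas (du i). Proof. by split => //; exists B => x; exact: du_B. Qed.
Let bg : bmeas g. Proof. exact/bmeasD/bmeas_cst/bmeasX. Qed.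
Let brho : bmeas rho. Proof. exact: bmeasX. Qed.

Let bf : bmeas f.
Proof.
split.
  apply: (measurableT_comp (continuous_measurable_fun (@sqrt_continuous R))).
  exact: bg.1.
have [_ [C gC]] := bg; exists (C + 1) => x.
rewrite (ger0_norm (sqrtr_ge0 _)) -(@ler_pXn2r _ 2)// ?nnegrE ?sqrtr_ge0//.
  rewrite f2 (le_trans (ler_norm _))// (le_trans (gC x))//.
  have C0 : 0 <= C by rewrite (le_trans _ (gC x)).
  by rewrite expr2; nra.
by rewrite addr_ge0// (le_trans _ (gC x)).
Qed.

Let rho_bounds : exists2 C, 0 < C & forall x, eps ^+ 4 <= rho x <= C.
Proof.
have [_ [C rC]] := brho; exists (C + 1).
  by rewrite ltr_wpDl// (le_trans _ (rC ((0, 0), (0, 0)))).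
move=> x; apply/andP; split; last first.
  by rewrite (le_trans (ler_norm _))// (le_trans (rC x))// lerDl.
rewrite /rho (exprM eps 2 2) ler_pXn2r ?nnegrE ?sqr_ge0//; last exact: ltW.
by rewrite /g lerDr sqr_ge0.
Qed.

Let c_u i y : continuous (fun t : R => u (ins i t y)).
Proof. by move=> t; exact: der_continuous (der_u i y t). Qed.

Let c_rho i y : continuous (fun t : R => rho (ins i t y)).
Proof.
move=> t; have h := derX 2 (derD (derX 2 (der_u i y t)) (der_cst (eps ^+ 2) t)).
exact: der_continuous h.
Qed.

Let der_f i y (t : R) : is_derive t 1 (fun t => f (ins i t y))
  (u (ins i t y) * du i (ins i t y) / f (ins i t y)).
Proof.
have h := derD (derX 2 (der_u i y t)) (der_cst (eps ^+ 2) t).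
have h1 := is_derive1_sqrt (g_gt0 (ins i t y)).
have := der_comp (f := fun t => g (ins i t y)) h1 h.
move=> {}h; apply: (is_derive_eq h); rewrite addr0 expr1.
rewrite -/(f _); move: (f_gt0 (ins i t y)) => f0.
by field; rewrite gt_eqF.
Qed.

(** Successive marginals of rho, integrating out the fourth, third and second coordinate; the last
    integration gives the total mass M. The i-th stage of the map disintegrates the i-th marginal
    along the i-th coordinate. *)
Let p4 (z : ((mT * mT) * mT) * mT) : R := rho (ins o3 z.2 z.1).
Let p3 : (mT * mT) * mT -> R := marginal p4 L.
Let p2 : mT * mT -> R := marginal p3 L.
(** The dummy first component gives this function of one variable the product shape required by the
    stage lemmas; it is always evaluated at 0. *)
Let p1 (z : mT * mT) : R := marginal p2 L z.2.
Let M : R := marginal p1 L 0.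

Let mp4 : measurable_fun setT p4.
Proof. by apply: (measurableT_comp brho.1); exact: measurable_ins. Qed.

Let bd4 : exists c C, 0 < c /\ forall z, c <= p4 z <= C.
Proof.
have [C C0 h] := rho_bounds; exists (eps ^+ 4), C.
by split=> [|z]; [rewrite exprn_gt0|exact: h].
Qed.

Let marg_bd d (X : measurableType d) (p : X * mT -> R) : measurable_fun setT p ->
  (exists c C, 0 < c /\ forall z, c <= p z <= C) ->
  bmeas (marginal p L) /\
  exists c C, 0 < c /\ forall x, c <= marginal p L x <= C.
Proof.
move=> mp [c [C [c0 h]]]; split; first exact: (bmeas_marginal L0 c0 mp h).
exists (2 * L * c), (2 * L * C); split; first by rewrite !mulr_gt0.
by move=> x; exact: (marginal_bounds L0 c0 mp h).
Qed.

Let bm3 : bmeas p3. Proof. by have [] := marg_bd mp4 bd4. Qed.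
Let bd3 : exists c C, 0 < c /\ forall z, c <= p3 z <= C.
Proof. by have [] := marg_bd mp4 bd4. Qed.
Let bm2 : bmeas p2. Proof. by have [] := marg_bd bm3.1 bd3. Qed.
Let bd2 : exists c C, 0 < c /\ forall z, c <= p2 z <= C.
Proof. by have [] := marg_bd bm3.1 bd3. Qed.
Let bm1 : bmeas p1.
Proof. by have [h _] := marg_bd bm2.1 bd2; exact: (bmeas_comp measurable_snd h). Qed.
Let bd1 : exists c C, 0 < c /\ forall z, c <= p1 z <= C.
Proof.
have [_ [c [C [c0 h]]]] := marg_bd bm2.1 bd2.
by exists c, C; split => // z; exact: h.
Qed.

Let norm_bd T (p : T -> R) : (exists c C, 0 < c /\ forall z, c <= p z <= C) ->
  exists C, forall z, `|p z| <= C.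
Proof.
move=> [c [C [c0 h]]]; exists C => z; have /andP[h1 h2] := h z.
by rewrite ger0_norm// (le_trans (ltW c0)).
Qed.

(* continuity of the marginals in each remaining variable separately *)
Let cp4 y : continuous (fun s : R => p4 (y, s)).
Proof. exact: c_rho. Qed.

Let cp3_ (h : R -> (mT * mT) * mT) :
  (forall t, exists i y, forall s, ins o3 t (h s) = ins i s y) ->
  continuous (fun s => p3 (h s)).
Proof.
move=> hy; have [C hC] := norm_bd bd4.
apply: (@continuous_marginal R L (fun s t => p4 (h s, t)) C).
- by move=> s; apply: (measurableT_comp mp4); exact: measurable_fun_pair.
- by move=> s t; exact: hC.
- move=> t; have [i [y h']] := hy t.
  suff <- : (fun s => rho (ins i s y)) = (fun s => p4 (h s, t)) by exact: c_rho.
  by apply/funext => s; rewrite /p4 /= h'.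
Qed.

Let cp3 c : continuous (fun s : R => p3 (c, s)).
Proof. by apply: cp3_ => t; exists o2, (c, t). Qed.

Let cp2_ (h : R -> mT * mT) :
  (forall t : mT, continuous (fun s => p3 (h s, t))) ->
  continuous (fun s => p2 (h s)).
Proof.
move=> hy; have [C hC] := norm_bd bd3.
have h1 (s : R) : measurable_fun setT (fun t : mT => p3 (h s, t)).
  by apply: (measurableT_comp bm3.1); exact: measurable_fun_pair.
have h2 (s : R) (t : mT) : `|p3 (h s, t)| <= C by exact: hC.
exact: (@continuous_marginal R L (fun s t => p3 (h s, t)) C h1 h2 hy).
Qed.

Let cp2 x1 : continuous (fun s : R => p2 (x1, s)).
Proof. by apply: cp2_ => t; apply: cp3_ => r; exists o1, ((x1, t), r). Qed.

Let cp1 x0 : continuous (fun s : R => p1 (x0, s)).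
Proof.
have [C hC] := norm_bd bd2.
have h1 (s : R) : measurable_fun setT (fun t : mT => p2 (s, t)).
  by apply: (measurableT_comp bm2.1); exact: measurable_fun_pair.
have h2 (s : R) (t : mT) : `|p2 (s, t)| <= C by exact: hC.
have h3 (t : mT) : continuous (fun s : R => p2 (s, t)).
  by apply: cp2_ => r; apply: cp3_ => q; exists o0, ((t, r), q).
exact: (@continuous_marginal R L (fun s t => p2 (s, t)) C h1 h2 h3).
Qed.

(** Angles of the Knothe map T, with T_i = tan(th_i) / (cos th_1 ... cos th_(i-1)). In these
    coordinates (1 + |y|^2)^-4 dy becomes cos^3 cos^4 cos^5 cos^6 of the four angles, which explains
    the indices 1, 2, 3, 4: stage j uses the law cos^(j+2). *)
Let th1 (x : R4 R) := angle p1 L a 1 (0, x.1.1).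
Let th2 (x : R4 R) := angle p2 L a 2 (x.1.1, x.1.2).
Let th3 (x : R4 R) := angle p3 L a 3 ((x.1.1, x.1.2), x.2.1).
Let th4 (x : R4 R) := angle p4 L a 4 (((x.1.1, x.1.2), x.2.1), x.2.2).
Let C1 x := cos (th1 x).
Let C2 x := cos (th2 x).
Let C3 x := cos (th3 x).
Let C4 x := cos (th4 x).

Let ca1 x : 0 < cos a <= C1 x. Proof. exact: cos_angle. Qed.
Let ca2 x : 0 < cos a <= C2 x. Proof. exact: cos_angle. Qed.
Let ca3 x : 0 < cos a <= C3 x. Proof. exact: cos_angle. Qed.
Let ca4 x : 0 < cos a <= C4 x. Proof. exact: cos_angle. Qed.
Let ca0 : 0 < cos a. Proof. by have /andP[] := ca1 ((0, 0), (0, 0)). Qed.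
Let C10 x : 0 < C1 x. Proof. by have /andP[h1 h2] := ca1 x; exact: lt_le_trans h2. Qed.
Let C20 x : 0 < C2 x. Proof. by have /andP[h1 h2] := ca2 x; exact: lt_le_trans h2. Qed.
Let C30 x : 0 < C3 x. Proof. by have /andP[h1 h2] := ca3 x; exact: lt_le_trans h2. Qed.
Let C40 x : 0 < C4 x. Proof. by have /andP[h1 h2] := ca4 x; exact: lt_le_trans h2. Qed.

(** The diagonal derivatives of T; since T is triangular, they determine both its divergence and its
    Jacobian. *)
Let D1 x := 1 * (2 * primcos 3 a * p1 (0, x.1.1) / (M * C1 x ^+ 5)).
Let D2 x := (C1 x)^-1 * (2 * primcos 4 a * p2 (x.1.1, x.1.2) /
  (p1 (0, x.1.1) * C2 x ^+ 6)).
Let D3 x := (C1 x * C2 x)^-1 * (2 * primcos 5 a * p3 ((x.1.1, x.1.2), x.2.1) /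
  (p2 (x.1.1, x.1.2) * C3 x ^+ 7)).
Let D4 x := (C1 x * C2 x * C3 x)^-1 * (2 * primcos 6 a * rho x /
  (p3 ((x.1.1, x.1.2), x.2.1) * C4 x ^+ 8)).
(** The i-th of these functions is the derivative of f^3 T_i in the i-th variable, expanded by the
    product rule with (f^3)' = 3 f u u'. Their sum is div(f^3 T). *)
Let E1 x := f x ^+ 3 * D1 x + 3 * f x * u x * du o0 x * (1 * (sin (th1 x) / C1 x)).
Let E2 x := f x ^+ 3 * D2 x +
  3 * f x * u x * du o1 x * ((C1 x)^-1 * (sin (th2 x) / C2 x)).
Let E3 x := f x ^+ 3 * D3 x +
  3 * f x * u x * du o2 x * ((C1 x * C2 x)^-1 * (sin (th3 x) / C3 x)).
Let E4 x := f x ^+ 3 * D4 x +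
  3 * f x * u x * du o3 x * ((C1 x * C2 x * C3 x)^-1 * (sin (th4 x) / C4 x)).

Let m11 : measurable_fun setT (fun x : (mT * mT) * (mT * mT) => x.1.1).
Proof. exact: (measurableT_comp measurable_fst measurable_fst). Qed.
Let m12 : measurable_fun setT (fun x : (mT * mT) * (mT * mT) => x.1.2).
Proof. exact: (measurableT_comp measurable_snd measurable_fst). Qed.
Let m21 : measurable_fun setT (fun x : (mT * mT) * (mT * mT) => x.2.1).
Proof. exact: (measurableT_comp measurable_fst measurable_snd). Qed.
Let m22 : measurable_fun setT (fun x : (mT * mT) * (mT * mT) => x.2.2).
Proof. exact: (measurableT_comp measurable_snd measurable_snd). Qed.
Let mx1 : measurable_fun setT (fun x : (mT * mT) * (mT * mT) => ((0 : mT), x.1.1)).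
Proof. exact: measurable_fun_pair. Qed.
Let mx2 : measurable_fun setT (fun x : (mT * mT) * (mT * mT) => (x.1.1, x.1.2)).
Proof. exact: measurable_fun_pair. Qed.
Let mx3 : measurable_fun setT
  (fun x : (mT * mT) * (mT * mT) => ((x.1.1, x.1.2), x.2.1)).
Proof. exact: measurable_fun_pair. Qed.
Let mx4 : measurable_fun setT
  (fun x : (mT * mT) * (mT * mT) => (((x.1.1, x.1.2), x.2.1), x.2.2)).
Proof. exact: measurable_fun_pair. Qed.

Let mangle d (X : measurableType d) (p : X * mT -> R) j : measurable_fun setT p ->
  (forall x, continuous (fun s : R => p (x, s))) ->
  (exists c C, 0 < c /\ forall z, c <= p z <= C) ->
  measurable_fun setT (angle p L a j).
Proof.
move=> mp cp [c [C [c0 h]]].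
by apply: (measurable_angle j mp cp c0) => // z; have /andP[] := h z.
Qed.

Let mth1 : measurable_fun setT th1.
Proof. exact: (measurableT_comp (mangle 1 bm1.1 cp1 bd1) mx1). Qed.
Let mth2 : measurable_fun setT th2.
Proof. exact: (measurableT_comp (mangle 2 bm2.1 cp2 bd2) mx2). Qed.
Let mth3 : measurable_fun setT th3.
Proof. exact: (measurableT_comp (mangle 3 bm3.1 cp3 bd3) mx3). Qed.
Let mth4 : measurable_fun setT th4.
Proof. exact: (measurableT_comp (mangle 4 mp4 cp4 bd4) mx4). Qed.

Let bcos (th : R4 R -> R) : measurable_fun setT th -> bmeas (fun x => cos (th x)).
Proof.
move=> mth; split; last by exists 1 => x; exact: cos_max.
exact: (measurableT_comp (continuous_measurable_fun (@continuous_cos R))).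
Qed.
Let bsin (th : R4 R -> R) : measurable_fun setT th -> bmeas (fun x => sin (th x)).
Proof.
move=> mth; split; last by exists 1 => x; exact: sin_max.
exact: (measurableT_comp (continuous_measurable_fun (@continuous_sin R))).
Qed.

Let bcosV (C : R4 R -> R) : bmeas C -> (forall x, 0 < cos a <= C x) ->
  bmeas (fun x => (C x)^-1).
Proof. by move=> bC h; apply: (bmeasV ca0) => // x; have /andP[] := h x. Qed.

Let bposV (p : R4 R -> R) : bmeas p ->
  (exists c C, 0 < c /\ forall z, c <= p z <= C) -> bmeas (fun x => (p x)^-1).
Proof.
by move=> bp [c [C [c0 h]]]; apply: (bmeasV c0) => // x; have /andP[] := h x.
Qed.

Let bq1 : bmeas (fun x : R4 R => p1 (0, x.1.1)).
Proof. exact: (bmeas_comp mx1 bm1). Qed.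
Let bq2 : bmeas (fun x : R4 R => p2 (x.1.1, x.1.2)).
Proof. exact: (bmeas_comp mx2 bm2). Qed.
Let bq3 : bmeas (fun x : R4 R => p3 ((x.1.1, x.1.2), x.2.1)).
Proof. exact: (bmeas_comp mx3 bm3). Qed.
Let bq1V : bmeas (fun x : R4 R => (p1 (0, x.1.1))^-1).
Proof.
have [c [C [c0 h]]] := bd1; apply: (bposV bq1).
by exists c, C; split => // x; exact: h.
Qed.
Let bq2V : bmeas (fun x : R4 R => (p2 (x.1.1, x.1.2))^-1).
Proof.
have [c [C [c0 h]]] := bd2; apply: (bposV bq2).
by exists c, C; split => // x; exact: h.
Qed.
Let bq3V : bmeas (fun x : R4 R => (p3 ((x.1.1, x.1.2), x.2.1))^-1).
Proof.
have [c [C [c0 h]]] := bd3; apply: (bposV bq3).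
by exists c, C; split => // x; exact: h.
Qed.
Let bC1V : bmeas (fun x => (C1 x)^-1). Proof. exact/bcosV/ca1/bcos. Qed.
Let bC2V : bmeas (fun x => (C2 x)^-1). Proof. exact/bcosV/ca2/bcos. Qed.
Let bC3V : bmeas (fun x => (C3 x)^-1). Proof. exact/bcosV/ca3/bcos. Qed.
Let bC4V : bmeas (fun x => (C4 x)^-1). Proof. exact/bcosV/ca4/bcos. Qed.

Let M0 : 0 < M.
Proof.
have [c [C [c0 h]]] := bd1.
by apply: (marginal_gt0 cp1 c0) => // z; have /andP[] := h z.
Qed.

Let bDV (q C : R4 R -> R) n : bmeas (fun x => (q x)^-1) ->
  bmeas (fun x => (C x)^-1) -> bmeas (fun x => (q x * C x ^+ n)^-1).
Proof.
move=> bq bC; under eq_fun do rewrite invfM -exprVn.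
by apply: bmeasM => //; exact: bmeasX.
Qed.

Let bfu i : bmeas (fun x => 3 * f x * u x * du i x).
Proof. exact: (bmeasM (bmeasM (bmeasM (bmeas_cst _ 3) bf) bu) (bdu i)). Qed.

Let bC12V : bmeas (fun x => (C1 x * C2 x)^-1).
Proof. by under eq_fun do rewrite invfM; exact: (bmeasM bC1V bC2V). Qed.
Let bC123V : bmeas (fun x => (C1 x * C2 x * C3 x)^-1).
Proof. by under eq_fun do rewrite invfM; exact: (bmeasM bC12V bC3V). Qed.

Let bE1 : bmeas E1.
Proof.
exact: (bmeasD (bmeasM (bmeasX 3 bf) (bmeasM (bmeas_cst _ 1)
    (bmeasM (bmeasM (bmeas_cst _ _) bq1) (bDV 5 (bmeas_cst _ M^-1) bC1V))))
  (bmeasM (bfu o0) (bmeasM (bmeas_cst _ 1) (bmeasM (bsin mth1) bC1V)))).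
Qed.
Let bE2 : bmeas E2.
Proof.
exact: (bmeasD (bmeasM (bmeasX 3 bf) (bmeasM bC1V
    (bmeasM (bmeasM (bmeas_cst _ _) bq2) (bDV 6 bq1V bC2V))))
  (bmeasM (bfu o1) (bmeasM bC1V (bmeasM (bsin mth2) bC2V)))).
Qed.
Let bE3 : bmeas E3.
Proof.
exact: (bmeasD (bmeasM (bmeasX 3 bf) (bmeasM bC12V
    (bmeasM (bmeasM (bmeas_cst _ _) bq3) (bDV 7 bq2V bC3V))))
  (bmeasM (bfu o2) (bmeasM bC12V (bmeasM (bsin mth3) bC3V)))).
Qed.
Let bE4 : bmeas E4.
Proof.
exact: (bmeasD (bmeasM (bmeasX 3 bf) (bmeasM bC123V
    (bmeasM (bmeasM (bmeas_cst _ _) brho) (bDV 8 bq3V bC4V))))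
  (bmeasM (bfu o3) (bmeasM bC123V (bmeasM (bsin mth4) bC4V)))).
Qed.

Let q := (cos a)^-1.
Let q1 : 1 <= q.
Proof. by rewrite invr_ge1 ?unitf_gt0// ?ca0// (le_trans (ler_norm _) (cos_max _)). Qed.

Let invb (C : R) : 0 < cos a <= C -> 0 <= C^-1 <= q.
Proof.
move=> /andP[c0 aC]; have C0 := lt_le_trans c0 aC.
by rewrite invr_ge0 (ltW C0)/= lef_pV2.
Qed.

Let invb1 (C : R) : 0 < cos a <= C -> 0 <= C^-1 <= q ^+ 3.
Proof.
move=> /invb/andP[-> h]; rewrite (le_trans h)// exprSr ler_peMl// ?(le_trans ler01)//.
exact: exprn_ege1.
Qed.

Let invb2 (C C' : R) : 0 < cos a <= C -> 0 < cos a <= C' ->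
  0 <= (C * C')^-1 <= q ^+ 3.
Proof.
move=> /invb/andP[h1 h2] /invb/andP[h3 h4].
rewrite invfM mulr_ge0//= (le_trans (ler_pM h1 h3 h2 h4))//.
by rewrite -expr2 (exprSr q 2) ler_peMr// exprn_ge0// (le_trans ler01).
Qed.

Let invb3 (C C' C'' : R) : 0 < cos a <= C -> 0 < cos a <= C' -> 0 < cos a <= C'' ->
  0 <= (C * C' * C'')^-1 <= q ^+ 3.
Proof.
move=> /invb/andP[h1 h2] /invb/andP[h3 h4] /invb/andP[h5 h6].
rewrite !invfM !mulr_ge0//= exprSr ler_pM ?mulr_ge0// expr2.
exact: ler_pM.
Qed.

Let der_f3 i y (t : R) : is_derive t 1 (fun t => f (ins i t y) ^+ 3)
  (3 * f (ins i t y) * u (ins i t y) * du i (ins i t y)).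
Proof.
apply: (is_derive_eq (derX 3 (der_f i y t))) => /=.
by have := f_gt0 (ins i t y); move: (f _) => F F0; field; rewrite gt_eqF.
Qed.

Let cont_df3 i y : continuous
  (fun t : R => 3 * f (ins i t y) * u (ins i t y) * du i (ins i t y)).
Proof.
move=> t; apply: cvgM; last exact: cont_du.
apply: cvgM; last exact: c_u.
by apply: cvgMr; exact: der_continuous (der_f i y t).
Qed.

Let f_bd i y t : L <= `|t| -> f (ins i t y) ^+ 3 = eps ^+ 3.
Proof.
move=> Lt; rewrite /f /g supp_u// expr0n/= add0r sqrtr_sqr ger0_norm//.
exact: ltW.
Qed.

Let f_L i y : f (ins i L y) ^+ 3 = eps ^+ 3.
Proof. by apply: f_bd; rewrite ger0_norm// ltW. Qed.
Let f_NL i y : f (ins i (- L) y) ^+ 3 = eps ^+ 3.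
Proof. by apply: f_bd; rewrite normrN ger0_norm// ltW. Qed.

Let line d (X : measurableType d) (p : X * mT -> R) j i y x kap :
  (forall x, continuous (fun s : R => p (x, s))) ->
  (exists c C, 0 < c /\ forall z, c <= p z <= C) -> 0 <= kap <= q ^+ 3 ->
  \int[mu]_(t in `[- L, L]) (f (ins i t y) ^+ 3 *
      (kap * (2 * primcos j.+2 a * p (x, t) /
        (marginal p L x * cos (angle p L a j (x, t)) ^+ j.+4)))
    + (3 * f (ins i t y) * u (ins i t y) * du i (ins i t y)) *
      (kap * (sin (angle p L a j (x, t)) / cos (angle p L a j (x, t))))) <=
  2 * eps ^+ 3 * (q ^+ 3 / cos a).
Proof.
move=> cp [c [C [c0 h]]] /andP[k0 kb].
have pc z : c <= p z by have /andP[] := h z.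
have e0 : 0 <= eps ^+ 3 by rewrite exprn_ge0// ltW.
exact: (@line_bound _ X R p c L a j cp c0 pc L0 a0 api x kap (eps ^+ 3) (q ^+ 3)
  (fun t => f (ins i t y) ^+ 3)
  (fun t => 3 * f (ins i t y) * u (ins i t y) * du i (ins i t y)) k0 kb e0 (der_f3 i y) (@cont_df3 i y)
  (f_L i y) (f_NL i y)).
Qed.

(** Bound for the flux along one line: on the faces f = eps, while a component of T is at most 1 /
    cos a times at most three further inverse cosines. *)
Let beta := 2 * eps ^+ 3 * (q ^+ 3 / cos a).

Let int_E1 : \int[pow4 (muL L)]_x E1 x <= beta * (2 * L) ^+ 3.
Proof.
apply: (box_line (i := o0) L0 bE1) => y.
have k : 0 <= (1 : R) <= q ^+ 3 by rewrite ler01 exprn_ege1.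
exact: (@line _ mT p1 1 o0 y (0 : R) 1 cp1 bd1 k).
Qed.

Let int_E2 : \int[pow4 (muL L)]_x E2 x <= beta * (2 * L) ^+ 3.
Proof.
apply: (box_line (i := o1) L0 bE2) => y.
have k := invb1 (ca1 (ins o1 0 y)).
exact: (line 2 o1 y y.1.1 cp2 bd2 k).
Qed.

Let int_E3 : \int[pow4 (muL L)]_x E3 x <= beta * (2 * L) ^+ 3.
Proof.
apply: (box_line (i := o2) L0 bE3) => y.
have k := invb2 (ca1 (ins o2 0 y)) (ca2 (ins o2 0 y)).
exact: (line 3 o2 y (y.1.1, y.1.2) cp3 bd3 k).
Qed.

Let int_E4 : \int[pow4 (muL L)]_x E4 x <= beta * (2 * L) ^+ 3.
Proof.
apply: (box_line (i := o3) L0 bE4) => y.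
have k := invb3 (ca1 (ins o3 0 y)) (ca2 (ins o3 0 y)) (ca3 (ins o3 0 y)).
exact: (line 4 o3 y ((y.1.1, y.1.2), y.2) cp4 bd4 k).
Qed.

Let muLfin : (muL L setT < +oo)%E. Proof. by rewrite muLT// ltry. Qed.

Let ins_pow4 (F : R4 R -> R) : measurable_fun setT F ->
  \int[pow4 (muL L)]_x F x = \int[pmeasure (pow3 (muL L)) (muL L)]_z F (ins o3 z.2 z.1).
Proof.
move=> mF; rewrite /Rintegral (integral_ins _ o3)//; exact/measurable_EFinP.
Qed.

Let massE : \int[pow4 (muL L)]_x rho x = M.
Proof.
rewrite ins_pow4; last exact: brho.1.
have h3 := stage_mass L0 bd4 mp4 (bmeas_cst _ (1 : R)) (pow3_muL_fin L0).
have h2 := stage_mass L0 bd3 bm3.1 (bmeas_cst _ (1 : R)) (pow2_muL_fin L0).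
have h1 := stage_mass L0 bd2 bm2.1 (bmeas_cst _ (1 : R)) muLfin.
transitivity (\int[pow3 (muL L)]_y (1 * p3 y)).
  by rewrite -h3; apply: eq_Rintegral => z _; rewrite mul1r.
transitivity (\int[pow2 (muL L)]_y (1 * p2 y)).
  by rewrite -h2; apply: eq_Rintegral => z _; rewrite mul1r.
transitivity (\int[muL L]_y (1 * p1 (0, y))).
  by rewrite -h1; apply: eq_Rintegral => z _; rewrite mul1r.
rewrite /M marginal_muL; last exact: bm1.1.
by apply: eq_Rintegral => z _; rewrite mul1r.
Qed.

Let r j : R := primcos j a / primcos j.+2 a.
Let c1 (t : mT) := cos (angle p1 L a 1 (0, t)).
Let c2 (z : mT * mT) := cos (angle p2 L a 2 z).
Let c3 (z : (mT * mT) * mT) := cos (angle p3 L a 3 z).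

Let bcosV' d (X : measurableType d) (p : X * mT -> R) j : measurable_fun setT p ->
  (forall x, continuous (fun s : R => p (x, s))) ->
  (exists c C, 0 < c /\ forall z, c <= p z <= C) ->
  bmeas (fun z => (cos (angle p L a j z) ^+ 2)^-1).
Proof.
move=> mp cp bp; under eq_fun do rewrite -exprVn; apply: bmeasX.
apply: (bmeasV ca0).
  by move=> z; have /andP[] := cos_angle p L j a0 api z.
split; last by exists 1 => z; exact: cos_max.
apply: (measurableT_comp (continuous_measurable_fun (@continuous_cos R))).
exact: mangle.
Qed.

Let bw1 : bmeas (fun t => (c1 t ^+ 2)^-1).
Proof.
have h := bcosV' 1 bm1.1 cp1 bd1.
by apply: (bmeas_comp _ h); exact: measurable_fun_pair.
Qed.
Let bw2 : bmeas (fun z : mT * mT => (c1 z.1 ^+ 2)^-1 * (c2 z ^+ 2)^-1).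
Proof. exact: bmeasM (bmeas_comp measurable_fst bw1) (bcosV' 2 bm2.1 cp2 bd2). Qed.
Let bw3 : bmeas (fun z : (mT * mT) * mT =>
  (c1 z.1.1 ^+ 2)^-1 * (c2 z.1 ^+ 2)^-1 * (c3 z ^+ 2)^-1).
Proof. exact: bmeasM (bmeas_comp measurable_fst bw2) (bcosV' 3 bm3.1 cp3 bd3). Qed.

Let Y x := (C1 x * C2 x * C3 x * C4 x) ^- 2.

Let bY : bmeas Y.
Proof.
suff -> : Y = fun x => ((C1 x * C2 x * C3 x)^-1 * (C4 x)^-1) ^+ 2.
  exact: (bmeasX 2 (bmeasM bC123V bC4V)).
by apply/funext => x; rewrite /Y -exprVn invfM.
Qed.

(** The integral of rho (1 + |T|^2), that is, M times the mean of 1 + |y|^2 under the target law.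
    The stages are peeled off from the last coordinate to the first, each contributing its factor r
    j. *)
Let momentE : \int[pow4 (muL L)]_x (rho x * Y x) = M * (r 1 * r 2 * r 3 * r 4).
Proof.
rewrite ins_pow4; last exact: (bmeasM brho bY).1.
have h4 := stage_moment 4 L0 a0 api cp4 bd4 mp4 bw3 (pow3_muL_fin L0).
have h3 := stage_moment 3 L0 a0 api cp3 bd3 bm3.1 bw2 (pow2_muL_fin L0).
have h2 := stage_moment 2 L0 a0 api cp2 bd2 bm2.1 bw1 muLfin.
have [c [C [cc0 hc]]] := bd1.
have pc z : c <= p1 z by have /andP[] := hc z.
have h1 := angle_moment 1 cp1 cc0 pc L0 a0 api 0.
transitivity (\int[pow3 (muL L)]_y ((c1 y.1.1 ^+ 2)^-1 * (c2 y.1 ^+ 2)^-1 *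
    (c3 y ^+ 2)^-1 * p3 y) * r 4).
  rewrite -h4; apply: eq_Rintegral => -[[[x1 x2] x3] x4] _.
  change (rho (ins o3 x4 ((x1, x2), x3)) * (c1 x1 * c2 (x1, x2) * c3 ((x1, x2), x3) *
      cos (angle p4 L a 4 (((x1, x2), x3), x4))) ^- 2 =
    (c1 x1 ^+ 2)^-1 * (c2 (x1, x2) ^+ 2)^-1 * (c3 ((x1, x2), x3) ^+ 2)^-1 *
    (rho (ins o3 x4 ((x1, x2), x3)) / cos (angle p4 L a 4 (((x1, x2), x3), x4)) ^+ 2)).
  move: (rho _) (c1 x1) (c2 _) (c3 _) (cos _) => e k1 k2 k3 k4.
  by rewrite !exprMn !invfM; ring.
transitivity (\int[pow2 (muL L)]_y ((c1 y.1 ^+ 2)^-1 * (c2 y ^+ 2)^-1 * p2 y)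
    * r 3 * r 4).
  rewrite -h3; congr (_ * _); apply: eq_Rintegral => y _.
  by rewrite -[cos _]/(c3 y); move: (p3 y) (c1 _) (c2 _) (c3 y) => e k1 k2 k3; ring.
transitivity (\int[muL L]_y ((c1 y ^+ 2)^-1 * p1 (0, y)) * r 2 * r 3 * r 4).
  rewrite -h2; congr (_ * _ * _); apply: eq_Rintegral => y _.
  by rewrite -[cos _]/(c2 y); move: (p2 y) (c1 _) (c2 y) => e k1 k2; ring.
have -> : \int[muL L]_y ((c1 y ^+ 2)^-1 * p1 (0, y)) = M * r 1.
  rewrite -h1 integral_muL; last first.
    apply: (bmeasM bw1 _).1; apply: (bmeas_comp _ bm1).
    exact: measurable_fun_pair.
  by apply: eq_Rintegral => y _; rewrite mulrC.
by move: M (r 1) (r 2) (r 3) (r 4) => *; ring.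
Qed.

(** Integrates [divergence_ge] over the box: the divergence side is controlled by the boundary
    fluxes, the other side is evaluated with [massE] and [momentE]. The condition on k says that k^4
    is the ratio of target mass to source mass. *)
Let box_inequality (k : R) : 0 < k ->
  k ^+ 4 = (2 * primcos 3 a) * (2 * primcos 4 a) * (2 * primcos 5 a) *
    (2 * primcos 6 a) / M ->
  k * M * (r 1 * r 2 * r 3 * r 4 + 3) -
  3 / (4 * k) * \int[pow4 (muL L)]_x (\sum_(i < 4) du i x ^+ 2) <=
  4 * (beta * (2 * L) ^+ 3).
Proof.
move=> k0 kE.
have S4 x : \sum_(i < 4) du i x ^+ 2 =
    du o0 x ^+ 2 + du o1 x ^+ 2 + du o2 x ^+ 2 + du o3 x ^+ 2.
  rewrite !big_ord_recl big_ord0 addr0 !addrA.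
  by congr (_ + _ + _ + _); congr (du _ x ^+ 2); apply: val_inj.
have bS : bmeas (fun x => \sum_(i < 4) du i x ^+ 2).
  under eq_fun do rewrite S4.
  exact: (bmeasD (bmeasD (bmeasD (bmeasX 2 (bdu o0)) (bmeasX 2 (bdu o1)))
    (bmeasX 2 (bdu o2))) (bmeasX 2 (bdu o3))).
(* This weight is dictated by the extremal case: when u is the bubble and T the identity, k = 1 and
   grad u = - 2 u^2 x, so that Young's inequality with l = 1/2 is an equality. *)
pose l := (2 * k)^-1.
have l0 : 0 < l by rewrite invr_gt0 mulr_gt0.
pose Glow x := 4 * k * (rho x * Y x) -
  3 / 2 * (l * (\sum_(i < 4) du i x ^+ 2) + l^-1 * (rho x * Y x - rho x)).
pose E x := E1 x + E2 x + E3 x + E4 x.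
have bE : bmeas E by exact: (bmeasD (bmeasD (bmeasD bE1 bE2) bE3) bE4).
have I4 F : bmeas F -> (pow4 (muL L)).-integrable setT (EFin \o F).
  exact: bmeas_integrable (pow4_muL_fin L0).
have bRY : bmeas (fun x => rho x * Y x) by exact: bmeasM.
have bX1 : bmeas (fun x => l * \sum_(i < 4) du i x ^+ 2).
  exact: (bmeasM (bmeas_cst _ l) bS).
have bX2 : bmeas (fun x => l^-1 * (rho x * Y x - rho x)).
  exact: (bmeasM (bmeas_cst _ l^-1) (bmeasB bRY brho)).
have bX3 : bmeas (fun x => 3 / 2 * (l * (\sum_(i < 4) du i x ^+ 2) +
    l^-1 * (rho x * Y x - rho x))).
  exact: (bmeasM (bmeas_cst _ _) (bmeasD bX1 bX2)).
have bX4 : bmeas (fun x => 4 * k * (rho x * Y x)).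
  exact: (bmeasM (bmeas_cst _ _) bRY).
have bG : bmeas Glow by exact: (bmeasB bX4 bX3).
have GE x : Glow x <= E x.
  rewrite /Glow /E S4 /E1 /E2 /E3 /E4 /D1 /D2 /D3 /D4 /Y !rhoE.
  have -> : f x ^+ 4 * (C1 x * C2 x * C3 x * C4 x) ^- 2 - f x ^+ 4 =
    f x ^+ 4 * ((C1 x * C2 x * C3 x * C4 x) ^- 2 - 1) by rewrite mulrBr mulr1.
  have sin2 t : sin t ^+ 2 = 1 - cos t ^+ 2 :> R by exact: sin2cos2.
  have pos T (p : T -> R) z : (exists c C, 0 < c /\ forall z, c <= p z <= C) -> 0 < p z.
    by move=> [c [C [cc0 h]]]; have /andP[h1 _] := h z; exact: lt_le_trans h1.
  have A0 j : 0 < 2 * primcos j a by rewrite mulr_gt0// primcos_gt0// ltW.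
  have uf : u x ^+ 2 <= f x ^+ 2 by rewrite f2 /g lerDl sqr_ge0.
  exact: (divergence_ge (du o0 x) (du o1 x) (du o2 x) (du o3 x)
    (C10 x) (C20 x) (C30 x) (C40 x) (sin2 (th1 x)) (sin2 (th2 x)) (sin2 (th3 x))
    (sin2 (th4 x)) (A0 3) (A0 4) (A0 5) (A0 6) (pos _ p1 (0, x.1.1) bd1)
    (pos _ p2 (x.1.1, x.1.2) bd2) (pos _ p3 ((x.1.1, x.1.2), x.2.1) bd3)
    M0 (f_gt0 x) uf k0 l0 kE).
have IG : \int[pow4 (muL L)]_x Glow x <= \int[pow4 (muL L)]_x E x.
  by apply: le_Rintegral => //; [exact: (I4 _ bG)|exact: (I4 _ bE)].
have IE : \int[pow4 (muL L)]_x E x = \int[pow4 (muL L)]_x E1 x +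
    \int[pow4 (muL L)]_x E2 x + \int[pow4 (muL L)]_x E3 x + \int[pow4 (muL L)]_x E4 x.
  rewrite /E RintegralD//; [|exact: (I4 _ (bmeasD (bmeasD bE1 bE2) bE3))|exact: (I4 _ bE4)].
  rewrite RintegralD//; [|exact: (I4 _ (bmeasD bE1 bE2))|exact: (I4 _ bE3)].
  by rewrite RintegralD//; [exact: (I4 _ bE1)|exact: (I4 _ bE2)].
have IGE : \int[pow4 (muL L)]_x Glow x = 4 * k * (M * (r 1 * r 2 * r 3 * r 4)) -
    3 / 2 * (l * \int[pow4 (muL L)]_x (\sum_(i < 4) du i x ^+ 2) +
      l^-1 * (M * (r 1 * r 2 * r 3 * r 4) - M)).
  rewrite /Glow RintegralB//; [|exact: (I4 _ bX4)|exact: (I4 _ bX3)].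
  rewrite RintegralZl//; last exact: (I4 _ bRY).
  rewrite RintegralZl//; last exact: (I4 _ (bmeasD bX1 bX2)).
  rewrite RintegralD//; [|exact: (I4 _ bX1)|exact: (I4 _ bX2)].
  rewrite RintegralZl//; last exact: (I4 _ bS).
  rewrite RintegralZl//; last exact: (I4 _ (bmeasB bRY brho)).
  rewrite RintegralB//; [|exact: (I4 _ bRY)|exact: (I4 _ brho)].
  by rewrite momentE massE.
have tot : \int[pow4 (muL L)]_x E x <= 4 * (beta * (2 * L) ^+ 3).
  by rewrite IE; exact: sum4_le int_E1 int_E2 int_E3 int_E4.
have := le_trans IG tot; rewrite IGE /l invrK; exact: collect_terms.
Qed.


Lemma box_sobolev (N := \int[pow4 (muL L)]_x ((u x ^+ 2 + eps ^+ 2) ^+ 2)) :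
  0 < N /\ forall k, 0 < k ->
  k ^+ 4 = (2 * primcos 3 a) * (2 * primcos 4 a) * (2 * primcos 5 a) *
    (2 * primcos 6 a) / N ->
  k * N * (primcos 1 a / primcos 3 a * (primcos 2 a / primcos 4 a) *
    (primcos 3 a / primcos 5 a) * (primcos 4 a / primcos 6 a) + 3) -
  3 / (4 * k) * \int[pow4 (muL L)]_x (\sum_(i < 4) du i x ^+ 2) <=
  4 * (2 * eps ^+ 3 * ((cos a)^-1 ^+ 3 / cos a) * (2 * L) ^+ 3).
Proof.
have NE : N = M by exact: massE.
by rewrite NE; split; [exact: M0|exact: box_inequality].
Qed.

End box_inequality.

(** * The power of a restricted measure as a restriction to a box *)

Section restricted_product.
Context d1 d2 (T1 : measurableType d1) (T2 : measurableType d2) (R : realType).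
Variables (m1 n1 : {sigma_finite_measure set T1 -> \bar R}).
Variables (m2 n2 : {sigma_finite_measure set T2 -> \bar R}).
Variables (D1 : set T1) (D2 : set T2).
Hypotheses (mD1 : measurable D1) (mD2 : measurable D2).
Hypothesis n1E : forall A, measurable A -> n1 A = m1 (A `&` D1).
Hypothesis n2E : forall A, measurable A -> n2 A = m2 (A `&` D2).

(** Both sides agree on measurable rectangles, and uniqueness of the product measure extends this to
    all measurable sets. *)
Lemma pmeasure_restr A : measurable A ->
  pmeasure n1 n2 A = pmeasure m1 m2 (A `&` (D1 `*` D2)).
Proof.
have mD : measurable (D1 `*` D2) by exact: measurableX.
move=> mA; apply: (product_measure_unique (m' := mrestr (pmeasure m1 m2) mD)) => //.
move=> X Y mX mY; rewrite [LHS]/= /mrestr n1E// n2E//.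
have -> : (X `*` Y) `&` (D1 `*` D2) = (X `&` D1) `*` (Y `&` D2).
  by apply/seteqP; split => -[x y] /=; tauto.
by rewrite /pmeasure product_measure1E//; exact: measurableI.
Qed.

End restricted_product.

Section restricted_pow4.
Variables (R : realType) (L : R).
Local Notation mu := (@lebesgue_measure R).

Definition box : set (R4 R) :=
  [set x | forall i, - L <= coord i x <= L].

Lemma boxE : box = (`[- L, L] `*` `[- L, L]) `*` (`[- L, L] `*` `[- L, L]).
Proof.
apply/seteqP; split => -[[x1 x2] [x3 x4]] /=; rewrite !in_itv/=.
  move=> h; have := h (@Ordinal 4 0 isT); have := h (@Ordinal 4 1 isT).
  by have := h (@Ordinal 4 2 isT); have := h (@Ordinal 4 3 isT).
move=> [[h1 h2] [h3 h4]] [[|[|[|[|?]]]] //= i4]; by rewrite /coord.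
Qed.

Lemma pow4_muL_restr A : measurable A ->
  pow4 (muL L) A = pow4 mu (A `&` box).
Proof.
have h2 X : measurable X -> pow2 (muL L) X = pow2 mu (X `&` (`[- L, L] `*` `[- L, L])).
  by move=> mX; apply: pmeasure_restr.
have mD : measurable ((`[- L, L] : set (measurableTypeR R)) `*`
  (`[- L, L] : set (measurableTypeR R))) by exact: measurableX.
move=> mA; rewrite boxE; exact: pmeasure_restr.
Qed.

Lemma measurable_box : measurable (box : set ((measurableTypeR R * measurableTypeR R) *
  (measurableTypeR R * measurableTypeR R))).
Proof. by rewrite boxE; apply: measurableX; exact: measurableX. Qed.

Lemma integral_box (F : R4 R -> \bar R) : measurable_fun setT F ->
  (\int[pow4 (muL L)]_x F x = \int[pow4 mu]_(x in box) F x)%E.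
Proof.
move=> mF; transitivity (\int[mrestr (pow4 mu) measurable_box]_x F x)%E.
  by apply: eq_measure_integral => A mA _; exact: pow4_muL_restr.
exact: integral_mrestr.
Qed.

Lemma integral_box_supp (F : R4 R -> \bar R) : measurable_fun setT F ->
  (forall x i, L < `|coord i x| -> F x = 0%E) ->
  (\int[pow4 (muL L)]_x F x = \int[pow4 mu]_x F x)%E.
Proof.
move=> mF F0; transitivity (\int[pow4 mu]_x (F \_ box) x)%E.
  by apply: etrans (integral_box mF) _; exact: integral_mkcond.
apply: eq_integral => x _; rewrite patchE; case: ifPn => //.
rewrite notin_setE => /existsNP[i]; rewrite -ler_norml => /negP; rewrite -ltNge.
by move=> /F0.
Qed.

End restricted_pow4.

(** * Sharp Sobolev inequality for regular compactly supported functions *)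

Section sobolev_C1.
Variable R : realType.
Local Notation mu := (@lebesgue_measure R).
Local Notation mT := (measurableTypeR R).

(** The integral of (1 + |x|^2)^-4 over R^4, in the form in which it comes out of the transport: the
    product of the integrals of cos^k over (-pi/2, pi/2) for k = 3, 4, 5, 6. The identification is
    [bub4_integral]. *)
Definition bubble_mass : R := (2 * primcos 3 (pi / 2)) * (2 * primcos 4 (pi / 2)) *
  (2 * primcos 5 (pi / 2)) * (2 * primcos 6 (pi / 2)).

Let mass (a : R) := (2 * primcos 3 a) * (2 * primcos 4 a) * (2 * primcos 5 a) *
  (2 * primcos 6 a).
Let ratio (a : R) := primcos 1 a / primcos 3 a * (primcos 2 a / primcos 4 a) *
    (primcos 3 a / primcos 5 a) * (primcos 4 a / primcos 6 a).

Lemma primcos_pihalf k : primcos k (pi / 2) / primcos k.+2 (pi / 2) =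
  k.+2%:R / k.+1%:R :> R.
Proof.
rewrite primcosSS cos_pihalf expr0n/= mul0r add0r.
have p0 : 0 < primcos k (pi / 2 : R) by rewrite primcos_gt0// pihalf_gt0.
have h1 : k.+1%:R != 0 :> R by rewrite pnatr_eq0.
have h2 : k.+2%:R != 0 :> R by rewrite pnatr_eq0.
move: (primcos k _) p0 (k.+1%:R : R) h1 (k.+2%:R : R) h2 => p p0 x x0 y y0.
by field; rewrite ?x0 ?y0 ?(gt_eqF p0).
Qed.

Lemma ratio_pihalf : ratio (pi / 2) = 3.
Proof. by rewrite /ratio !primcos_pihalf; field. Qed.

Lemma bubble_mass_gt0 : 0 < bubble_mass.
Proof.
have h k : 0 < 2 * primcos k (pi / 2 : R).
  by rewrite mulr_gt0// primcos_gt0// pihalf_gt0.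
by rewrite /bubble_mass; do !apply: mulr_gt0 => //.
Qed.

Lemma le_eps3 (X K C : R) : (forall e, 0 < e -> X <= K + C * e ^+ 3) -> X <= K.
Proof.
move=> h; apply/ler_addgt0Pr => d d0.
pose e := Num.min 1 (d / (`|C| + 1)).
have C1 : 0 < `|C| + 1 by rewrite ltr_wpDl.
have e0 : 0 < e by rewrite lt_min ltr01 divr_gt0.
have e1 : e <= 1 by rewrite ge_min lexx.
apply: (le_trans (h e e0)); rewrite lerD2l.
apply: (@le_trans _ _ ((`|C| + 1) * e)).
  apply: (@le_trans _ _ (`|C| * e)).
    apply: (@le_trans _ _ (`|C| * e ^+ 3)).
      by rewrite ler_wpM2r ?exprn_ge0 ?ler_norm// ltW.
    by rewrite ler_wpM2l// exprS ler_piMr ?(ltW e0)// exprn_ile1// ltW.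
  by rewrite ler_wpM2r ?lerDl// ltW.
by rewrite mulrC -ler_pdivlMr// ge_min lexx orbT.
Qed.

Variables (u : R4 R -> R) (du : 'I_4 -> R4 R -> R) (B L : R).
Hypothesis meas_u : measurable_fun setT u.
Hypothesis meas_du : forall i, measurable_fun setT (du i).
Hypothesis u_B : forall x, `|u x| <= B.
Hypothesis du_B : forall i x, `|du i x| <= B.
Hypothesis der_u : forall i y (t : R),
  is_derive t 1 (fun t => u (ins i t y)) (du i (ins i t y)).
Hypothesis cont_du : forall i y, continuous (fun t : R => du i (ins i t y)).
Hypothesis supp_u : forall i x, L <= `|coord i x| -> u x = 0.
Hypothesis L0 : 0 < L.

Let supp' i y t : L <= `|t| -> u (ins i t y) = 0.
Proof. by move=> Lt; apply: (supp_u (i := i)); rewrite coord_ins. Qed.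

Let K := \int[pow4 (muL L)]_x (\sum_(i < 4) du i x ^+ 2).
Let N0 := \int[pow4 (muL L)]_x (u x ^+ 4).

Let bu : bmeas u. Proof. by split => //; exists B. Qed.

Let N0_ge0 : 0 <= N0.
Proof. by apply: Rintegral_ge0 => x _; rewrite -[4%N]/(2 * 2)%N exprM sqr_ge0. Qed.

(** The limit eps -> 0 at a fixed truncation a of the target: for fixed a and L the boundary terms
    are of order eps^3. *)
Let sobolev_a a : 0 < a -> a < pi / 2 ->
  4 / 3 * (Num.sqrt (mass a * N0) * (ratio a + 3)) <= K.
Proof.
move=> a0 api.
have P0 j : 0 < primcos j a by rewrite primcos_gt0// ltW.
have P2 j : 0 < 2 * primcos j a by rewrite mulr_gt0.
have m0 : 0 < mass a by rewrite /mass; do !apply: mulr_gt0 => //.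
have PV j : 0 < (primcos j a)^-1 by rewrite invr_gt0.
have r0 : 0 < ratio a by rewrite /ratio; do !apply: mulr_gt0 => //.
have K0 : 0 <= K.
  by apply: Rintegral_ge0 => x _; apply: sumr_ge0 => i _; rewrite sqr_ge0.
have [N00|N00] := eqVneq N0 0.
  by rewrite N00 mulr0 sqrtr0 mul0r mulr0.
have {}N00 : 0 < N0 by rewrite lt_neqAle eq_sym N00.
(* The number k depends on eps through the mass of (u^2 + eps^2)^2. That mass is at least N0, so k0
   bounds k uniformly in eps and the error constant C is independent of eps. *)
pose k0 := Num.sqrt (Num.sqrt (mass a / N0)).
pose C := 4 / 3 * k0 * (4 * (2 * ((cos a)^-1 ^+ 3 / cos a) * (2 * L) ^+ 3)).
apply: (@le_eps3 _ _ C) => e e0.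
have [] := box_sobolev meas_u meas_du u_B du_B der_u cont_du supp' L0 e0 a0 api.
set N := \int[_]_x _ => Np; rewrite -/(mass a) -/(ratio a) -/K => h.
have N0N : N0 <= N.
  have fin := pow4_muL_fin L0.
  have bX : bmeas (fun x => (u x ^+ 2 + e ^+ 2) ^+ 2).
    exact: (bmeasX 2 (bmeasD (bmeasX 2 bu) (bmeas_cst _ _))).
  apply: le_Rintegral => //.
  - exact: bmeas_integrable fin (bmeasX 4 bu).
  - exact: bmeas_integrable fin bX.
  - move=> x _; rewrite -[4%N]/(2 * 2)%N exprM ler_pXn2r ?nnegrE ?addr_ge0 ?sqr_ge0//.
    by rewrite lerDl sqr_ge0.
pose k := Num.sqrt (Num.sqrt (mass a / N)).
have mN0 : 0 < mass a / N by rewrite divr_gt0.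
have k0p : 0 < k by rewrite !sqrtr_gt0.
have k2 : k ^+ 2 = Num.sqrt (mass a / N) by rewrite sqr_sqrtr// sqrtr_ge0.
have k4 : k ^+ 4 = mass a / N.
  by rewrite -[4%N]/(2 * 2)%N exprM k2 sqr_sqrtr// ltW.
have kk0 : k <= k0.
  rewrite /k /k0 ler_sqrt ?sqrtr_ge0// ler_sqrt; last by rewrite divr_ge0 ?ltW.
  by rewrite ler_wpM2l ?(ltW m0)// lef_pV2.
have k2N : k ^+ 2 * N = Num.sqrt (mass a * N).
  rewrite k2 -{2}(ger0_norm (ltW Np)) -sqrtr_sqr -sqrtrM ?ltW//.
  by congr Num.sqrt; field; rewrite gt_eqF.
have sN : Num.sqrt (mass a * N0) <= Num.sqrt (mass a * N).
  rewrite ler_sqrt; first by rewrite ler_wpM2l// ltW.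
  by rewrite mulr_ge0// ltW.
have := h k k0p k4.
set be := 4 * (2 * e ^+ 3 * _ * _) => hb.
have hb2 : 4 / 3 * (k ^+ 2 * N * (ratio a + 3)) <= K + 4 / 3 * k * be.
  have : 4 / 3 * k * (k * N * (ratio a + 3) - 3 / (4 * k) * K) <= 4 / 3 * k * be.
    by rewrite ler_wpM2l// mulr_ge0// ltW.
  have -> : 4 / 3 * k * (k * N * (ratio a + 3) - 3 / (4 * k) * K) =
    4 / 3 * (k ^+ 2 * N * (ratio a + 3)) - K by field; rewrite gt_eqF.
  by rewrite lerBlDl.
rewrite (le_trans _ (le_trans hb2 _))//.
  rewrite k2N ler_wpM2l// ler_wpM2r//.
  by rewrite addr_ge0// ltW.
rewrite lerD2l /C /be.
have ca : 0 < cos a.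
  by rewrite cos_gt0_pihalf// api andbT (lt_trans _ a0)// oppr_lt0 pihalf_gt0.
set w := (cos a)^-1 ^+ 3 / cos a.
have w0 : 0 <= w by rewrite /w divr_ge0 ?exprn_ge0 ?invr_ge0 ?(ltW ca).
have -> : 4 / 3 * k * (4 * (2 * e ^+ 3 * w * (2 * L) ^+ 3)) =
  k * (4 / 3 * (4 * (2 * w * (2 * L) ^+ 3)) * e ^+ 3) by ring.
have -> : 4 / 3 * k0 * (4 * (2 * w * (2 * L) ^+ 3)) * e ^+ 3 =
  k0 * (4 / 3 * (4 * (2 * w * (2 * L) ^+ 3)) * e ^+ 3) by ring.
have e3 : 0 <= e ^+ 3 by rewrite exprn_ge0// ltW.
have L3 : 0 <= (2 * L) ^+ 3 by rewrite exprn_ge0// mulr_ge0// ltW.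
by rewrite ler_wpM2r//; do !apply: mulr_ge0 => //.
Qed.

(** The limit a -> pi/2, where the target becomes the full measure (1 + |y|^2)^-4 dy. There [ratio]
    equals 3, so the factor 4/3 (3 + 3) gives the sharp constant 8. *)
Lemma sobolev_box : 8 * Num.sqrt (bubble_mass * N0) <= K.
Proof.
pose Phi (a : R) := 4 / 3 * (Num.sqrt (mass a * N0) * (ratio a + 3)).
have PhiE : Phi (pi / 2) = 8 * Num.sqrt (bubble_mass * N0).
  by rewrite /Phi ratio_pihalf /bubble_mass -/(mass _); field.
have pN k : primcos k (pi / 2) != 0 :> R by rewrite gt_eqF// primcos_gt0// pihalf_gt0.
have cp k : primcos k x @[x --> (pi / 2 : R)] --> (primcos k (pi / 2) : R).
  exact: primcos_cont.
have cPhi : Phi x @[x --> (pi / 2 : R)] --> Phi (pi / 2).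
  apply: cvgMr; apply: cvgM.
    apply: (cvg_comp (fun a => mass a * N0) Num.sqrt); last exact: sqrt_continuous.
    apply: cvgM; last exact: cvg_cst.
    have cp2 k : 2 * primcos k x @[x --> (pi / 2 : R)] --> 2 * (primcos k (pi / 2) : R).
      by apply: cvgM; [exact: cvg_cst|exact: cp].
    exact: (cvgM (cvgM (cvgM (cp2 3) (cp2 4)) (cp2 5)) (cp2 6)).
  apply: cvgD; last exact: cvg_cst.
  have cpr j k : primcos j x / primcos k x @[x --> (pi / 2 : R)] -->
      (primcos j (pi / 2) / primcos k (pi / 2) : R).
    by apply: cvgM; [exact: cp|apply: cvgV; [exact: pN|exact: cp]].
  exact: (cvgM (cvgM (cvgM (cpr 1 3) (cpr 2 4)) (cpr 3 5)) (cpr 4 6)).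
(* If K were smaller than Phi(pi/2), continuity of Phi would give some a < pi/2 with K < Phi a,
   against [sobolev_a]. *)
rewrite -PhiE leNgt; apply/negP => Kl.
have nK : \forall x \near (pi / 2 : R)^'-, K < Phi x.
  by apply: cvg_at_left_filter (cvgr_gt _ cPhi _ Kl).
have n0 : \forall x \near (pi / 2 : R)^'-, 0 < x < pi / 2.
  near=> x; apply/andP; split; near: x.
    by apply: nbhs_left_gt; exact: pihalf_gt0.
  exact: nbhs_left_lt.
near (pi / 2 : R)^'- => x.
have /andP[x0 xp] : 0 < x < pi / 2 by near: x.
have : K < Phi x by near: x.
by rewrite ltNge sobolev_a.
Unshelve. all: by end_near. Qed.

End sobolev_C1.

(** * Functions vanishing to infinite order at 0 *)

Section flat_functions.
Variable R : realType.

(** The factor t^-n makes the family closed under differentiation up to linear combinations, so the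
    smoothness of exp(-1/t) extended by 0 needs no induction on derivatives. *)
Definition flat n (t : R) : R := if 0 < t then t ^- n * expR (- t^-1) else 0.

Lemma flat_ge0 n t : 0 <= flat n t.
Proof.
rewrite /flat; case: ifP => // t0.
by rewrite mulr_ge0 ?expR_ge0// invr_ge0 exprn_ge0// ltW.
Qed.

Lemma flat_le0 n t : t <= 0 -> flat n t = 0.
Proof. by rewrite /flat ltNge => ->. Qed.

(** One term of the exponential series at 1/t gives exp(-1/t) <= (n+2)! t^(n+2). The remaining
    factor t^2 forces the derivative at 0 to vanish. *)
Lemma flat_bound n t : flat n t <= n.+2`!%:R * t ^+ 2.
Proof.
rewrite /flat; case: ifPn => [t0|_]; last by rewrite mulr_ge0// sqr_ge0.
have f0 : (0 : R) < n.+2`!%:R by rewrite ltr0n fact_gt0.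
have ti : 0 <= t^-1 by rewrite invr_ge0 ltW.
have h : t^-1 ^+ n.+2 / n.+2`!%:R <= expR t^-1.
  by rewrite (le_trans _ (expR_ge1Dxn n.+1 ti))// lerDr.
have h2 : expR (- t^-1) <= n.+2`!%:R * t ^+ n.+2.
  rewrite expRN -[leRHS]invrK lef_pV2 ?posrE ?expR_gt0//; last first.
    by rewrite invr_gt0 mulr_gt0// exprn_gt0.
  by rewrite invfM -exprVn mulrC.
rewrite (le_trans (ler_wpM2l _ h2)) ?invr_ge0 ?exprn_ge0 ?(ltW t0)//.
rewrite le_eqVlt; apply/orP; left; apply/eqP.
by rewrite !exprSr; field; rewrite expf_neq0// gt_eqF.
Qed.

Lemma der_flat n (t : R) :
  is_derive t 1 (flat n) (flat n.+2 t - n%:R * flat n.+1 t).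
Proof.
case: (ltgtP t 0) => [t0|t0|->].
- rewrite !flat_le0 ?ltW// mulr0 subr0.
  have h := der_cst (0 : R) t; apply: near_eq_is_derive h.
  near=> s; rewrite flat_le0// ltW//; near: s; exact: lt_nbhsl.
- have tN0 : t != 0 by rewrite gt_eqF.
  have h1 := derV (f := fun s => s ^+ n) (expf_neq0 n tN0) (derX n (der_id t)).
  have h2 := der_comp (f := fun s => - s^-1) (is_derive_expR (- t^-1))
    (derN (derV (f := fun s => s) tN0 (der_id t))).
  have h := derM h1 h2.
  have {}h : is_derive t 1 (fun s => s ^- n * expR (- s^-1))
    (flat n.+2 t - n%:R * flat n.+1 t).
    apply: (is_derive_eq h); rewrite /flat t0 mulr1.
    case: n {h1 h2 h} => [|n] /=; first by rewrite !expr0; field.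
    by rewrite !exprSr; field; rewrite expf_neq0// tN0.
  apply: near_eq_is_derive h.
  by near=> s; rewrite /flat ifT//; near: s; exact: lt_nbhsr.
- rewrite !flat_le0// mulr0 subr0.
  (* At the origin the difference quotient is at most (n+2)! |h| by [flat_bound]. *)
  have h : h^-1 *: (flat n (h + 0) - flat n 0) @[h --> (0 : R)^'] --> (0 : R).
    apply/cvgr0Pnorm_le => e e0; near=> h.
    have hN0 : h != 0 by near: h; exact: nbhs_dnbhs_neq.
    rewrite addr0 (flat_le0 n (lexx 0)) subr0 normrZ normfV.
    rewrite ler_pdivrMl ?normr_gt0// (ger0_norm (flat_ge0 _ _)).
    rewrite (le_trans (flat_bound _ _))// -[h ^+ 2]ger0_norm ?sqr_ge0// normrX expr2 mulrA.
    rewrite [leRHS]mulrC ler_wpM2r//.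
    rewrite mulrC -ler_pdivlMr ?ltr0n ?fact_gt0//.
    by near: h; apply: dnbhs0_le; rewrite divr_gt0// ltr0n fact_gt0.
  apply: DeriveDef.
    by apply/cvg_ex; exists 0; under eq_fun do rewrite scaler1; exact: h.
  by rewrite /derive; under eq_fun do rewrite scaler1; exact: cvg_lim h.
Unshelve. all: by end_near. Qed.

End flat_functions.

(** * A derivative-closed class of smooth functions *)

Section smooth_functions.
Variable R : realType.
Local Notation mT := (measurableTypeR R).
Implicit Types (f g phi : R4 R -> R) (i : 'I_4).

(* A class of functions closed under partial derivatives that contains the bubble and
   enough bump functions. *)
Inductive smooth : (R4 R -> R) -> Prop :=
| smooth_cst c : smooth (fun _ => c)
| smooth_coord i : smooth (coord i)
| smoothD f g : smooth f -> smooth g -> smooth (fun x => f x + g x)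
| smoothM f g : smooth f -> smooth g -> smooth (fun x => f x * g x)
| smooth_flat n f : smooth f -> smooth (fun x => flat n (f x))
| smoothV f : smooth f -> (forall x, 0 < f x) -> smooth (fun x => (f x)^-1).

Definition has_grad f (df : 'I_4 -> R4 R -> R) := forall i x,
  is_derive (0 : R) 1 (fun t => f (shift i t x)) (df i x).

Lemma shift0 i (x : R4 R) : shift i 0 x = x.
Proof. by rewrite shiftE addr0 ins_coord_del. Qed.

Lemma has_grad_pd f df : has_grad f df -> forall i, pd i f = df i.
Proof.
by move=> h i; apply/funext => x; rewrite /pd (der_derive1 (h i x)).2.
Qed.

Lemma has_grad_ins f df : has_grad f df -> forall i y (t : R),
  is_derive t 1 (fun t => f (ins i t y)) (df i (ins i t y)).
Proof.
move=> h i y t; have h0 := h i (ins i t y).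
have := der_comp (g := fun s => f (shift i s (ins i t y))) (f := fun r => r - t)
  (x := t) (df := 1 - 0) (dg := df i (ins i t y)).
rewrite subrr => /(_ h0 (derB (der_id t) (der_cst t t))).
rewrite subr0 mulr1; congr is_derive; apply/funext => r.
by rewrite shift_ins addrC subrK.
Qed.

Lemma has_gradD f g df dg : has_grad f df -> has_grad g dg ->
  has_grad (fun x => f x + g x) (fun i x => df i x + dg i x).
Proof. by move=> hf hg i x; exact: derD (hf i x) (hg i x). Qed.

Lemma has_gradM f g df dg : has_grad f df -> has_grad g dg ->
  has_grad (fun x => f x * g x) (fun i x => df i x * g x + f x * dg i x).
Proof.
move=> hf hg i x; have := derM (hf i x) (hg i x); by rewrite !shift0.
Qed.

Lemma has_grad_comp (h dh : R -> R) f df : (forall t : R, is_derive t 1 h (dh t)) ->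
  has_grad f df -> has_grad (fun x => h (f x)) (fun i x => dh (f x) * df i x).
Proof.
move=> hh hf i x; have := der_comp (f := fun t => f (shift i t x)) (hh _) (hf i x).
by rewrite shift0.
Qed.

Lemma has_gradV f df : (forall x, 0 < f x) -> has_grad f df ->
  has_grad (fun x => (f x)^-1) (fun i x => - df i x * ((f x)^-1 * (f x)^-1)).
Proof.
move=> f0 hf i x.
have f0' : f (shift i 0 x) != 0 by rewrite gt_eqF.
have := derV (f := fun t => f (shift i t x)) f0' (hf i x).
by rewrite shift0 expr2 invfM.
Qed.

Lemma has_grad_coord j : has_grad (coord j) (fun i _ => (i == j)%:R).
Proof.
move=> i x; have h : is_derive (0 : R) 1 (fun t => coord j x + (i == j)%:R * t) (i == j)%:R.
  have := derD (der_cst (coord j x) 0) (derMl (i == j)%:R (der_id 0)).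
  by rewrite add0r mulr1.
move: h; congr is_derive; apply/funext => t.
by case: i j => [[|[|[|[|?]]]] //= i4] [[|[|[|[|?]]]] //= j4];
   rewrite /coord /shift -val_eqE /=.
Qed.

Lemma smooth_grad f : smooth f ->
  exists df, has_grad f df /\ forall i, smooth (df i).
Proof.
elim=> {f} [c|j|f g sf [df [hf sdf]] sg [dg [hg sdg]]
  |f g sf [df [hf sdf]] sg [dg [hg sdg]]|n f sf [df [hf sdf]]
  |f sf [df [hf sdf]] f0].
- exists (fun _ _ => 0); split=> [i x|i]; first exact: der_cst.
  exact: smooth_cst.
- exists (fun i _ => (i == j)%:R); split; first exact: has_grad_coord.
  by move=> i; exact: smooth_cst.
- exists (fun i x => df i x + dg i x); split; first exact: has_gradD.
  by move=> i; exact: smoothD.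
- exists (fun i x => df i x * g x + f x * dg i x); split; first exact: has_gradM.
  by move=> i; apply: smoothD; exact: smoothM.
- exists (fun i x => (flat n.+2 (f x) - n%:R * flat n.+1 (f x)) * df i x); split.
    exact: (has_grad_comp (dh := fun t => flat n.+2 t - n%:R * flat n.+1 t) (der_flat n)).
  move=> i; apply: smoothM => //; apply: smoothD; first exact: smooth_flat.
  under eq_fun do rewrite -mulNr.
  by apply: smoothM; [exact: smooth_cst|exact: smooth_flat].
- exists (fun i x => - df i x * ((f x)^-1 * (f x)^-1)); split; first exact: has_gradV.
  move=> i; apply: smoothM; last by apply: smoothM; exact: smoothV.
  under eq_fun do rewrite -mulN1r.
  by apply: smoothM => //; exact: smooth_cst.
Qed.

Lemma smooth_pd f i : smooth f -> smooth (pd i f).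
Proof. by move=> /smooth_grad[df [hf sdf]]; rewrite (has_grad_pd hf). Qed.

Lemma smooth_has_grad f : smooth f -> has_grad f (fun i => pd i f).
Proof.
move=> /smooth_grad[df [hf _]] i x.
by rewrite (has_grad_pd hf).
Qed.

Lemma coord_continuous i : continuous (coord (R := R) i).
Proof.
case: i => -[|[|[|[|?]]]] // i4 x; rewrite /coord /=.
- by apply: (cvg_comp fst fst); [exact: cvg_fst|exact: cvg_fst].
- by apply: (cvg_comp fst snd); [exact: cvg_fst|exact: cvg_snd].
- by apply: (cvg_comp snd fst); [exact: cvg_snd|exact: cvg_fst].
- by apply: (cvg_comp snd snd); [exact: cvg_snd|exact: cvg_snd].
Qed.

Lemma smooth_continuous f : smooth f -> continuous f.
Proof.
elim=> {f} [c|j|f g sf cf sg cg|f g sf cf sg cg|n f sf cf|f sf cf f0] x.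
- exact: cvg_cst.
- exact: coord_continuous.
- by apply: cvgD; [exact: cf|exact: cg].
- by apply: cvgM; [exact: cf|exact: cg].
- apply: (cvg_comp f (flat n)); first exact: cf.
  exact: (der_continuous (der_flat n (f x))).
- by apply: cvgV; [rewrite gt_eqF|exact: cf].
Qed.

Lemma measurable_coord i :
  measurable_fun setT (coord i : (mT * mT) * (mT * mT) -> R).
Proof.
case: i => -[|[|[|[|?]]]] // i4; rewrite /coord /=.
- exact: (measurableT_comp measurable_fst measurable_fst).
- exact: (measurableT_comp measurable_snd measurable_fst).
- exact: (measurableT_comp measurable_fst measurable_snd).
- exact: (measurableT_comp measurable_snd measurable_snd).
Qed.

Lemma smooth_measurable f : smooth f -> measurable_fun setT f.
Proof.
elim=> {f} [c|j|f g sf cf sg cg|f g sf cf sg cg|n f sf cf|f sf cf f0].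
- exact: measurable_cst.
- exact: measurable_coord.
- exact: measurable_funD.
- exact: measurable_funM.
- apply: (measurableT_comp (continuous_measurable_fun _) cf) => t.
  exact: (der_continuous (der_flat n t)).
- exact: measurable_funVr.
Qed.

(** Closure of the class under [pd] makes every iterated partial derivative smooth again, hence
    derivable along the axes and continuous. *)
Lemma smooth_test_fun f (M : R) : smooth f ->
  (forall x i, M < `|coord i x| -> f x = 0) -> test_fun f.
Proof.
move=> sf supp.
have sd s : smooth (dpart s f) by elim: s => //= i s IH; exact: smooth_pd.
split; [|split].
- by move=> s i x; case: (smooth_has_grad (sd s) i x).
- by move=> s; exact: smooth_continuous.
- by exists M => x [i]; exact: supp.
Qed.

End smooth_functions.

(** * The one-dimensional mollifier *)

Section mollifier1.
Variable R : realType.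
Local Notation mu := (@lebesgue_measure R).
Local Notation mT := (measurableTypeR R).

Definition bump (t : R) : R := flat 0 (1 - t ^+ 2).

Lemma bump_ge0 t : 0 <= bump t. Proof. exact: flat_ge0. Qed.

Lemma bump_le1 t : bump t <= 1.
Proof.
rewrite /bump /flat; case: ifP => // t0.
rewrite expr0 invr1 mul1r -[leRHS]expR0 ler_expR oppr_le0 invr_ge0; exact: ltW.
Qed.

Lemma bump_supp t : 1 <= `|t| -> bump t = 0.
Proof.
move=> t1; apply: flat_le0; rewrite subr_le0 -[t ^+ 2]ger0_norm ?sqr_ge0// normrX.
exact: exprn_ege1.
Qed.

Lemma bump_cont : continuous bump.
Proof.
move=> t; have h := derB (der_cst 1 t) (derX 2 (der_id t)).
exact: der_continuous (der_comp (f := fun t => 1 - t ^+ 2) (der_flat 0 _) h).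
Qed.

Lemma measurable_bump : measurable_fun setT bump.
Proof. exact: continuous_measurable_fun bump_cont. Qed.

Lemma bump_integrable : mu.-integrable setT (EFin \o bump).
Proof.
have i1 : mu.-integrable setT (EFin \o \1_(`[-1, 1] : set R)).
  by apply: integrable_indic_itv.
apply: (le_integrable measurableT _ _ i1).
  by apply/measurable_EFinP; exact: measurable_bump.
move=> t _; rewrite /= lee_fin (ger0_norm (bump_ge0 t)) ger0_norm ?indicE//.
have [t1|t1] := lerP 1 `|t|; first by rewrite bump_supp.
rewrite mem_set ?bump_le1//= in_itv/= -ler_norml; exact: ltW.
Qed.

Definition bump_mass : R := \int[mu]_t bump t.

Lemma bump_mass_gt0 : 0 < bump_mass.
Proof.
have h2 : bump (1 / 2) > 0.
  by rewrite /bump /flat ifT ?mulr_gt0 ?expR_gt0 ?invr_gt0 ?exprn_gt0//; lra.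
apply: (lt_le_trans h2).
have i1 : mu.-integrable setT (EFin \o (fun t => bump (1 / 2) * \1_(`[- (1 / 2), 1 / 2] : set R) t)).
  have i0 := integrable_indic_itv (- (1 / 2) : R) (1 / 2) true false.
  exact: (integrableZl measurableT (bump (1 / 2)) i0).
have -> : bump (1 / 2) = \int[mu]_t (bump (1 / 2) * \1_(`[- (1 / 2), 1 / 2] : set R) t).
  rewrite RintegralZl//; last first.
    exact: (integrable_indic_itv (- (1 / 2) : R) (1 / 2) true false).
  rewrite /Rintegral integral_indic// setIT /= lebesgue_measure_itv/= lte_fin.
  rewrite ifT; last by lra.
  by rewrite -EFinD/=; lra.
apply: le_Rintegral => //; first exact: bump_integrable.
move=> t _; rewrite indicE; have [|_] := boolP (t \in _); last by rewrite mulr0 bump_ge0.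
rewrite inE/= in_itv/= mulr1 => /andP[t1 t2].
rewrite /bump /flat ifT; last by lra.
have t3 : t ^+ 2 <= (1 / 2) ^+ 2 by rewrite -[t ^+ 2]ger0_norm ?sqr_ge0// normrX ler_pXn2r ?nnegrE// ler_norml t1.
rewrite ifT; last by rewrite subr_gt0 (le_lt_trans t3)//; lra.
rewrite !expr0 !invr1 !mul1r ler_expR lerN2 lef_pV2 ?posrE; lra.
Qed.

Definition eta n (t : R) : R := n.+1%:R * bump (n.+1%:R * t) / bump_mass.

Lemma eta_ge0 n t : 0 <= eta n t.
Proof. by rewrite !mulr_ge0 ?bump_ge0// invr_ge0 ltW// bump_mass_gt0. Qed.

Lemma eta_supp n t : n.+1%:R^-1 <= `|t| -> eta n t = 0.
Proof.
move=> t1; rewrite /eta bump_supp ?mulr0 ?mul0r// normrM ger0_norm//.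
by rewrite -ler_pdivrMl ?mulr1.
Qed.

Lemma eta_supp1 n t : 1 <= `|t| -> eta n t = 0.
Proof.
by move=> t1; apply: eta_supp; rewrite (le_trans _ t1)// invf_le1 ?ler1n.
Qed.

Lemma etaN n t : eta n (- t) = eta n t.
Proof. by rewrite /eta /bump mulrN sqrrN. Qed.

Lemma eta_le n t : eta n t <= n.+1%:R / bump_mass.
Proof.
rewrite /eta ler_wpM2r ?invr_ge0 ?(ltW bump_mass_gt0)//.
by rewrite ler_piMr ?bump_le1.
Qed.

Lemma eta_cont n : continuous (eta n).
Proof.
move=> t; apply: cvgM; last exact: cvg_cst.
apply: cvgM; first exact: cvg_cst.
apply: (cvg_comp (fun t => n.+1%:R * t) bump); last exact: bump_cont.
by apply: cvgM; [exact: cvg_cst|exact: cvg_id].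
Qed.

Lemma integral_eta n (x : R) : (\int[mu]_t (eta n (t - x))%:E = 1)%E.
Proof.
pose F (t : R) := n.+1%:R * (t - x).
have n0 : (0 : R) < n.+1%:R by rewrite ltr0n.
have dF (t : R) : is_derive t 1 F n.+1%:R.
  have := derMl n.+1%:R (derB (der_id t) (der_cst x t)).
  by rewrite subr0 mulr1.
have dFE : derive1 F = cst n.+1%:R.
  by apply/funext => t; rewrite (der_derive1 (dF t)).2.
have Zp := bump_mass_gt0.
have h : (\int[mu]_t (bump t)%:E = \int[mu]_t (((bump \o F) * derive1 F)%R t)%:E)%E.
  apply: increasing_ge0_integration_by_substitutionT.
  - by move=> s t st; rewrite /F ltr_pM2l// ltrD2r.
  - by rewrite dFE => t; exact: cvg_cst.
  - by rewrite dFE; exact: is_cvg_cst.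
  - by rewrite dFE; exact: is_cvg_cst.
  - by move=> t; case: (dF t).
  - apply/cvgrNyPle => A; near=> t.
    rewrite /F mulrC -ler_pdivlMr// lerBlDr; near: t.
    exact: nbhs_ninfty_le (num_real _).
  - apply/cvgryPge => A; near=> t.
    rewrite /F mulrC -ler_pdivrMr// lerBrDr; near: t.
    exact: nbhs_pinfty_ge (num_real _).
  - exact: bump_cont.
  - exact: bump_ge0.
transitivity (\int[mu]_t (bump_mass^-1%:E * (((bump \o F) * derive1 F)%R t)%:E))%E.
  apply: eq_integral => t _; rewrite -EFinM; congr EFin.
  have -> : ((bump \o F) * derive1 F) t = bump (F t) * n.+1%:R by rewrite dFE.
  by rewrite [RHS]mulrC (mulrC (bump (F t))).
rewrite ge0_integralZl//; first last.
- by rewrite lee_fin invr_ge0 ltW.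
- by move=> t _; rewrite lee_fin dFE mulr_ge0// bump_ge0.
- apply/measurable_EFinP; rewrite dFE; apply: measurable_funM => //.
  apply: (measurableT_comp measurable_bump).
  by apply: measurable_funM => //; exact: measurable_funB.
rewrite -h -(fineK (integrable_fin_num measurableT bump_integrable)).
by rewrite -EFinM mulVf// gt_eqF.
Unshelve. all: by end_near. Qed.

End mollifier1.

(** * Separately continuous functions and compact supports *)

Section sepcont.
Variable R : realType.
Local Notation mT := (measurableTypeR R).

(** The Carathéodory lemma is applied once per added coordinate. Continuity along axis-parallel
    lines is enough, and for convolutions only this is available directly. *)
Lemma sepcont_measurable (f : R4 R -> R) :
  (forall i y, continuous (fun t : R => f (ins i t y))) -> measurable_fun setT f.
Proof.
move=> cf.
have h1 (x2 x3 x4 : R) : measurable_fun setT (fun x1 : mT => f ((x1, x2), (x3, x4))).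
  exact: continuous_measurable_fun (@cf (@Ordinal 4 0 isT) ((x2, x3), x4)).
have h2 (x3 x4 : R) : measurable_fun setT (fun c : mT * mT => f ((c.1, c.2), (x3, x4))).
  apply: caratheodory_measurable => [x2|x1]; first exact: h1.
  exact: (@cf (@Ordinal 4 1 isT) ((x1, x3), x4)).
have h3 (x4 : R) :
    measurable_fun setT (fun z : (mT * mT) * mT => f ((z.1.1, z.1.2), (z.2, x4))).
  apply: caratheodory_measurable => [x3|x1]; first exact: h2.
  exact: (@cf (@Ordinal 4 2 isT) (x1, x4)).
have h4 : measurable_fun setT
    (fun z : ((mT * mT) * mT) * mT => f ((z.1.1.1, z.1.1.2), (z.1.2, z.2))).
  apply: caratheodory_measurable => [x4|y]; first exact: h3.
  exact: (@cf (@Ordinal 4 3 isT) y).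
have m1 : measurable_fun setT (fun x : (mT * mT) * (mT * mT) => ((x.1, x.2.1), x.2.2)).
  apply: measurable_fun_pair.
    by apply: measurable_fun_pair => //; exact: (measurableT_comp measurable_fst measurable_snd).
  exact: (measurableT_comp measurable_snd measurable_snd).
have := measurableT_comp h4 m1; congr measurable_fun.
by apply/funext => -[[x1 x2] [x3 x4]].
Qed.

Lemma continuous_sepcont (f : R4 R -> R) : continuous f ->
  forall i y, continuous (fun t : R => f (ins i t y)).
Proof.
move=> cf i y t.
apply: (cvg_comp (fun t => ins i t y) f (G := nbhs (ins i t y))); last exact: cf.
have pair (U V : topologicalType) (a : R -> U) (b : R -> V) :
    a s @[s --> t] --> a t -> b s @[s --> t] --> b t ->
    (a s, b s) @[s --> t] --> (a t, b t).
  exact: (@cvg_pair _ _ _ _ (nbhs (a t)) (nbhs (b t))).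
have idt : (s : R) @[s --> t] --> t by exact: cvg_id.
have cst (a : R) : a @[_ --> t] --> a by exact: cvg_cst.
case: i => -[|[|[|[|?]]]] // i4; rewrite /ins /=.
- exact: (pair _ _ (fun s => (s, _)) (fun=> (_, _)) (pair _ _ id (fun=> _) idt (cst _)) (pair _ _ (fun=> _) (fun=> _) (cst _) (cst _))).
- exact: (pair _ _ (fun s => (_, s)) (fun=> (_, _)) (pair _ _ (fun=> _) id (cst _) idt) (pair _ _ (fun=> _) (fun=> _) (cst _) (cst _))).
- exact: (pair _ _ (fun=> (_, _)) (fun s => (s, _)) (pair _ _ (fun=> _) (fun=> _) (cst _) (cst _)) (pair _ _ id (fun=> _) idt (cst _))).
- exact: (pair _ _ (fun=> (_, _)) (fun s => (_, s)) (pair _ _ (fun=> _) (fun=> _) (cst _) (cst _)) (pair _ _ (fun=> _) id (cst _) idt)).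
Qed.

Lemma continuous_supp_bounded (f : R4 R -> R) (M : R) : continuous f ->
  (forall x i, M < `|coord i x| -> f x = 0) -> exists B, forall x, `|f x| <= B.
Proof.
move=> cf supp.
pose D : set (R4 R) := (`[- M, M] `*` `[- M, M]) `*` (`[- M, M] `*` `[- M, M]).
have cD : compact D.
  by apply: compact_setX; apply: compact_setX; exact: segment_compact.
have cfD : compact (f @` D).
  by apply: continuous_compact cD; exact: continuous_subspaceT.
have [B [Br hB]] := compact_bounded cfD.
exists (`|B| + 1) => x; have [xD|xD] := pselect (D x).
  apply: (hB (`|B| + 1)); last by exists x.
  by rewrite (le_lt_trans (ler_norm _))// ltrDl.
rewrite (_ : f x = 0) ?normr0 ?addr_ge0//.
have : ~ box M x by rewrite boxE.
by move=> /existsNP[i]; rewrite -ler_norml => /negP; rewrite -ltNge => /supp.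
Qed.

(** The condition M < |x_i| is open, so f vanishes along the line for small t and its derivative
    there is 0. *)
Lemma pd_supp (f : R4 R -> R) df (M : R) : has_grad f df ->
  (forall x i, M < `|coord i x| -> f x = 0) ->
  forall j x i, M < `|coord i x| -> df j x = 0.
Proof.
move=> hf supp j x i Mx.
have h := hf j x.
have h0 : is_derive (0 : R) 1 (fun t => f (shift j t x)) 0.
  have hc := der_cst (0 : R) 0; apply: near_eq_is_derive hc.
  near=> t; rewrite (supp _ i)//; near: t.
  have ct : coord i (shift j t x) @[t --> (0 : R)] --> coord i (shift j 0 x).
    exact: (der_continuous (has_grad_coord i j x)).
  rewrite shift0 in ct.
  exact: (cvgr_norm_gt _ ct _ Mx).
by rewrite -(der_derive1 h).2 (der_derive1 h0).2.
Unshelve. all: by end_near. Qed.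

End sepcont.

(** * Integrability criteria and differentiation under the integral *)

Section integral_tools.
Context d (T : measurableType d) (R : realType).
Variable m : {measure set T -> \bar R}.
Implicit Types f g h : T -> R.

Lemma le_integrableR f g : measurable_fun setT f ->
  (forall x, `|f x| <= g x) -> m.-integrable setT (EFin \o g) ->
  m.-integrable setT (EFin \o f).
Proof.
move=> mf fg ig; apply: (le_integrable measurableT _ _ ig).
  exact/measurable_EFinP.
by move=> x _; rewrite /= lee_fin (le_trans (fg x))// ler_norm.
Qed.

Lemma ge0_integrableR f : measurable_fun setT f -> (forall x, 0 <= f x) ->
  (\int[m]_x (f x)%:E < +oo)%E -> m.-integrable setT (EFin \o f).
Proof.
move=> mf f0 fi; apply/integrableP; split; first exact/measurable_EFinP.
move: fi; congr (_ < _)%E; apply: eq_integral => x _.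
by rewrite /= ger0_norm.
Qed.

Lemma integrable_measurable f : m.-integrable setT (EFin \o f) -> measurable_fun setT f.
Proof. by case/integrableP => /measurable_EFinP. Qed.

Lemma integrable_RintegralE f : m.-integrable setT (EFin \o f) ->
  (\int[m]_x (f x)%:E = (\int[m]_x f x)%:E)%E.
Proof. by move=> fi; rewrite /Rintegral fineK//; exact: integrable_fin_num fi. Qed.

Lemma integrableZR (c : R) f : m.-integrable setT (EFin \o f) ->
  m.-integrable setT (EFin \o (fun x => c * f x)).
Proof. by move=> fi; exact: (integrableZl measurableT c fi). Qed.

Lemma integrableDR f g : m.-integrable setT (EFin \o f) ->
  m.-integrable setT (EFin \o g) -> m.-integrable setT (EFin \o (fun x => f x + g x)).
Proof. by move=> fi gi; exact: (integrableD measurableT fi gi). Qed.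

Lemma integrable_normR f : m.-integrable setT (EFin \o f) ->
  m.-integrable setT (EFin \o (fun x => `|f x|)).
Proof. by move=> fi; exact: (integrable_abse fi). Qed.

Lemma integrable_mulb h f (C : R) : m.-integrable setT (EFin \o h) ->
  measurable_fun setT f -> (forall x, `|f x| <= C) ->
  m.-integrable setT (EFin \o (fun x => h x * f x)).
Proof.
move=> hi mf fC; have mh := integrable_measurable hi.
have ahi : m.-integrable setT (EFin \o (fun x => C * `|h x|)).
  exact: (integrableZR C (integrable_normR hi)).
apply: le_integrableR ahi; first exact: measurable_funM.
by move=> x; rewrite normrM mulrC ler_wpM2r.
Qed.

Lemma Rintegral_sum (I : Type) (r : seq I) (f : I -> T -> R) :
  (forall k, m.-integrable setT (EFin \o f k)) ->
  m.-integrable setT (EFin \o (fun x => \sum_(k <- r) f k x)) /\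
  \int[m]_x (\sum_(k <- r) f k x) = \sum_(k <- r) \int[m]_x f k x.
Proof.
move=> fi; elim: r => [|k r [IH1 IH2]].
  rewrite big_nil (_ : (fun x => _) = cst 0).
    by split; [exact: integrable0|rewrite /Rintegral integral0].
  by apply/funext => x; rewrite big_nil.
rewrite big_cons (_ : (fun x => _) = (fun x => f k x + \sum_(k <- r) f k x)).
  by split; [exact: integrableDR|rewrite RintegralD ?IH2].
by apply/funext => x; rewrite big_cons.
Qed.

Lemma der_under_integral (F dF : R -> T -> R) (G : T -> R) (a : R) :
  (forall t, m.-integrable setT (EFin \o F t)) ->
  (forall t y, is_derive (t : R) 1 (F ^~ y) (dF t y)) ->
  (forall t y, `|dF t y| <= G y) -> m.-integrable setT (EFin \o G) ->
  is_derive a 1 (fun t => \int[m]_y F t y) (\int[m]_y dF a y).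
Proof.
move=> iF hF dFG iG.
have I0 : `]a - 1, a + 1[%classic a.
  by rewrite /= in_itv/= ltrBlDr ltrDl ltr01.
have G0 y : 0 <= G y := le_trans (normr_ge0 _) (dFG 0 y).
have dE t y : partial1of2 F t y = dF t y by rewrite /partial1of2 (der_derive1 (hF t y)).2.
have bd t y : `]a - 1, a + 1[%classic t -> setT y -> `|partial1of2 F t y| <= G y.
  by rewrite dE.
have h := cvg_differentiation_under_integral measurableT I0
  (fun t _ => iF t) (fun t y _ _ => (der_derive1 (hF t y)).1) G0 iG bd.
have {}h : h^-1 *: (\int[m]_y F (h + a) y - \int[m]_y F a y) @[h --> (0 : R)^']
    --> \int[m]_y dF a y.
  by rewrite (_ : \int[m]_y dF a y = \int[m]_y partial1of2 F a y)//;
    apply: eq_Rintegral => y _; rewrite dE.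
apply: DeriveDef.
  apply/cvg_ex; exists (\int[m]_y dF a y).
  by under eq_fun do rewrite scaler1; exact: h.
by rewrite /derive; under eq_fun do rewrite scaler1; exact: cvg_lim h.
Qed.

End integral_tools.

(** * Translations and reflections in R^4 *)

Section difference.
Variable R : realType.
Local Notation mT := (measurableTypeR R).
Local Notation mT4 := ((mT * mT) * (mT * mT))%type.
Implicit Types (f : R4 R -> R) (x y : R4 R) (i : 'I_4).

Lemma coordB i x y : coord i (x - y) = coord i x - coord i y.
Proof. by case: i => -[|[|[|[|?]]]]. Qed.

Lemma R4P x y : (forall i, coord i x = coord i y) -> x = y.
Proof.
case: x y => [[a b] [c e]] [[a' b'] [c' e']] h.
have := h (@Ordinal 4 0 isT); have := h (@Ordinal 4 1 isT).
have := h (@Ordinal 4 2 isT); have := h (@Ordinal 4 3 isT).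
by rewrite /coord /= => -> -> -> ->.
Qed.

Lemma coord_shift i j (t : R) x : coord j (shift i t x) = coord j x + (i == j)%:R * t.
Proof.
by case: i j => [[|[|[|[|?]]]] //= i4] [[|[|[|[|?]]]] //= j4];
   rewrite /coord /shift -val_eqE /=.
Qed.

Lemma shift_subl i (t : R) x y : shift i t x - y = shift i t (x - y).
Proof. by apply: R4P => j; rewrite coord_shift !coordB coord_shift addrAC. Qed.

Lemma shift_subr i (t : R) x y : x - shift i t y = shift i (- t) (x - y).
Proof.
by apply: R4P => j; rewrite coord_shift !coordB coord_shift mulrN opprD addrA.
Qed.

Lemma has_grad_subl f df y : has_grad f df ->
  has_grad (fun x => f (x - y)) (fun i x => df i (x - y)).
Proof.
move=> hf i x; have := hf i (x - y); congr is_derive.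
by apply/funext => t; rewrite shift_subl.
Qed.

Lemma has_grad_subr f df x : has_grad f df ->
  has_grad (fun y => f (x - y)) (fun i y => - df i (x - y)).
Proof.
move=> hf i y; have h0 := hf i (x - y).
have := der_comp (g := fun s => f (shift i s (x - y))) (f := fun r => - r)
  (x := 0) (df := - 1) (dg := df i (x - y)).
rewrite oppr0 => /(_ h0 (derN (der_id 0))); rewrite mulrN1; congr is_derive.
by apply/funext => t; rewrite shift_subr.
Qed.

Lemma smooth_opp f : smooth f -> smooth (fun x => - f x).
Proof.
move=> sf; under eq_fun do rewrite -mulN1r.
by apply: smoothM => //; exact: smooth_cst.
Qed.

Lemma smooth_subr f x : smooth f -> smooth (fun y => f (x - y)).
Proof.
elim=> {f} [c|j|f g sf cf sg cg|f g sf cf sg cg|n f sf cf|f sf cf f0].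
- exact: smooth_cst.
- under eq_fun do rewrite coordB.
  by apply: smoothD; [exact: smooth_cst|apply: smooth_opp; exact: smooth_coord].
- exact: smoothD.
- exact: smoothM.
- exact: smooth_flat.
- exact: smoothV.
Qed.

Lemma smooth_prod (I : Type) (r : seq I) (f : I -> R4 R -> R) :
  (forall k, smooth (f k)) -> smooth (fun x => \prod_(k <- r) f k x).
Proof.
move=> sf; elim: r => [|k r IH].
  by under eq_fun do rewrite big_nil; exact: smooth_cst.
by under eq_fun do rewrite big_cons; exact: smoothM.
Qed.

Lemma measurable_sub4 : measurable_fun setT (fun z : mT4 * mT4 => (z.1 - z.2 : R4 R) : mT4).
Proof.
have m1 i : measurable_fun setT (fun z : mT4 * mT4 => coord i z.1 - coord i z.2).
  by apply: measurable_funB; apply: (measurableT_comp (measurable_coord i)).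
have := measurable_fun_pair
  (measurable_fun_pair (m1 (@Ordinal 4 0 isT)) (m1 (@Ordinal 4 1 isT)))
  (measurable_fun_pair (m1 (@Ordinal 4 2 isT)) (m1 (@Ordinal 4 3 isT))).
by congr measurable_fun.
Qed.

Lemma measurable_subr f x : measurable_fun setT (f : mT4 -> R) ->
  measurable_fun setT (fun y : mT4 => f (x - y)).
Proof.
move=> mf; apply: (measurableT_comp mf).
by apply: (measurableT_comp measurable_sub4 (g := fun y => (x, y)));
  exact: measurable_fun_pair.
Qed.

Lemma measurable_subl f y : measurable_fun setT (f : mT4 -> R) ->
  measurable_fun setT (fun x : mT4 => f (x - y)).
Proof.
move=> mf; apply: (measurableT_comp mf).
by apply: (measurableT_comp measurable_sub4 (g := fun x => (x, y)));
  exact: measurable_fun_pair.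
Qed.

End difference.

(** * Convolution with a bounded kernel *)

Section convolution.
Variable R : realType.
Local Notation mT := (measurableTypeR R).
Local Notation mu := (@lebesgue_measure R).
Local Notation mu4 := (pow4 mu).
Implicit Types (h Psi : R4 R -> R) (x y : R4 R) (i : 'I_4).

Definition conv Psi h x : R := \int[mu4]_y (h y * Psi (x - y)).

Lemma conv_integrable h Psi C x : mu4.-integrable setT (EFin \o h) ->
  measurable_fun setT Psi -> (forall x, `|Psi x| <= C) ->
  mu4.-integrable setT (EFin \o (fun y => h y * Psi (x - y))).
Proof.
move=> hi mPsi PsiC; apply: (integrable_mulb hi (measurable_subr x mPsi)).
by move=> y; exact: PsiC.
Qed.

Lemma conv_bound h Psi C : mu4.-integrable setT (EFin \o h) ->
  measurable_fun setT Psi -> (forall x, `|Psi x| <= C) ->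
  forall x, `|conv Psi h x| <= \int[mu4]_y (C * `|h y|).
Proof.
move=> hi mPsi PsiC x; have ic := conv_integrable x hi mPsi PsiC.
have ahi := integrableZR C (integrable_normR hi).
apply: (le_trans (le_normr_Rintegral measurableT ic)).
apply: le_Rintegral => //; first exact: (integrable_abse ic).
by move=> y _; rewrite normrM mulrC ler_wpM2r.
Qed.

(** Differentiation under the integral falls on the kernel, with the integrable majorant C' |h|. *)
Lemma conv_der h Psi dPsi C C' : mu4.-integrable setT (EFin \o h) ->
  measurable_fun setT Psi -> (forall x, `|Psi x| <= C) ->
  has_grad Psi dPsi -> (forall i x, `|dPsi i x| <= C') ->
  forall i z (t : R), is_derive t 1 (fun t => conv Psi h (ins i t z))
    (conv (dPsi i) h (ins i t z)).
Proof.
move=> hi mPsi PsiC hPsi dPsiC i z t.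
have ahi : mu4.-integrable setT (EFin \o (fun y => C' * `|h y|)).
  exact: (integrableZR C' (integrable_normR hi)).
have := @der_under_integral _ _ _ mu4 (fun t y => h y * Psi (ins i t z - y))
  (fun t y => h y * dPsi i (ins i t z - y)) _ t _ _ _ ahi; apply.
- by move=> s; exact: conv_integrable hi mPsi PsiC.
- by move=> s y; exact: derMl (has_grad_ins (has_grad_subl y hPsi) i z s).
- by move=> s y; rewrite normrM mulrC ler_wpM2r.
Qed.

Lemma conv_supp h Psi L i x : (forall y, L < `|coord i y| -> h y = 0) ->
  (forall z, 1 < `|coord i z| -> Psi z = 0) ->
  L + 1 < `|coord i x| -> conv Psi h x = 0.
Proof.
move=> h0 P0 Lx; transitivity (\int[mu4]_y (0 : R)); last by rewrite /Rintegral integral0.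
apply: eq_Rintegral => y _; have [yL|yL] := ltrP L `|coord i y|; first by rewrite h0 ?mul0r.
rewrite P0 ?mulr0// coordB -(ltrD2l L) (lt_le_trans Lx)//.
by rewrite -{1}[coord i x](subrK (coord i y)) (le_trans (ler_normD _ _))// addrC lerD2r.
Qed.

End convolution.

(** * The product kernel on R^4 *)

Section kernel.
Variable R : realType.
Local Notation mT := (measurableTypeR R).
Local Notation mT4 := ((mT * mT) * (mT * mT))%type.
Local Notation mu := (@lebesgue_measure R).
Local Notation mu4 := (pow4 mu).
Implicit Types (x y : R4 R) (i j : 'I_4) (nu : 'I_4 -> nat).

Lemma prodI4 (f : 'I_4 -> R) : \prod_(j < 4) f j =
  f (@Ordinal 4 0 isT) * f (@Ordinal 4 1 isT) * f (@Ordinal 4 2 isT) * f (@Ordinal 4 3 isT).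
Proof.
rewrite !big_ord_recl big_ord0 mulr1 !mulrA.
by congr (_ * _ * _ * _); congr f; exact: val_inj.
Qed.

Lemma integral_prod1 (a : 'I_4 -> R -> R) :
  (forall j, measurable_fun setT (a j)) -> (forall j t, 0 <= a j t) ->
  (forall j, \int[mu]_t (a j t)%:E = 1)%E ->
  (\int[mu4]_x (\prod_(j < 4) a j (coord j x))%:E = 1)%E.
Proof.
move=> ma a0 a1.
have mprod : measurable_fun setT (fun x : mT4 => \prod_(j < 4) a j (coord j x)).
  by apply: measurable_prod => j _; apply: (measurableT_comp (ma j)); exact: measurable_coord.
have int1 (c : R) j : 0 <= c -> (\int[mu]_t (c * a j t)%:E = c%:E)%E.
  move=> c0; under eq_integral do rewrite EFinM.
  rewrite ge0_integralZl//; [by rewrite a1 mule1| |by move=> t _; rewrite lee_fin].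
  by apply/measurable_EFinP; exact: ma.
rewrite (tonelli_ins mu (@Ordinal 4 3 isT)); first last.
- by move=> x; rewrite lee_fin prodr_ge0.
- exact/measurable_EFinP.
pose F (y : mT * mT * mT) := a (@Ordinal 4 0 isT) y.1.1 * a (@Ordinal 4 1 isT) y.1.2 * a (@Ordinal 4 2 isT) y.2.
transitivity (\int[pow3 mu]_y (F y)%:E)%E.
  apply: eq_integral => y _; rewrite -(int1 (F y) (@Ordinal 4 3 isT)).
    by apply: eq_integral => t _; rewrite prodI4.
  by rewrite /F !mulr_ge0.
have m11 : measurable_fun setT (fun z : (mT * mT) * mT => z.1.1).
  exact: (measurableT_comp measurable_fst measurable_fst).
have m12 : measurable_fun setT (fun z : (mT * mT) * mT => z.1.2).
  exact: (measurableT_comp measurable_snd measurable_fst).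
rewrite tonelli1; first last.
- by move=> y; rewrite lee_fin /F !mulr_ge0.
- apply/measurable_EFinP; apply: measurable_funM.
    exact: (measurable_funM (measurableT_comp (ma _) m11) (measurableT_comp (ma _) m12)).
  exact: (measurableT_comp (ma _) measurable_snd).
transitivity (\int[pow2 mu]_y (a (@Ordinal 4 0 isT) y.1 * a (@Ordinal 4 1 isT) y.2)%:E)%E.
  by apply: eq_integral => y _; rewrite -(int1 _ (@Ordinal 4 2 isT))// !mulr_ge0.
rewrite tonelli1; first last.
- by move=> y; rewrite lee_fin !mulr_ge0.
- apply/measurable_EFinP.
  exact: (measurable_funM (measurableT_comp (ma _) measurable_fst)
    (measurableT_comp (ma _) measurable_snd)).
rewrite -(a1 (@Ordinal 4 0 isT)).
by apply: eq_integral => y _; rewrite -(int1 _ (@Ordinal 4 1 isT)).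
Qed.

(** Each coordinate has its own scale, so that the four mollifications can be removed one after the
    other. *)
Definition kern nu x : R := \prod_(j < 4) eta (nu j) (coord j x).

Lemma smooth_eta n i : smooth (fun x : R4 R => eta n (coord i x)).
Proof.
apply: smoothM; last exact: smooth_cst.
apply: smoothM; first exact: smooth_cst.
apply: smooth_flat; apply: smoothD; first exact: smooth_cst.
apply: smooth_opp; under eq_fun do rewrite expr2.
have s1 : smooth (fun x : R4 R => n.+1%:R * coord i x).
  by apply: smoothM; [exact: smooth_cst|exact: smooth_coord].
exact: smoothM.
Qed.

Lemma smooth_kern nu : smooth (kern nu).
Proof. by apply: smooth_prod => j; exact: smooth_eta. Qed.

Lemma kern_ge0 nu x : 0 <= kern nu x.
Proof. by apply: prodr_ge0 => j _; exact: eta_ge0. Qed.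

Lemma kern_supp nu x i : 1 <= `|coord i x| -> kern nu x = 0.
Proof. by move=> x1; rewrite /kern (bigD1 i)//= eta_supp1// mul0r. Qed.

Lemma measurable_kern nu : measurable_fun setT (kern nu).
Proof. exact: (smooth_measurable (smooth_kern nu)). Qed.

Lemma measurable_eta n : measurable_fun setT (@eta R n).
Proof. exact: (continuous_measurable_fun (@eta_cont R n)). Qed.

Lemma integral_kernl nu y : (\int[mu4]_x (kern nu (x - y))%:E = 1)%E.
Proof.
transitivity (\int[mu4]_x (\prod_(j < 4) (fun t => eta (nu j) (t - coord j y)) (coord j x))%:E)%E.
  by apply: eq_integral => x _; congr EFin; apply: eq_bigr => j _; rewrite coordB.
apply: (integral_prod1 (a := fun j t => eta (nu j) (t - coord j y))).
- by move=> j; apply: (measurableT_comp (measurable_eta _)); exact: measurable_funB.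
- by move=> j t; exact: eta_ge0.
- by move=> j; exact: integral_eta.
Qed.

Lemma kern_sym nu x y : kern nu (x - y) = kern nu (y - x).
Proof. by apply: eq_bigr => j _; rewrite !coordB -etaN opprB. Qed.

Lemma integral_kernr nu x : (\int[mu4]_y (kern nu (x - y))%:E = 1)%E.
Proof. by under eq_integral do rewrite kern_sym; exact: integral_kernl. Qed.

Lemma kern_bounded nu : exists C, forall x, `|kern nu x| <= C.
Proof.
apply: (continuous_supp_bounded (M := 1)); first exact: (smooth_continuous (smooth_kern nu)).
by move=> x i /ltW; exact: kern_supp.
Qed.

Lemma pd_kern_supp nu j x i : 1 < `|coord i x| -> pd j (kern nu) x = 0.
Proof.
apply: (pd_supp (smooth_has_grad (smooth_kern nu)) _ _) => z k /ltW.
exact: kern_supp.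
Qed.


Lemma pd_kern_bounded nu : exists C, forall j x, `|pd j (kern nu) x| <= C.
Proof.
have h j : exists C, forall x, `|pd j (kern nu) x| <= C.
  apply: (continuous_supp_bounded (M := 1)).
    exact: (smooth_continuous (smooth_pd j (smooth_kern nu))).
  by move=> x i; exact: pd_kern_supp.
have [C hC] := choice h.
exists (\sum_(j < 4) `|C j|) => j x; rewrite (le_trans (hC j x))//.
rewrite (bigD1 j)//= (le_trans (ler_norm _))// lerDl.
exact: sumr_ge0.
Qed.

Lemma pd2_kern_bounded nu k : exists C, forall j x, `|pd j (pd k (kern nu)) x| <= C.
Proof.
have sk := smooth_pd k (smooth_kern nu).
have h j : exists C, forall x, `|pd j (pd k (kern nu)) x| <= C.
  apply: (continuous_supp_bounded (M := 1)).
    exact: (smooth_continuous (smooth_pd j sk)).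
  move=> x i; apply: (pd_supp (smooth_has_grad sk) _ _) => z l.
  exact: pd_kern_supp.
have [C hC] := choice h.
exists (\sum_(j < 4) `|C j|) => j x; rewrite (le_trans (hC j x))//.
rewrite (bigD1 j)//= (le_trans (ler_norm _))// lerDl.
exact: sumr_ge0.
Qed.

End kernel.

Lemma Rintegral_box_supp (R : realType) (L : R) (F : R4 R -> R) : measurable_fun setT F ->
  (forall x i, L < `|coord i x| -> F x = 0) ->
  \int[pow4 (muL L)]_x F x = \int[pow4 (@lebesgue_measure R)]_x F x.
Proof.
move=> mF F0; apply: (congr1 fine (integral_box_supp (F := EFin \o F) _ _)).
  exact/measurable_EFinP.
by move=> x i /F0 /= ->.
Qed.

(** * Sobolev inequality for mollified functions *)

Section mollification.
Variable R : realType.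
Local Notation mT := (measurableTypeR R).
Local Notation mT4 := ((mT * mT) * (mT * mT))%type.
Local Notation mu := (@lebesgue_measure R).
Local Notation mu4 := (pow4 mu).
Implicit Types (x y : R4 R) (i j : 'I_4) (nu : 'I_4 -> nat).

Lemma kern_integrable nu x : mu4.-integrable setT (EFin \o (fun y => kern nu (x - y))).
Proof.
apply: ge0_integrableR.
- by have := measurable_subr x (measurable_kern nu).
- by move=> y; exact: kern_ge0.
- by rewrite integral_kernr ltry.
Qed.

Lemma conv_kern_integrable nu (G : R4 R -> R) x : measurable_fun setT G ->
  mu4.-integrable setT (EFin \o (fun y => G y ^+ 2)) ->
  mu4.-integrable setT (EFin \o (fun y => G y * kern nu (x - y))).
Proof.
move=> mG iG; have [C hC] := kern_bounded R nu.
have i1 := conv_integrable x iG (measurable_kern nu) hC.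
apply: (le_integrableR _ _ (integrableDR i1 (kern_integrable nu x))).
  exact: (measurable_funM mG (measurable_subr x (measurable_kern nu))).
move=> y; have k0 := kern_ge0 nu (x - y).
have g1 : `|G y| <= G y ^+ 2 + 1.
  rewrite -[G y ^+ 2]ger0_norm ?sqr_ge0// normrX.
  by have := sqr_ge0 (`|G y| - 1); have := normr_ge0 (G y); nra.
by rewrite normrM (ger0_norm k0) (le_trans (ler_wpM2r k0 g1))// mulrDl mul1r.
Qed.

(** Jensen's inequality for the probability density kern(x - .): the variance of G, expanded, is
    non-negative. *)
Lemma conv_kern_sqr_le nu (G : R4 R -> R) x : measurable_fun setT G ->
  mu4.-integrable setT (EFin \o (fun y => G y ^+ 2)) ->
  conv (kern nu) G x ^+ 2 <= conv (kern nu) (fun y => G y ^+ 2) x.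
Proof.
move=> mG iG; have [C hC] := kern_bounded R nu.
have i2 := conv_integrable x iG (measurable_kern nu) hC.
have i1 := conv_kern_integrable nu x mG iG.
have i0 := kern_integrable nu x.
have k1 : \int[mu4]_y kern nu (x - y) = 1 by rewrite /Rintegral integral_kernr.
set a := conv (kern nu) G x.
have h : 0 <= \int[mu4]_y ((G y - a) ^+ 2 * kern nu (x - y)).
  by apply: Rintegral_ge0 => y _; rewrite mulr_ge0 ?sqr_ge0 ?kern_ge0.
have e : \int[mu4]_y ((G y - a) ^+ 2 * kern nu (x - y)) =
    conv (kern nu) (fun y => G y ^+ 2) x - a ^+ 2.
  transitivity (\int[mu4]_y (G y ^+ 2 * kern nu (x - y) +
      (- (2 * a) * (G y * kern nu (x - y)) + a ^+ 2 * kern nu (x - y)))).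
    by apply: eq_Rintegral => y _; ring.
  have i3 := integrableZR (- (2 * a)) i1; have i4 := integrableZR (a ^+ 2) i0.
  rewrite (RintegralD measurableT i2 (integrableDR i3 i4)).
  rewrite (RintegralD measurableT i3 i4).
  rewrite (RintegralZl _ measurableT i1) (RintegralZl _ measurableT i0) k1.
  by rewrite -/(conv (kern nu) _ x) -/(conv (kern nu) G x) -/a; ring.
by rewrite e subr_ge0 in h.
Qed.

Lemma measurable_conv_kern nu (h : R4 R -> R) : mu4.-integrable setT (EFin \o h) ->
  measurable_fun setT (conv (kern nu) h).
Proof.
move=> hi; have [C hC] := kern_bounded R nu.
have [C' hC'] := pd_kern_bounded R nu.
apply: sepcont_measurable => i y t.
have d := conv_der hi (measurable_kern nu) hC (smooth_has_grad (@smooth_kern R nu)) hC' i y t.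
exact: (der_continuous d).
Qed.

(** After Jensen, Tonelli exchanges the integrals and the kernel integrates to 1 in the other
    variable: mollification does not increase the L^2 norm. *)
Lemma integral_conv_kern_sqr nu (G : R4 R -> R) : measurable_fun setT G ->
  measurable_fun setT (conv (kern nu) G) ->
  mu4.-integrable setT (EFin \o (fun y => G y ^+ 2)) ->
  (\int[mu4]_x (conv (kern nu) G x ^+ 2)%:E <= \int[mu4]_x (G x ^+ 2)%:E)%E.
Proof.
move=> mG mcG iG; have [C hC] := kern_bounded R nu.
pose F (z : mT4 * mT4) := (G z.2 ^+ 2 * kern nu (z.1 - z.2))%:E.
have mF : measurable_fun setT F.
  apply/measurable_EFinP/measurable_funM.
    by apply: measurable_funX; exact: (measurableT_comp mG measurable_snd).
  exact: (measurableT_comp (measurable_kern nu) (measurable_sub4 (R := R))).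
have F0 z : (0 <= F z)%E by rewrite lee_fin mulr_ge0 ?sqr_ge0 ?kern_ge0.
apply: (@le_trans _ _ (\int[mu4]_x \int[mu4]_y F (x, y))%E).
  apply: ge0_le_integral => //.
  - by move=> x _; rewrite lee_fin sqr_ge0.
  - by apply/measurable_EFinP; exact: measurable_funX.
  - exact: (measurable_fun_fubini_tonelli_F (m2 := mu4) _ mF F0).
  - move=> x _.
    have := integrable_RintegralE (conv_integrable x iG (measurable_kern nu) hC).
    by rewrite /F /= => ->; rewrite lee_fin; exact: conv_kern_sqr_le.
rewrite -(tonelli1 _ _ mF F0) (tonelli2 _ _ mF F0).
apply: ge0_le_integral => //.
- by move=> y _; exact: integral_ge0.
- exact: (measurable_fun_fubini_tonelli_G (m1 := mu4) _ mF F0).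
- by apply/measurable_EFinP; exact: measurable_funX.
move=> y _; rewrite /F /=.
under eq_integral do rewrite EFinM.
rewrite ge0_integralZl//; [by rewrite integral_kernl mule1| | |].
- by apply/measurable_EFinP; exact: (measurable_subl y (measurable_kern nu)).
- by move=> x _; rewrite lee_fin kern_ge0.
- by rewrite lee_fin sqr_ge0.
Qed.

(** The mollified function has bounded continuous partial derivatives and compact support, so
    [sobolev_box] applies. Its gradient is the mollified weak gradient, whose L^2 norm is at most
    that of G. *)
Lemma sobolev_conv (h : R4 R -> R) (G : 'I_4 -> R4 R -> R) (L : R) nu : 0 <= L ->
  mu4.-integrable setT (EFin \o h) ->
  (forall i x, L < `|coord i x| -> h x = 0) ->
  (forall i, measurable_fun setT (G i)) ->
  (forall i, mu4.-integrable setT (EFin \o (fun y => G i y ^+ 2))) ->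
  (forall i phi (M : R), smooth phi -> (forall x j, M < `|coord j x| -> phi x = 0) ->
    \int[mu4]_x (h x * pd i phi x) = - \int[mu4]_x (G i x * phi x)) ->
  8 * Num.sqrt (bubble_mass R * \int[mu4]_x (conv (kern nu) h x ^+ 4)) <=
    \sum_(i < 4) \int[mu4]_x (G i x ^+ 2).
Proof.
move=> L0 hi h0 mG iG wk.
have [C hC] := kern_bounded R nu.
have [C' hC'] := pd_kern_bounded R nu.
have sk := @smooth_kern R nu.
have mk := @measurable_kern R nu.
have mpk i := smooth_measurable (smooth_pd i sk).
pose u := conv (kern nu) h.
pose du i := conv (pd i (kern nu)) h.
have duE i : du i = conv (kern nu) (G i).
  apply/funext => x; rewrite /du /conv.
  have hg := has_grad_pd (has_grad_subr x (smooth_has_grad sk)) i.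
  have := wk i (fun y => kern nu (x - y)) (\sum_(j < 4) `|coord j x| + 1) (smooth_subr x sk).
  rewrite hg => wk'; transitivity (- \int[mu4]_y (h y * - pd i (kern nu) (x - y))).
    rewrite -mulN1r -RintegralZl//; last first.
      have := conv_integrable x hi (measurable_funN (mpk i)) (C := C'); apply.
      by move=> z /=; rewrite normrN.
    by apply: eq_Rintegral => y _; rewrite mulrN mulN1r opprK.
  rewrite wk' ?opprK// => y j; rewrite (bigD1 j)//= => yj.
  apply: (kern_supp nu (i := j)); rewrite coordB.
  have := ler_normB (coord j x) (coord j x - coord j y); rewrite subKr.
  have : 0 <= \sum_(k < 4 | k != j) `|coord k x| by exact: sumr_ge0.
  by move: yj; lra.
have dcont i (y : (R * R) * R) : continuous (fun t => du i (ins i t y)).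
  have [C2 hC2] := pd2_kern_bounded R nu i.
  move=> t; exact: (der_continuous (conv_der hi (mpk i) (hC' i)
    (smooth_has_grad (smooth_pd i sk)) hC2 i y t)).
have mdu i : measurable_fun setT (du i).
  have [C2 hC2] := pd2_kern_bounded R nu i.
  apply: sepcont_measurable => j y t.
  exact: (der_continuous (conv_der hi (mpk i) (hC' i)
    (smooth_has_grad (smooth_pd i sk)) hC2 j y t)).
have mu_ : measurable_fun setT u by exact: measurable_conv_kern.
have u0 i x : L + 1 < `|coord i x| -> u x = 0.
  by apply: conv_supp => [y|z /ltW]; [exact: h0|exact: kern_supp].
have du0 k i x : L + 1 < `|coord i x| -> du k x = 0.
  by apply: conv_supp => [y|z]; [exact: h0|exact: pd_kern_supp].
pose B := \int[mu4]_y (C * `|h y|) + \int[mu4]_y (C' * `|h y|).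
have C0 : 0 <= C := le_trans (normr_ge0 _) (hC 0).
have C'0 : 0 <= C' := le_trans (normr_ge0 _) (hC' ord0 0).
have uB x : `|u x| <= B.
  rewrite (le_trans (conv_bound hi mk hC x))// lerDl.
  by apply: Rintegral_ge0 => y _; rewrite mulr_ge0.
have duB i x : `|du i x| <= B.
  rewrite (le_trans (conv_bound hi (mpk i) (hC' i) x))// lerDr.
  by apply: Rintegral_ge0 => y _; rewrite mulr_ge0.
(* The kernel widens the support by 1; the second unit turns the strict support condition into the
   non-strict one of [sobolev_box] and ensures a positive half-width. *)
have L2 : 0 < L + 2 by lra.
have dder i (y : (R * R) * R) (t : R) : is_derive t 1 (fun t => u (ins i t y)) (du i (ins i t y)).
  exact: (conv_der hi mk hC (smooth_has_grad sk) hC').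
have u0' i x : L + 2 <= `|coord i x| -> u x = 0.
  by move=> Lx; apply: (u0 i); lra.
have := sobolev_box mu_ mdu uB duB dder dcont u0' L2.
have idu i : mu4.-integrable setT (EFin \o (fun x => du i x ^+ 2)).
  apply: ge0_integrableR => [|x|]; [exact: (measurable_funX 2 (mdu i))|exact: sqr_ge0|].
  rewrite duE; apply: (le_lt_trans (integral_conv_kern_sqr (mG i) _ (iG i))).
    by rewrite -duE.
  by rewrite (integrable_RintegralE (iG i)) ltry.
have u40 x i : L + 2 < `|coord i x| -> u x ^+ 4 = 0.
  by move=> /ltW Lx; rewrite (u0' i x Lx) expr0n.
have du20 x i : L + 2 < `|coord i x| -> \sum_(k < 4) du k x ^+ 2 = 0.
  by move=> Lx; apply: big1 => k _; rewrite (du0 k i x) ?expr0n//; lra.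
have mdu2 : measurable_fun setT (fun x => \sum_(k < 4) du k x ^+ 2).
  by apply: measurable_sum => k; exact: (measurable_funX 2 (mdu k)).
rewrite (Rintegral_box_supp (measurable_funX 4 mu_) u40).
move=> hh; apply: (le_trans hh); rewrite [leLHS](Rintegral_box_supp mdu2 du20).
rewrite (Rintegral_sum _ idu).2.
apply: ler_sum => i _; rewrite -lee_fin.
rewrite -(integrable_RintegralE (idu i)) -(integrable_RintegralE (iG i)) duE.
apply: integral_conv_kern_sqr => //; first by rewrite -duE.
Qed.

End mollification.

(** * Fatou bounds; scaling and measurability of integrals *)

Section fatou_bounds.
Context d (T : measurableType d) (R : realType).
Variable m : {measure set T -> \bar R}.

Lemma limn_einf_le (u : nat -> \bar R) (C : \bar R) :
  (forall n, u n <= C)%E -> (limn_einf u <= C)%E.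
Proof.
move=> uC; rewrite limn_einf_lim; apply: lime_le; first exact: is_cvg_einfs.
by apply: nearW => n; apply: le_trans (uC n); apply: ereal_inf_lbound; exists n => /=.
Qed.

Lemma measurable_limn_einf (g : nat -> T -> \bar R) :
  (forall n, measurable_fun setT (g n)) ->
  measurable_fun setT (fun x => limn_einf (g ^~ x)).
Proof.
move=> mg; apply: measurableT_comp => //.
by apply: measurable_fun_limn_esup => n; apply: measurableT_comp.
Qed.

Lemma limn_einf_ge0 (u : nat -> \bar R) : (forall n, 0 <= u n)%E -> (0 <= limn_einf u)%E.
Proof.
move=> u0; rewrite limn_einf_lim; apply: lime_ge; first exact: is_cvg_einfs.
by apply: nearW => n; apply: le_ereal_inf_tmp => _ [k _ <-].
Qed.

Lemma le_integral_limn_einf (f : T -> \bar R) (g : nat -> T -> \bar R) :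
  measurable_fun setT f -> (forall x, 0 <= f x)%E ->
  (forall n, measurable_fun setT (g n)) -> (forall n x, 0 <= g n x)%E ->
  {ae m, forall x, f x <= limn_einf (g ^~ x)}%E ->
  (\int[m]_x f x <= limn_einf (fun n => \int[m]_x g n x))%E.
Proof.
move=> mf f0 mg g0 fg.
have h := fatou m measurableT mg (fun n x _ => g0 n x).
apply: le_trans h; apply: ae_ge0_le_integral => //.
- by move=> x _; apply: limn_einf_ge0 => n; exact: g0.
- exact: measurable_limn_einf.
- by apply: filterS fg => x + _.
Qed.

(** Integrability is not assumed: multiplication by a non-negative constant is compatible with the
    extended difference of the positive and negative parts, also when one or both are infinite. *)
Lemma ge0_integralZR (c : R) (f : T -> R) : 0 <= c -> measurable_fun setT f ->
  (\int[m]_x (c * f x)%:E = c%:E * \int[m]_x (f x)%:E)%E.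
Proof.
move=> c0 mf; have mF : measurable_fun setT (EFin \o f) by exact/measurable_EFinP.
transitivity (\int[m]_x (c%:E * (EFin \o f) x))%E; first by [].
rewrite integralE ge0_funeposM// ge0_funenegM//.
rewrite !ge0_integralZl//; first last.
- exact: measurable_funepos.
- exact: measurable_funeneg.
rewrite [in RHS]integralE; set A := integral _ _ _; set B := integral _ _ _.
have A0 : (0 <= A)%E by exact: integral_ge0.
have B0 : (0 <= B)%E by exact: integral_ge0.
move: c0; rewrite le_eqVlt => /orP[/eqP <-|c0]; first by rewrite !mul0e sube0.
have c1 : (0 < c%:E)%E by rewrite lte_fin.
case: A A0 => [a| |] // A0; case: B B0 => [b| |] // B0.
- by rewrite -muleBr.
- by rewrite [in LHS]gt0_muley//= gt0_muleNy.
- by rewrite [in LHS]gt0_muley//= gt0_muley.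
- by rewrite [in LHS]gt0_muley//= gt0_muleNy.
Qed.

Lemma RintegralZl_ge0 (c : R) (f : T -> R) : 0 <= c -> measurable_fun setT f ->
  \int[m]_x (c * f x) = c * \int[m]_x f x.
Proof.
move=> c0 mf; have e := ge0_integralZR c0 mf.
move: c0; rewrite le_eqVlt => /orP[/eqP c0|c0].
  by rewrite -c0 mul0r /Rintegral; under eq_integral do rewrite mul0r; rewrite integral0.
rewrite /Rintegral e; case: (\int[m]_x (f x)%:E)%E => [r| |] //=.
  by rewrite gt0_muley ?lte_fin// mulr0.
by rewrite gt0_muleNy ?lte_fin// mulr0.
Qed.

End fatou_bounds.

Section measurable_parameter.
Context d1 d2 (T1 : measurableType d1) (T2 : measurableType d2) (R : realType).
Variable m2 : {sigma_finite_measure set T2 -> \bar R}.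

Lemma measurable_Rintegral (f : T1 * T2 -> R) : measurable_fun setT f ->
  measurable_fun setT (fun x => \int[m2]_y f (x, y)).
Proof.
move=> mf; apply: (measurableT_comp (f := fine)) => //.
have mF : measurable_fun setT (EFin \o f) by exact/measurable_EFinP.
rewrite (_ : (fun x => _) = (fun x => \int[m2]_y (EFin \o f)^\+ (x, y) -
    \int[m2]_y (EFin \o f)^\- (x, y))%E).
  apply: emeasurable_funB.
  - exact: (measurable_fun_fubini_tonelli_F _ (measurable_funepos mF) (funepos_ge0 _)).
  - exact: (measurable_fun_fubini_tonelli_F _ (measurable_funeneg mF) (funeneg_ge0 _)).
apply/funext => x; rewrite integralE; congr (_ - _)%E.
  by apply: eq_integral => y _; rewrite !funeposE.
by apply: eq_integral => y _; rewrite !funenegE.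
Qed.

End measurable_parameter.

(** * Almost everywhere convergence of one-dimensional mollification *)

Section mollify1.
Variable R : realType.
Local Notation mT := (measurableTypeR R).
Local Notation mu := (@lebesgue_measure R).

Definition moll n (v : R -> R) (x : R) : R := \int[mu]_t (v t * eta n (x - t)).

Lemma measurable_etaB n (x : R) : measurable_fun setT (fun t : mT => eta n (x - t)).
Proof.
apply: (measurableT_comp (@measurable_eta R n)).
by apply: measurable_funB.
Qed.

Lemma measurable_eta2 n : measurable_fun setT (fun z : mT * mT => eta n (z.1 - z.2)).
Proof.
apply: (measurableT_comp (@measurable_eta R n)).
by apply: measurable_funB.
Qed.

Lemma measurable_moll n v : measurable_fun setT v -> measurable_fun setT (moll n v).
Proof.
move=> mv; apply: (@measurable_Rintegral _ _ mT mT R mu (fun z => v z.2 * eta n (z.1 - z.2))).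
apply: measurable_funM; last exact: measurable_eta2.
exact: (measurableT_comp mv measurable_snd).
Qed.

Lemma integral_etar n (x : R) : (\int[mu]_t (eta n (x - t))%:E = 1)%E.
Proof.
by rewrite -(integral_eta n x); apply: eq_integral => t _; rewrite -etaN opprB.
Qed.

Lemma eta_norm_le n (t : R) : `|eta n t| <= n.+1%:R / bump_mass R.
Proof. by rewrite (ger0_norm (eta_ge0 _ _)) eta_le. Qed.

Lemma moll_integrable n v x : mu.-integrable setT (EFin \o v) ->
  mu.-integrable setT (EFin \o (fun t => v t * eta n (x - t))).
Proof.
move=> iv; apply: (integrable_mulb iv (measurable_etaB n x)).
by move=> t; exact: eta_norm_le.
Qed.

Lemma eta_integrable n (x : R) : mu.-integrable setT (EFin \o (fun t => eta n (x - t))).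
Proof.
apply: ge0_integrableR.
- exact: measurable_etaB.
- by move=> t; exact: eta_ge0.
- by rewrite integral_etar ltry.
Qed.

(** The kernel is at most (n+1) / [bump_mass] and lives on a ball of length 2 / (n+1), so the error
    is at most 2 / [bump_mass] times the mean oscillation of v on that ball. Lebesgue
    differentiation makes this tend to 0 almost everywhere. *)
Lemma moll_davg n v x : mu.-integrable setT (EFin \o v) ->
  ((`|moll n v x - v x|)%:E <= (2 / bump_mass R)%:E * davg v x (n.+1%:R^-1))%E.
Proof.
move=> iv; have mv := integrable_measurable iv.
have i1 := moll_integrable n x iv; have i2 := integrableZR (v x) (eta_integrable n x).
have m0 := bump_mass_gt0 R.
have n0 : (0 : R) < n.+1%:R by rewrite ltr0n.
have r0 : (0 : R) < n.+1%:R^-1 by rewrite invr_gt0.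
have iD : mu.-integrable setT (EFin \o (fun t => (v t - v x) * eta n (x - t))).
  rewrite (_ : (fun t => _) = (fun t => v t * eta n (x - t) + - 1 * (v x * eta n (x - t)))).
    exact: (integrableDR i1 (integrableZR (-1) i2)).
  by apply/funext => t; ring.
have -> : moll n v x - v x = \int[mu]_t ((v t - v x) * eta n (x - t)).
  transitivity (\int[mu]_t (v t * eta n (x - t)) - \int[mu]_t (v x * eta n (x - t))).
    rewrite (RintegralZl _ measurableT (eta_integrable n x)).
    by rewrite [X in v x * X]/Rintegral integral_etar /= mulr1.
  rewrite -RintegralB//.
  by apply: eq_Rintegral => t _; rewrite mulrBl.
apply: (@le_trans _ _ (\int[mu]_t (`|(v t - v x) * eta n (x - t)|)%:E)%E).
  rewrite (integrable_RintegralE (integrable_normR iD)) lee_fin.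
  exact: le_normr_Rintegral.
have mb : measurable (ball x n.+1%:R^-1 : set mT) by exact: measurable_ball.
rewrite /davg /iavg lebesgue_measure_ball ?(ltW r0)//.
set J := (X in (_ * (_ * X))%E).
have -> : ((2 / bump_mass R)%:E * (((n.+1%:R^-1 *+ 2)%:E)^-1 * J) =
    (n.+1%:R / bump_mass R)%:E * J)%E.
  rewrite muleA; congr (_ * _)%E.
  rewrite inver ifF; last by rewrite mulrn_eq0/= invr_eq0 gt_eqF.
  rewrite -EFinM; congr EFin; rewrite -mulr_natr; field.
  by rewrite !gt_eqF.
have J0 : (forall t : R, 0 <= `|((center (v x) \o v) t)%:E|)%E by move=> t; exact: abse_ge0.
have mc : measurable_fun setT (fun t : mT => `|((center (v x) \o v) t)%:E|)%E.
  apply: measurableT_comp => //; apply/measurable_EFinP.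
  by apply: measurable_funB.
rewrite /J -ge0_integralZl//; first last.
- by rewrite lee_fin divr_ge0// ltW.
- by apply: measurable_funTS.
rewrite [leRHS]integral_mkcond; apply: ge0_le_integral => //.
- by apply/measurable_EFinP; exact: (integrable_measurable (integrable_normR iD)).
- apply/(measurable_restrictT _ _).1 => //; apply: measurable_funTS.
  by apply: measurable_funeM.
move=> t _; rewrite patchE; case: ifPn => [_|].
  rewrite /= -EFinM lee_fin normrM mulrC ler_wpM2r//.
  exact: eta_norm_le.
rewrite notin_setE /ball /= => /negP; rewrite -leNgt => tx.
by rewrite eta_supp ?mulr0 ?normr0.
Qed.

Lemma moll_cvg v : mu.-integrable setT (EFin \o v) ->
  {ae mu, forall x, moll n v x @[n --> \oo] --> v x}.
Proof.
move=> iv.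
have lv : locally_integrable setT v by exact: (open_integrable_locally openT iv).
move: (lebesgue_differentiation lv); apply: negligibleS => x /= + hx; apply.
have h : (((2 / bump_mass R)%:E * davg v x n.+1%:R^-1) @[n --> \oo] --> 0)%E.
  rewrite -(mule0 (2 / bump_mass R)%:E); apply: cvgeZl => //.
  apply: (cvg_comp (fun n : nat => n.+1%:R^-1 : R) (davg v x) _ hx).
  move=> P /= hP.
  have hh : \forall n \near \oo, (fun r : R => 0 < r -> P r) (harmonic n) := cvg_harmonic hP.
  by apply: filterS hh => n; apply; exact: harmonic_gt0.
have h0 : ((`|moll n v x - v x|)%:E @[n --> \oo] --> 0)%E.
  apply: squeeze_cvge h; [|exact: cvg_cst]; apply: nearW => n.
  by rewrite lee_fin normr_ge0 moll_davg.
by apply/subr_cvg0; apply: norm_cvg0; exact: (fine_cvg h0).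
Qed.

Lemma moll_fatou v : mu.-integrable setT (EFin \o v) ->
  (\int[mu]_x (v x ^+ 4)%:E <=
   limn_einf (fun n => \int[mu]_x (moll n v x ^+ 4)%:E))%E.
Proof.
move=> iv; have mv := integrable_measurable iv.
have e4 (r : R) : (0 <= (r ^+ 4)%:E)%E by rewrite lee_fin -[4%N]/(2 * 2)%N exprM sqr_ge0.
apply: le_integral_limn_einf => //.
- by apply/measurable_EFinP; exact: (measurable_funX 4 mv).
- move=> n; apply/measurable_EFinP.
  exact: (measurable_funX 4 (measurable_moll n mv)).
move: (moll_cvg iv); apply: negligibleS => x /= + hx; apply.
have h : ((moll n v x ^+ 4)%:E @[n --> \oo] --> (v x ^+ 4)%:E)%E.
  apply: cvg_EFin; first exact: nearW.
  exact: (cvg_comp _ (fun r : R => r ^+ 4) hx (der_continuous (derX 4 (der_id (v x))))).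
by rewrite (cvg_limn_einf_sup h).1.
Qed.

Lemma moll_norm_le n v : measurable_fun setT v ->
  (\int[mu]_x (`|moll n v x|)%:E <= \int[mu]_x (`|v x|)%:E)%E.
Proof.
move=> mv; pose F (z : mT * mT) := (`|v z.2| * eta n (z.1 - z.2))%:E.
have mF : measurable_fun setT F.
  apply/measurable_EFinP/measurable_funM; last exact: measurable_eta2.
  by apply: measurableT_comp => //; exact: (measurableT_comp mv measurable_snd).
have F0 z : (0 <= F z)%E by rewrite lee_fin mulr_ge0 ?eta_ge0.
apply: (@le_trans _ _ (\int[mu]_x \int[mu]_y F (x, y))%E).
  apply: ge0_le_integral => //.
  - by apply/measurable_EFinP; apply: measurableT_comp => //; exact: measurable_moll.
  - exact: (measurable_fun_fubini_tonelli_F (m2 := mu) _ mF F0).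
  - move=> x _; have mvx : measurable_fun setT (fun t : mT => v t * eta n (x - t)).
      exact: (measurable_funM mv (measurable_etaB n x)).
    have -> : (\int[mu]_y F (x, y) = \int[mu]_y `|(v y * eta n (x - y))%:E|)%E.
      by apply: eq_integral => y _; rewrite /F /= normrM (ger0_norm (eta_ge0 _ _)).
    apply: le_trans (le_abse_integral mu measurableT _); last exact/measurable_EFinP.
    (* When the extended integral is infinite the real-valued [moll] is 0 and the bound is
       trivial. *)
    rewrite /moll /Rintegral; case: (integral _ _ _) => [r| |] //=.
    - by rewrite normr0 leey.
    - by rewrite normr0 leey.
rewrite -(tonelli1 _ _ mF F0) (tonelli2 _ _ mF F0).
apply: ge0_le_integral => //.
- by move=> y _; exact: integral_ge0.
- exact: (measurable_fun_fubini_tonelli_G (m1 := mu) _ mF F0).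
- by apply/measurable_EFinP; apply: measurableT_comp.
move=> y _; rewrite /F /=.
under eq_integral do rewrite EFinM.
rewrite ge0_integralZl//; [by rewrite integral_eta mule1| |].
- by apply/measurable_EFinP; apply: (measurableT_comp (@measurable_eta R n)); exact: measurable_funB.
- by move=> x _; rewrite lee_fin eta_ge0.
Qed.

End mollify1.

(** * Mollification of functions on R^4 in a single coordinate *)

Section mollify4.
Variable R : realType.
Local Notation mT := (measurableTypeR R).
Local Notation mT4 := ((mT * mT) * (mT * mT))%type.
Local Notation mu := (@lebesgue_measure R).
Local Notation mu4 := (pow4 mu).
Implicit Types (h : R4 R -> R) (i : 'I_4).

Definition molli i n h (x : R4 R) : R := moll n (fun t => h (ins i t (del i x))) (coord i x).

Lemma molli_ins i n h t y : molli i n h (ins i t y) = moll n (fun t => h (ins i t y)) t.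
Proof. by rewrite /molli del_ins coord_ins. Qed.

Lemma measurable_del i :
  measurable_fun setT (fun x : mT4 => del i x : (mT * mT) * mT).
Proof.
have mc j := @measurable_coord R j.
case: i => -[|[|[|[|?]]]] // i4; rewrite /del /=.
- exact: (measurable_fun_pair (measurable_fun_pair (mc (@Ordinal 4 1 isT))
    (mc (@Ordinal 4 2 isT))) (mc (@Ordinal 4 3 isT))).
- exact: (measurable_fun_pair (measurable_fun_pair (mc (@Ordinal 4 0 isT))
    (mc (@Ordinal 4 2 isT))) (mc (@Ordinal 4 3 isT))).
- exact: (measurable_fun_pair (measurable_fun_pair (mc (@Ordinal 4 0 isT))
    (mc (@Ordinal 4 1 isT))) (mc (@Ordinal 4 3 isT))).
- exact: (measurable_fun_pair (measurable_fun_pair (mc (@Ordinal 4 0 isT))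
    (mc (@Ordinal 4 1 isT))) (mc (@Ordinal 4 2 isT))).
Qed.

Lemma measurable_line i h y : measurable_fun setT h ->
  measurable_fun setT (fun t : mT => h (ins i t y)).
Proof.
move=> mh; have m1 := measurableT_comp mh (measurable_ins (R := R) i).
by apply: (measurableT_comp m1 (g := fun t : mT => (y, t))); exact: measurable_fun_pair.
Qed.

Lemma measurable_molli i n h : measurable_fun setT h -> measurable_fun setT (molli i n h).
Proof.
move=> mh; apply: (@measurable_Rintegral _ _ mT4 mT R mu
  (fun z => h (ins i z.2 (del i z.1)) * eta n (coord i z.1 - z.2))).
apply: measurable_funM.
  have m1 := measurableT_comp mh (measurable_ins (R := R) i).
  apply: (measurableT_comp m1 (g := fun z : mT4 * mT => (del i z.1, z.2))).
  apply: measurable_fun_pair => //.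
  exact: (measurableT_comp (measurable_del i) measurable_fst).
apply: (measurableT_comp (@measurable_eta R n)); apply: measurable_funB => //.
exact: (measurableT_comp (@measurable_coord R i) measurable_fst).
Qed.

Lemma molli_integrable i n h : mu4.-integrable setT (EFin \o h) ->
  mu4.-integrable setT (EFin \o molli i n h).
Proof.
move=> /integrableP[/measurable_EFinP mh ih]; have mM := measurable_molli i n mh.
apply/integrableP; split; first exact/measurable_EFinP.
apply: le_lt_trans ih.
have mh1 : measurable_fun setT (fun x : mT4 => `|(h x)%:E|)%E.
  by apply: measurableT_comp => //; exact/measurable_EFinP.
have mM1 : measurable_fun setT (fun x : mT4 => `|(molli i n h x)%:E|)%E.
  by apply: measurableT_comp => //; exact/measurable_EFinP.
rewrite (tonelli_ins mu i mM1 (fun x => abse_ge0 _)).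
rewrite (tonelli_ins mu i mh1 (fun x => abse_ge0 _)).
have mi (f : mT4 -> R) : measurable_fun setT f ->
    measurable_fun setT (fun z : (mT * mT) * mT * mT => (`|f (ins i z.2 z.1)|)%:E).
  move=> mf; apply/measurable_EFinP; apply: measurableT_comp => //.
  exact: (measurableT_comp mf (measurable_ins (R := R) i)).
have fe0 (f : mT4 -> R) (z : (mT * mT) * mT * mT) : (0 <= (`|f (ins i z.2 z.1)|)%:E)%E.
  by rewrite lee_fin.
apply: ge0_le_integral => //.
- by move=> y _; apply: integral_ge0.
- exact: (measurable_fun_fubini_tonelli_F (m2 := mu) _ (mi _ mM) (fe0 _)).
- exact: (measurable_fun_fubini_tonelli_F (m2 := mu) _ (mi _ mh) (fe0 _)).
move=> y _.
have -> : (\int[mu]_t `|(molli i n h (ins i t y))%:E| =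
  \int[mu]_t (`|moll n (fun t => h (ins i t y)) t|)%:E)%E.
  by apply: eq_integral => t _; rewrite molli_ins.
exact: (moll_norm_le n (measurable_line i y mh)).
Qed.

(** On almost every line in direction i the restriction of h is integrable, so the one-dimensional
    Fatou bound applies there; a second use of Fatou integrates it over the transverse variables. *)
Lemma molli_fatou i h (C : \bar R) : mu4.-integrable setT (EFin \o h) ->
  (forall n, \int[mu4]_x (molli i n h x ^+ 4)%:E <= C)%E ->
  (\int[mu4]_x (h x ^+ 4)%:E <= C)%E.
Proof.
move=> ih hC; have mh := integrable_measurable ih.
have e4 (r : R) : (0 <= (r ^+ 4)%:E)%E by rewrite lee_fin -[4%N]/(2 * 2)%N exprM sqr_ge0.
have m4 (f : mT4 -> R) : measurable_fun setT f ->
    measurable_fun setT (fun x : mT4 => (f x ^+ 4)%:E).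
  by move=> mf; apply/measurable_EFinP; exact: (measurable_funX 4 mf).
have mi (f : mT4 -> R) (mf : measurable_fun setT f) :=
  measurableT_comp (m4 f mf) (measurable_ins (R := R) i).
rewrite (tonelli_ins mu i (m4 _ mh) (fun x => e4 _)).
have hm n := mi _ (measurable_molli i n mh).
have [ae _ _] := fubini_ins i ih.
apply: (@le_trans _ _ (limn_einf
    (fun n => \int[pow3 mu]_y \int[mu]_t (molli i n h (ins i t y) ^+ 4)%:E))%E).
  apply: le_integral_limn_einf.
  - exact: (measurable_fun_fubini_tonelli_F (m2 := mu) _ (mi _ mh) (fun x => e4 _)).
  - by move=> y; apply: integral_ge0.
  - by move=> n; exact: (measurable_fun_fubini_tonelli_F (m2 := mu) _ (hm n) (fun x => e4 _)).
  - by move=> n y; apply: integral_ge0.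
  move: ae; apply: negligibleS => y /= + iy; apply.
  have e : (fun n => \int[mu]_t (molli i n h (ins i t y) ^+ 4)%:E)%E =
      (fun n => \int[mu]_t (moll n (fun t => h (ins i t y)) t ^+ 4)%:E)%E.
    by apply/funext => n; apply: eq_integral => t _; rewrite molli_ins.
  by rewrite [X in limn_einf X]e; exact: (moll_fatou iy).
apply: limn_einf_le => n; rewrite -(tonelli_ins mu i (m4 _ (measurable_molli i n mh)) (fun x => e4 _)).
exact: hC.
Qed.

End mollify4.

(** * Removing the mollification one coordinate at a time *)

Section iterated_mollification.
Variable R : realType.
Local Notation mT := (measurableTypeR R).
Local Notation mT4 := ((mT * mT) * (mT * mT))%type.
Local Notation mu := (@lebesgue_measure R).
Local Notation mu4 := (pow4 mu).
Local Notation o0 := (@Ordinal 4 0 isT).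
Local Notation o1 := (@Ordinal 4 1 isT).
Local Notation o2 := (@Ordinal 4 2 isT).
Local Notation o3 := (@Ordinal 4 3 isT).

(** The kernel is a product, so after Fubini each factor leaves the inner integrals. They need not
    converge for every value of the outer variables, hence the scaling rule [RintegralZl_ge0], which
    needs no integrability. *)
Lemma conv_molli (nu : 'I_4 -> nat) (h : R4 R -> R) x : mu4.-integrable setT (EFin \o h) ->
  conv (kern nu) h x =
  molli o0 (nu o0) (molli o1 (nu o1) (molli o2 (nu o2) (molli o3 (nu o3) h))) x.
Proof.
move=> hi; have mh := integrable_measurable hi.
have [C hC] := kern_bounded R nu.
have iF := conv_integrable x hi (measurable_kern nu) hC.
have [_ i3 e3] := fubini_ins o3 iF.
have [_ i2 e2] := fubiniR1 (m1 := pow2 mu) (m2 := mu) i3.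
have [_ i1 e1] := fubiniR1 (m1 := mu) (m2 := mu) i2.
rewrite /conv e3 e2 e1 {i1 i2 i3 e1 e2 e3 iF hC C}.
case: x => [[x1 x2] [x3 x4]].
pose k0 (t : R) := eta (nu o0) (x1 - t); pose k1 (t : R) := eta (nu o1) (x2 - t).
pose k2 (t : R) := eta (nu o2) (x3 - t); pose k3 (t : R) := eta (nu o3) (x4 - t).
have k00 t : 0 <= k0 t := eta_ge0 _ _; have k10 t : 0 <= k1 t := eta_ge0 _ _.
have k20 t : 0 <= k2 t := eta_ge0 _ _.
have kE a b s t : kern nu (((x1, x2), (x3, x4)) - ((a, b), (s, t)) : R4 R) =
    k0 a * k1 b * k2 s * k3 t by rewrite /kern prodI4.
pose h3 := molli o3 (nu o3) h; pose h2 := molli o2 (nu o2) h3.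
pose h1 := molli o1 (nu o1) h2.
have mh3 : measurable_fun setT h3 by exact: measurable_molli.
have mh2 : measurable_fun setT h2 by exact: measurable_molli.
have mh1 : measurable_fun setT h1 by exact: measurable_molli.
have me n (r : R) := @measurable_etaB R n r.
have s3 (a b s : R) : \int[mu]_t (h ((a, b), (s, t)) * kern nu (((x1, x2), (x3, x4)) - ((a, b), (s, t)) : R4 R)) =
    k0 a * k1 b * k2 s * h3 ((a, b), (s, x4)).
  have mm : measurable_fun setT (fun t : mT => h ((a, b), (s, t)) * k3 t).
    exact: (measurable_funM (measurable_line o3 ((a, b), s) mh) (me (nu o3) x4)).
  rewrite -(RintegralZl_ge0 mu _ mm); last exact: (mulr_ge0 (mulr_ge0 (k00 a) (k10 b)) (k20 s)).
  by apply: eq_Rintegral => t _; rewrite kE; ring.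
have s2 (a b : R) : \int[mu]_s (k0 a * k1 b * k2 s * h3 ((a, b), (s, x4))) =
    k0 a * k1 b * h2 ((a, b), (x3, x4)).
  have mm : measurable_fun setT (fun s : mT => h3 ((a, b), (s, x4)) * k2 s).
    exact: (measurable_funM (measurable_line o2 ((a, b), x4) mh3) (me (nu o2) x3)).
  rewrite -(RintegralZl_ge0 mu _ mm); last exact: (mulr_ge0 (k00 a) (k10 b)).
  by apply: eq_Rintegral => s _; ring.
have s1 (a : R) : \int[mu]_b (k0 a * k1 b * h2 ((a, b), (x3, x4))) =
    k0 a * h1 ((a, x2), (x3, x4)).
  have mm : measurable_fun setT (fun b : mT => h2 ((a, b), (x3, x4)) * k1 b).
    exact: (measurable_funM (measurable_line o1 ((a, x3), x4) mh2) (me (nu o1) x2)).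
  rewrite -(RintegralZl_ge0 mu _ mm); last exact: k00.
  by apply: eq_Rintegral => b _; ring.
apply: eq_Rintegral => a _; transitivity (k0 a * h1 ((a, x2), (x3, x4))); last exact: mulrC.
rewrite -s1; apply: eq_Rintegral => b _.
rewrite -s2; apply: eq_Rintegral => s _.
by rewrite -s3.
Qed.

(** Four uses of [molli_fatou], one per coordinate, in place of a Lebesgue differentiation theorem
    on R^4. *)
Lemma conv_fatou (h : R4 R -> R) (C : \bar R) : mu4.-integrable setT (EFin \o h) ->
  (forall nu, \int[mu4]_x (conv (kern nu) h x ^+ 4)%:E <= C)%E ->
  (\int[mu4]_x (h x ^+ 4)%:E <= C)%E.
Proof.
move=> ih hC.
apply: (molli_fatou (i := o3)) => // n3; have i3 := molli_integrable o3 n3 ih.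
apply: (molli_fatou (i := o2)) => // n2; have i2 := molli_integrable o2 n2 i3.
apply: (molli_fatou (i := o1)) => // n1; have i1 := molli_integrable o1 n1 i2.
apply: (molli_fatou (i := o0)) => // n0.
pose nu (i : 'I_4) := nth 0%N [:: n0; n1; n2; n3] i.
apply: le_trans (hC nu); rewrite le_eqVlt; apply/orP; left; apply/eqP.
by apply: eq_integral => x _; rewrite conv_molli.
Qed.

Lemma bounded_supp_integrable (f : R4 R -> R) (B L : R) : 0 < L ->
  measurable_fun setT f -> (forall x, `|f x| <= B) ->
  (forall x i, L < `|coord i x| -> f x = 0) -> mu4.-integrable setT (EFin \o f).
Proof.
move=> L0 mf fB f0; apply/integrableP; split; first exact/measurable_EFinP.
have mf' : measurable_fun setT (fun x : mT4 => `|(EFin \o f) x|)%E.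
  by apply: measurableT_comp => //; exact/measurable_EFinP.
rewrite -(integral_box_supp (L := L) mf'); last first.
  by move=> x i /f0 /= ->; rewrite normr0.
have bf : bmeas f by split => //; exists B.
by have /integrableP[] := bmeas_integrable (pow4_muL_fin L0) bf.
Qed.

Lemma sqrt_bound (m a E : R) : 0 < m -> 0 <= a -> 8 * Num.sqrt (m * a) <= E ->
  a <= (E / 8) ^+ 2 / m.
Proof.
move=> m0 a0 h; rewrite ler_pdivlMr// mulrC.
have ma : 0 <= m * a by rewrite mulr_ge0// ltW.
have h' : Num.sqrt (m * a) <= E / 8 by rewrite ler_pdivlMr// mulrC.
rewrite -(sqr_sqrtr ma) ler_pXn2r ?nnegrE// ?sqrtr_ge0//.
exact: le_trans (sqrtr_ge0 _) h'.
Qed.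

Lemma sobolev_supp (h : R4 R -> R) (G : 'I_4 -> R4 R -> R) (L : R) : 0 <= L ->
  mu4.-integrable setT (EFin \o h) ->
  (forall i x, L < `|coord i x| -> h x = 0) ->
  (forall i, measurable_fun setT (G i)) ->
  (forall i, mu4.-integrable setT (EFin \o (fun y => G i y ^+ 2))) ->
  (forall i phi (M : R), smooth phi -> (forall x j, M < `|coord j x| -> phi x = 0) ->
    \int[mu4]_x (h x * pd i phi x) = - \int[mu4]_x (G i x * phi x)) ->
  (\int[mu4]_x (h x ^+ 4)%:E <=
    (((\sum_(i < 4) \int[mu4]_x (G i x ^+ 2)) / 8) ^+ 2 / bubble_mass R)%:E)%E.
Proof.
move=> L0 hi h0 mG iG wk; apply: conv_fatou => // nu.
have H := sobolev_conv nu L0 hi h0 mG iG wk.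
have m0 := bubble_mass_gt0 R.
have c4 (r : R) : 0 <= r ^+ 4 by rewrite -[4%N]/(2 * 2)%N exprM sqr_ge0.
have mc := measurable_conv_kern nu hi.
have i4 : mu4.-integrable setT (EFin \o (fun x => conv (kern nu) h x ^+ 4)).
  have [C hC] := kern_bounded R nu.
  have cb := conv_bound hi (measurable_kern nu) hC.
  apply: (bounded_supp_integrable (L := L + 1) (B := (\int[mu4]_y (C * `|h y|)) ^+ 4)).
  - by rewrite ltr_wpDl.
  - exact: (measurable_funX 4 mc).
  - by move=> x; rewrite normrX ler_pXn2r ?nnegrE// (le_trans _ (cb x)).
  - move=> x i Lx; rewrite (conv_supp (L := L) (i := i)) ?expr0n//; first exact: h0.
    by move=> z /ltW; exact: kern_supp.
rewrite (integrable_RintegralE i4) lee_fin; apply: sqrt_bound => //.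
exact: Rintegral_ge0.
Qed.

End iterated_mollification.

(** * Cutoff functions and bounds on their gradients *)

Section cutoff.
Variable R : realType.
Local Notation mT := (measurableTypeR R).
Local Notation mT4 := ((mT * mT) * (mT * mT))%type.
Local Notation mu := (@lebesgue_measure R).
Local Notation mu4 := (pow4 mu).
Implicit Types (x : R4 R) (i : 'I_4).

Lemma bump0_gt0 : 0 < bump (0 : R).
Proof. by rewrite /bump /flat expr0n subr0 ltr01 expr0 invr1 mul1r expR_gt0. Qed.

Lemma bump_le0 (t : R) : bump t <= bump 0.
Proof.
rewrite /bump expr0n subr0.
have [t1|t1] := lerP (1 - t ^+ 2) 0; first by rewrite flat_le0// flat_ge0.
rewrite /flat t1 ltr01 !expr0 !invr1 !mul1r ler_expR lerN2 invf_ge1//.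
by rewrite lerBlDr lerDl sqr_ge0.
Qed.

Definition dbump (t : R) : R := flat 2 (1 - t ^+ 2) * - (2 * t).

Lemma der_bump (t : R) : is_derive t 1 (@bump R) (dbump t).
Proof.
have h := derB (der_cst 1 t) (derX 2 (der_id t)).
apply: is_derive_eq (der_comp (f := fun t => 1 - t ^+ 2) (der_flat 0 _) h) _.
by rewrite /dbump mul0r subr0 sub0r expr1 mulr1 mulr_natl.
Qed.

Lemma dbump_le (t : R) : `|dbump t| <= 48 * `|t|.
Proof.
rewrite /dbump normrM normrN normrM (ger0_norm (flat_ge0 _ _)) mulrA ler_wpM2r//.
rewrite ger0_norm// (_ : 48 = 24 * 2); last by ring.
rewrite ler_wpM2r//; have [t1|t1] := lerP (1 - t ^+ 2) 0; first by rewrite flat_le0.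
apply: (le_trans (flat_bound _ _)); rewrite (_ : 4`!%:R = 24 :> R)//.
have h : (1 - t ^+ 2) ^+ 2 <= 1.
  by rewrite exprn_ile1 ?(ltW t1)// lerBlDr lerDl sqr_ge0.
by lra.
Qed.

Lemma dbump_supp (t : R) : 1 <= `|t| -> dbump t = 0.
Proof.
move=> t1; rewrite /dbump flat_le0 ?mul0r// subr_le0.
by rewrite -[t ^+ 2]ger0_norm ?sqr_ge0// normrX exprn_ege1.
Qed.

(** Dividing by [bump 0] normalises the cutoff to 1 at the origin, so that it tends to 1 pointwise
    while staying in [0, 1]. *)
Definition cut n x : R := \prod_(j < 4) (bump (n.+1%:R^-1 * coord j x) / bump 0).

Lemma cut1_ge0 n (t : R) : 0 <= bump (n.+1%:R^-1 * t) / bump 0.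
Proof. by rewrite divr_ge0 ?bump_ge0// ltW// bump0_gt0. Qed.

Lemma cut1_le1 n (t : R) : bump (n.+1%:R^-1 * t) / bump 0 <= 1.
Proof. by rewrite ler_pdivrMr ?bump0_gt0// mul1r bump_le0. Qed.

Lemma cut_ge0 n x : 0 <= cut n x.
Proof. by apply: prodr_ge0 => j _; exact: cut1_ge0. Qed.

Lemma cut_le1 n x : cut n x <= 1.
Proof. by apply: prodr_ile1 => j _; rewrite cut1_ge0 cut1_le1. Qed.

Lemma scale_ge n (t : R) : n.+1%:R <= `|t| -> 1 <= `|n.+1%:R^-1 * t|.
Proof.
move=> nt; have n0 : (0 : R) < n.+1%:R by rewrite ltr0n.
by rewrite normrM normfV (gtr0_norm n0) ler_pdivlMl// mulr1.
Qed.

Lemma cut_supp n x i : n.+1%:R <= `|coord i x| -> cut n x = 0.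
Proof. by move=> nx; rewrite /cut (bigD1 i)//= (bump_supp (scale_ge nx)) !mul0r. Qed.

Lemma smooth_cut n : smooth (cut n).
Proof.
apply: smooth_prod => j; apply: smoothM; last exact: smooth_cst.
apply: smooth_flat; apply: smoothD; first exact: smooth_cst.
apply: smooth_opp; under eq_fun do rewrite expr2.
have s1 : smooth (fun x : R4 R => n.+1%:R^-1 * coord j x).
  by apply: smoothM; [exact: smooth_cst|exact: smooth_coord].
exact: smoothM.
Qed.

Lemma pd_cut n i x : pd i (cut n) x =
  dbump (n.+1%:R^-1 * coord i x) * n.+1%:R^-1 / bump 0 *
  \prod_(j < 4 | j != i) (bump (n.+1%:R^-1 * coord j x) / bump 0).
Proof.
set P := \prod_(j < 4 | _) _.
have h : is_derive (0 : R) 1 (fun t => cut n (shift i t x))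
    (dbump (n.+1%:R^-1 * coord i x) * n.+1%:R^-1 / bump 0 * P).
  have h1 : is_derive (0 : R) 1 (fun t : R => n.+1%:R^-1 * (coord i x + t)) n.+1%:R^-1.
    have := derMl n.+1%:R^-1 (derD (der_cst (coord i x) 0) (der_id 0)).
    by rewrite add0r mulr1.
  have := derMr P (derMr (bump 0)^-1
    (der_comp (f := fun t : R => n.+1%:R^-1 * (coord i x + t)) (der_bump _) h1)).
  rewrite addr0; congr is_derive; apply/funext => t.
  rewrite /cut (bigD1 i)//= coord_shift eqxx mul1r; congr (_ * _).
  by apply: eq_bigr => j ji; rewrite coord_shift eq_sym (negPf ji) mul0r addr0.
by rewrite /pd (der_derive1 h).2.
Qed.

(** 48 = 2 * 4!: the factor 4! comes from [flat_bound] for [flat 2], the factor 2 from the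
    derivative of t^2. *)
Definition cutC : R := 48 / bump 0.

Lemma cutC_ge0 : 0 <= cutC. Proof. by rewrite divr_ge0// ltW// bump0_gt0. Qed.

(** The derivative of [bump] vanishes linearly at 0, which gains the factor |x_i| / (n+1) over the
    usual bound of order 1 / (n+1). This factor tends to 0 pointwise and later permits dominated
    convergence. *)
Lemma pd_cut_le n i x : `|pd i (cut n) x| <= cutC * `|coord i x| / n.+1%:R ^+ 2.
Proof.
rewrite pd_cut; set P := \prod_(j < 4 | _) _.
have P0 : 0 <= P by apply: prodr_ge0 => j _; exact: cut1_ge0.
have P1 : P <= 1 by apply: prodr_ile1 => j _; rewrite cut1_ge0 cut1_le1.
have n0 : (0 : R) < n.+1%:R by rewrite ltr0n.
have b0 := bump0_gt0.
have : `|dbump (n.+1%:R^-1 * coord i x)| <= 48 * (`|coord i x| / n.+1%:R).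
  by rewrite (le_trans (dbump_le _))// normrM normfV (gtr0_norm n0) [_^-1 * _]mulrC.
move: (dbump _) => a ha.
rewrite !normrM (ger0_norm P0) !normfV (gtr0_norm b0) (gtr0_norm n0).
apply: (@le_trans _ _ (`|a| / n.+1%:R / bump 0)).
  by rewrite ler_piMr// divr_ge0 ?divr_ge0// ltW.
rewrite /cutC (_ : 48 / bump 0 * _ / _ = 48 * (`|coord i x| / n.+1%:R) / n.+1%:R / bump 0).
  by rewrite ler_wpM2r ?invr_ge0 ?(ltW b0)// ler_wpM2r ?invr_ge0 ?(ltW n0).
by field; rewrite !gt_eqF.
Qed.

Lemma pd_cut_supp n i j x : n.+1%:R <= `|coord j x| -> pd i (cut n) x = 0.
Proof.
move=> nx; rewrite pd_cut; have [ji|ji] := eqVneq j i.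
  by rewrite -ji dbump_supp ?scale_ge// !mul0r.
by rewrite (bigD1 j)//= (bump_supp (scale_ge nx)) !mul0r mulr0.
Qed.

Lemma pd_cut_bound n i x : `|pd i (cut n) x| <= cutC.
Proof.
have [nx|nx] := lerP n.+1%:R `|coord i x|.
  by rewrite (pd_cut_supp i nx) normr0 cutC_ge0.
have n0 : (0 : R) < n.+1%:R by rewrite ltr0n.
rewrite (le_trans (pd_cut_le n i x))// -mulrA ler_piMr ?cutC_ge0//.
rewrite ler_pdivrMr ?exprn_gt0// mul1r (le_trans (ltW nx))//.
by rewrite expr2 ler_peMr// ?(ltW n0)// ler1n.
Qed.

Lemma cut_cvg x : cut n x @[n --> \oo] --> (1 : R).
Proof.
have h j : (bump (n.+1%:R^-1 * coord j x) / bump 0) @[n --> \oo] --> (1 : R).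
  have b0 : bump (0 : R) != 0 by rewrite gt_eqF// bump0_gt0.
  rewrite -[X in _ --> X](mulfV b0); apply: cvgM; last exact: cvg_cst.
  have hz : (n.+1%:R^-1 * coord j x) @[n --> \oo] --> (0 : R).
    rewrite -[X in _ --> X](mul0r (coord j x)); apply: cvgM; last exact: cvg_cst.
    exact: cvg_harmonic.
  exact: (cvg_comp _ _ hz (@bump_cont R 0)).
have -> : (fun n => cut n x) = (fun n =>
   (bump (n.+1%:R^-1 * coord (@Ordinal 4 0 isT) x) / bump 0) *
   (bump (n.+1%:R^-1 * coord (@Ordinal 4 1 isT) x) / bump 0) *
   (bump (n.+1%:R^-1 * coord (@Ordinal 4 2 isT) x) / bump 0) *
   (bump (n.+1%:R^-1 * coord (@Ordinal 4 3 isT) x) / bump 0)).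
  by apply/funext => n; rewrite /cut prodI4.
have e : 1 = 1 * 1 * 1 * 1 :> R by rewrite !mulr1.
rewrite [X in _ --> X]e.
exact: (cvgM (cvgM (cvgM (h _) (h _)) (h _)) (h _)).
Qed.

End cutoff.

(** * Cutting off a function of the homogeneous Sobolev space *)

Section sobolev_inequality.
Variable R : realType.
Local Notation mT := (measurableTypeR R).
Local Notation mT4 := ((mT * mT) * (mT * mT))%type.
Local Notation mu := (@lebesgue_measure R).
Local Notation mu4 := (pow4 mu).
Implicit Types (x : R4 R) (i : 'I_4).

Lemma sqr_sqrE (r : R) : r ^+ 4 = (r ^+ 2) ^+ 2.
Proof. by rewrite -exprM. Qed.

Lemma expr4_ge0 (r : R) : 0 <= r ^+ 4.
Proof. by rewrite sqr_sqrE sqr_ge0. Qed.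

Lemma Hdot1_measurable (u : R4 R -> R) g : Hdot1 u g -> measurable_fun setT u.
Proof. by case. Qed.

Lemma Hdot1_measurable_grad (u : R4 R -> R) g : Hdot1 u g -> forall i, measurable_fun setT (g i).
Proof. by case=> _ [_ h] i; case: (h i). Qed.

Lemma Hdot1_integrable (u : R4 R -> R) g : Hdot1 u g ->
  mu4.-integrable setT (EFin \o (fun x => u x ^+ 4)).
Proof.
case=> mu_ [iu _]; apply: ge0_integrableR.
- exact: (measurable_funX 4 mu_).
- by move=> x; exact: expr4_ge0.
- apply: le_lt_trans iu; rewrite le_eqVlt; apply/orP; left; apply/eqP.
  apply: eq_integral => x _; rewrite -normrX ger0_norm//.
  exact: expr4_ge0.
Qed.

Lemma Hdot1_integrable_grad (u : R4 R -> R) g : Hdot1 u g ->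
  forall i, mu4.-integrable setT (EFin \o (fun x => g i x ^+ 2)).
Proof.
case=> _ [_ h] i; case: (h i) => mg [ig _]; apply: ge0_integrableR.
- exact: (measurable_funX 2 mg).
- by move=> x; exact: sqr_ge0.
- exact: ig.
Qed.

Lemma Hdot1_weak (u : R4 R -> R) g : Hdot1 u g -> forall i phi (M : R), smooth phi ->
  (forall x j, M < `|coord j x| -> phi x = 0) ->
  \int[mu4]_x (u x * pd i phi x) = - \int[mu4]_x (g i x * phi x).
Proof.
case=> _ [_ h] i phi M sphi phi0; case: (h i) => _ [_ /(_ _ (smooth_test_fun sphi phi0))].
by move=> e; rewrite /Rintegral -fineN; congr fine; exact: e.
Qed.

Lemma norm_le1X (q : R) k : `|q| <= 1 + `|q| ^+ k.+1.
Proof.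
have [q1|q1] := lerP `|q| 1; first by rewrite (le_trans q1)// lerDl exprn_ge0.
apply: (@le_trans _ _ (`|q| ^+ k.+1)); last by rewrite lerDr.
exact: (ler_eXnr (ltn0Sn k) (ltW q1)).
Qed.

Lemma norm_le1X2 (q : R) : `|q| <= 1 + q ^+ 2.
Proof. by have := norm_le1X q 1; rewrite -normrX (ger0_norm (sqr_ge0 q)). Qed.

Lemma norm_le1X4 (q : R) : `|q| <= 1 + q ^+ 4.
Proof. by have := norm_le1X q 3; rewrite -normrX (ger0_norm (expr4_ge0 q)). Qed.

Lemma mul_supp_integrable (f q psi : R4 R -> R) (L : R) : 0 < L ->
  measurable_fun setT f -> (forall x, `|f x| <= 1 + q x) ->
  mu4.-integrable setT (EFin \o q) -> smooth psi ->
  (forall x i, L < `|coord i x| -> psi x = 0) ->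
  mu4.-integrable setT (EFin \o (fun x => f x * psi x)).
Proof.
move=> L0 mf fq iq spsi psi0; have mpsi := smooth_measurable spsi.
have [B hB] := continuous_supp_bounded (smooth_continuous spsi) psi0.
have i1 := integrable_normR (bounded_supp_integrable L0 mpsi hB psi0).
have i2 : mu4.-integrable setT (EFin \o (fun x => q x * `|psi x|)).
  apply: (integrable_mulb (C := B) iq); first by apply: measurableT_comp.
  by move=> x; rewrite normr_id.
apply: (le_integrableR _ _ (integrableDR i1 i2)).
  exact: (measurable_funM mf mpsi).
by move=> x; rewrite normrM (le_trans (ler_wpM2r _ (fq x)))// mulrDl mul1r.
Qed.

(** The Leibniz rule for weak gradients, obtained from the weak formulation with test function cut *
    phi. *)
Lemma cut_weak (u : R4 R -> R) g : Hdot1 u g -> forall n i phi (M : R), smooth phi ->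
  (forall x j, M < `|coord j x| -> phi x = 0) ->
  \int[mu4]_x (cut n x * u x * pd i phi x) =
  - \int[mu4]_x ((cut n x * g i x + pd i (cut n) x * u x) * phi x).
Proof.
move=> H n i phi M sphi phi0.
have sc := smooth_cut R n; have mu_ := Hdot1_measurable H.
have n0 : (0 : R) < n.+1%:R by rewrite ltr0n.
have c0 x j : n.+1%:R < `|coord j x| -> cut n x = 0 by move=> /ltW; exact: cut_supp.
have dc0 x j : n.+1%:R < `|coord j x| -> pd i (cut n) x = 0 by move=> /ltW; exact: pd_cut_supp.
have cp0 (f : R4 R -> R) x j : n.+1%:R < `|coord j x| -> cut n x * f x = 0.
  by move=> /c0 ->; rewrite mul0r.
have dcp0 (f : R4 R -> R) x j : n.+1%:R < `|coord j x| -> pd i (cut n) x * f x = 0.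
  by move=> /dc0 ->; rewrite mul0r.
have i1 := mul_supp_integrable n0 mu_ (fun x => norm_le1X4 (u x)) (Hdot1_integrable H)
  (smoothM (smooth_pd i sc) sphi) (dcp0 phi).
have i2 := mul_supp_integrable n0 mu_ (fun x => norm_le1X4 (u x)) (Hdot1_integrable H)
  (smoothM sc (smooth_pd i sphi)) (cp0 (pd i phi)).
have i3 := mul_supp_integrable n0 (Hdot1_measurable_grad H i) (fun x => norm_le1X2 (g i x))
  (Hdot1_integrable_grad H i) (smoothM sc sphi) (cp0 phi).
have := Hdot1_weak H i (smoothM sc sphi) (cp0 phi).
rewrite (has_grad_pd (has_gradM (smooth_has_grad sc) (smooth_has_grad sphi)) i).
have -> : \int[mu4]_x (u x * (pd i (cut n) x * phi x + cut n x * pd i phi x)) =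
    \int[mu4]_x (u x * (pd i (cut n) x * phi x)) + \int[mu4]_x (u x * (cut n x * pd i phi x)).
  rewrite -(RintegralD measurableT i1 i2).
  by apply: eq_Rintegral => x _; rewrite mulrDr.
have -> : \int[mu4]_x (cut n x * u x * pd i phi x) = \int[mu4]_x (u x * (cut n x * pd i phi x)).
  by apply: eq_Rintegral => x _; ring.
have -> : \int[mu4]_x ((cut n x * g i x + pd i (cut n) x * u x) * phi x) =
    \int[mu4]_x (g i x * (cut n x * phi x)) + \int[mu4]_x (u x * (pd i (cut n) x * phi x)).
  rewrite -(RintegralD measurableT i3 i1).
  by apply: eq_Rintegral => x _; ring.
by move=> e; rewrite opprD -e; ring.
Qed.

(** Two weighted Young inequalities. The first separates c g from dc u. The second bounds u^2 / N^2
    by de^-2 u^4 + de^2 / N^4, which turns the missing L^2 bound on u into the available L^4 bound;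
    the term de^2 / N^4 has integral 16 de^2 over the box of half-width N. *)
Lemma cut_grad_bound (de u c dc g e N C : R) : 0 < de -> 0 < N -> 0 <= C ->
  0 <= c -> c <= 1 -> `|dc| <= C * e / N -> 0 <= e -> e <= 1 ->
  (c * g + dc * u) ^+ 2 <=
  (1 + de) * g ^+ 2 + (1 + de^-1) * C ^+ 2 * (de^-1 ^+ 2 * (u ^+ 4 * e ^+ 2) + de ^+ 2 / N ^+ 4).
Proof.
move=> de0 N0 C0 c0 c1 hdc e0 e1.
have d'0 : 0 < de^-1 by rewrite invr_gt0.
have h1 : (c * g + dc * u) ^+ 2 <= (1 + de) * (c * g) ^+ 2 + (1 + de^-1) * (dc * u) ^+ 2.
  have -> : (1 + de) * (c * g) ^+ 2 + (1 + de^-1) * (dc * u) ^+ 2 =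
    (c * g + dc * u) ^+ 2 + de * (c * g - de^-1 * (dc * u)) ^+ 2 by field; rewrite gt_eqF.
  by rewrite lerDl mulr_ge0 ?sqr_ge0// ltW.
apply: (le_trans h1); apply: lerD.
  rewrite ler_wpM2l ?addr_ge0 ?(ltW de0)// exprMn ler_piMl ?sqr_ge0//.
  exact: exprn_ile1.
rewrite -mulrA ler_wpM2l ?addr_ge0 ?(ltW d'0)//.
have h2 : dc ^+ 2 <= C ^+ 2 * (e ^+ 2 / N ^+ 2).
  rewrite -[dc ^+ 2]ger0_norm ?sqr_ge0// normrX.
  have -> : C ^+ 2 * (e ^+ 2 / N ^+ 2) = (C * e / N) ^+ 2 by field; rewrite gt_eqF.
  by rewrite ler_pXn2r ?nnegrE// ?divr_ge0 ?mulr_ge0// ltW.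
have e2 : 0 <= e ^+ 2 <= 1 by rewrite sqr_ge0 exprn_ile1.
rewrite exprMn (le_trans (ler_wpM2r (sqr_ge0 u) h2))// -mulrA ler_wpM2l ?sqr_ge0//.
have h3 : u ^+ 2 / N ^+ 2 <= de^-1 ^+ 2 * u ^+ 4 + de ^+ 2 / N ^+ 4.
  have -> : de^-1 ^+ 2 * u ^+ 4 + de ^+ 2 / N ^+ 4 =
     (de^-1 * u ^+ 2 - de / N ^+ 2) ^+ 2 + 2 * (u ^+ 2 / N ^+ 2).
    by field; rewrite !gt_eqF.
  have := sqr_ge0 (de^-1 * u ^+ 2 - de / N ^+ 2).
  have : 0 <= u ^+ 2 / N ^+ 2 by rewrite divr_ge0 ?sqr_ge0.
  by move: (u ^+ 2 / N ^+ 2) ((de^-1 * u ^+ 2 - de / N ^+ 2) ^+ 2) => a b; lra.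
have -> : e ^+ 2 / N ^+ 2 * u ^+ 2 = e ^+ 2 * (u ^+ 2 / N ^+ 2) by ring.
case/andP: e2 => e20 e21.
rewrite (le_trans (ler_wpM2l e20 h3))// mulrDr; apply: lerD.
  by rewrite le_eqVlt; apply/orP; left; apply/eqP; ring.
by rewrite ler_piMl// divr_ge0 ?sqr_ge0 ?exprn_ge0// ltW.
Qed.

(** The square of the extra factor in [pd_cut_le], restricted to the support box of the cutoff. It
    lies in [0, 1] and tends to 0 pointwise, so its integral against any integrable function tends
    to 0. *)
Definition far n i x : R := \1_(box (n.+1%:R : R)) x * (coord i x / n.+1%:R) ^+ 2.

Lemma measurable_indic_box (L : R) : measurable_fun setT (\1_(box L) : mT4 -> R).
Proof. by apply: measurable_indic; exact: measurable_box. Qed.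

Lemma measurable_far n i : measurable_fun setT (far n i).
Proof.
apply: measurable_funM; first exact: measurable_indic_box.
apply: (measurable_funX 2); apply: measurable_funM; first exact: measurable_coord.
exact: measurable_cst.
Qed.

Lemma box_coord (L : R) x i : box L x -> `|coord i x| <= L.
Proof. by move=> /(_ i); rewrite -ler_norml. Qed.

Lemma nbox_coord (L : R) x : ~ box L x -> exists i, L < `|coord i x|.
Proof.
move=> /existsNP[i]; rewrite -ler_norml => /negP; rewrite -ltNge => h.
by exists i.
Qed.

Lemma far_le1 n i x : 0 <= far n i x <= 1.
Proof.
have n0 : (0 : R) < n.+1%:R by rewrite ltr0n.
rewrite /far indicE; have [xb|xb] := boolP (x \in _); last by rewrite mul0r lexx ler01.
rewrite mul1r sqr_ge0/= -[_ ^+ 2]ger0_norm ?sqr_ge0// normrX exprn_ile1// normrM normfV.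
rewrite (gtr0_norm n0) ler_pdivrMr// mul1r; apply: box_coord.
by move: xb; rewrite inE.
Qed.

Lemma far_cvg i x : far n i x @[n --> \oo] --> (0 : R).
Proof.
have h : ((coord i x / n.+1%:R) ^+ 2) @[n --> \oo] --> (0 : R).
  have h1 : (coord i x / n.+1%:R) @[n --> \oo] --> (0 : R).
    by rewrite -[X in _ --> X](mulr0 (coord i x)); apply: cvgM;
      [exact: cvg_cst|exact: cvg_harmonic].
  have e : 0 = 0 ^+ 2 :> R by rewrite expr0n.
  by rewrite [X in _ --> X]e; exact: (cvg_comp _ _ h1 (der_continuous (derX 2 (der_id 0)))).
apply: (squeeze_cvgr _ (cvg_cst 0) h); apply: nearW => n.
have /andP[-> _] := far_le1 n i x; rewrite /= /far ler_piMl ?sqr_ge0//.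
Qed.

Lemma far_integral_cvg (q : R4 R -> R) i : mu4.-integrable setT (EFin \o q) ->
  \int[mu4]_x (q x * far n i x) @[n --> \oo] --> (0 : R).
Proof.
move=> iq; have mq := integrable_measurable iq.
have h := @dominated_cvg _ _ _ mu4 setT measurableT
  (fun n x => (q x * far n i x)%:E) (fun _ => 0%E) (EFin \o (fun x => `|q x|)).
have {}h : (\int[mu4]_x (q x * far n i x)%:E)%E @[n --> \oo] --> (\int[mu4]_x 0)%E.
  apply: h.
  - by move=> n; apply/measurable_EFinP; exact: (measurable_funM mq (measurable_far n i)).
  - move=> x _; apply: cvg_EFin; first exact: nearW.
    by rewrite -[X in _ --> X](mulr0 (q x)); apply: cvgM; [exact: cvg_cst|exact: far_cvg].
  - by [].
  - exact: integrable_normR.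
  - move=> n x _; rewrite /= lee_fin normrM ler_piMr//.
    by have /andP[f0 f1] := far_le1 n i x; rewrite ger0_norm.
rewrite integral0 in h; exact: (fine_cvg h).
Qed.

Lemma integral_indic_box (L : R) : 0 < L ->
  mu4.-integrable setT (EFin \o (\1_(box L) : R4 R -> R)) /\
  \int[mu4]_x \1_(box L) x = (2 * L) ^+ 4.
Proof.
move=> L0; have m1 := measurable_indic_box L.
have i0 x i : L < `|coord i x| -> \1_(box L) x = 0 :> R.
  by move=> Lx; rewrite indicE memNset// => /(@box_coord _ _ i); rewrite leNgt Lx.
split.
  apply: (bounded_supp_integrable (B := 1) L0 m1 _ i0) => x.
  by rewrite indicE; case: (_ \in _); rewrite ?normr0 ?normr1.
have mb := measurable_box L.
have e : mu4 (box L) = ((2 * L) ^+ 4)%:E.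
  exact: (etrans (congr1 mu4 (esym (setTI (box L))))
    (etrans (esym (pow4_muL_restr L measurableT)) (pow4_muL L0))).
have e1 : (\int[mu4]_x (\1_(box L) x)%:E = mu4 (box L `&` setT))%E.
  exact: (integral_indic mu4 measurableT mb).
exact: (congr1 fine (etrans e1 (etrans (congr1 mu4 (setIT (box L))) e))).
Qed.

End sobolev_inequality.

(** * Sharp Sobolev inequality on the homogeneous Sobolev space *)

Section sobolev_inequality2.
Variable R : realType.
Local Notation mT := (measurableTypeR R).
Local Notation mT4 := ((mT * mT) * (mT * mT))%type.
Local Notation mu := (@lebesgue_measure R).
Local Notation mu4 := (pow4 mu).
Implicit Types (x : R4 R) (i : 'I_4).

Definition cut_grad n (u : R4 R -> R) (g : 'I_4 -> R4 R -> R) i x : R :=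
  cut n x * g i x + pd i (cut n) x * u x.

Lemma cut_grad_le n u g i x (de : R) : 0 < de ->
  cut_grad n u g i x ^+ 2 <= (1 + de) * g i x ^+ 2 +
    ((1 + de^-1) * cutC R ^+ 2 * de^-1 ^+ 2 * (u x ^+ 4 * far n i x) +
     (1 + de^-1) * cutC R ^+ 2 * (de ^+ 2 / n.+1%:R ^+ 4) * \1_(box (n.+1%:R : R)) x).
Proof.
move=> de0; have n0 : (0 : R) < n.+1%:R by rewrite ltr0n.
have d'0 : 0 < de^-1 by rewrite invr_gt0.
have [xb|xb] := pselect (box (n.+1%:R : R) x); last first.
  have [j nj] := nbox_coord xb.
  rewrite /cut_grad (cut_supp (ltW nj)) (pd_cut_supp i (ltW nj)) !mul0r addr0 expr0n/=.
  have /andP[f0 _] := far_le1 n i x.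
  have w0 : 0 <= (1 + de^-1) * cutC R ^+ 2 by rewrite mulr_ge0 ?sqr_ge0// addr_ge0// ltW.
  apply: addr_ge0; first by rewrite mulr_ge0 ?sqr_ge0// addr_ge0// ltW.
  apply: addr_ge0.
    apply: mulr_ge0; first by apply: mulr_ge0 => //; exact: sqr_ge0.
    by apply: mulr_ge0 => //; exact: expr4_ge0.
  apply: mulr_ge0; last by rewrite indicE ler0n.
  by apply: mulr_ge0 => //; rewrite divr_ge0 ?sqr_ge0// exprn_ge0// ltW.
have e0 : 0 <= `|coord i x| / n.+1%:R by rewrite divr_ge0// ltW.
have e1 : `|coord i x| / n.+1%:R <= 1.
  by rewrite ler_pdivrMr// mul1r; exact: box_coord.
have hd : `|pd i (cut n) x| <= cutC R * (`|coord i x| / n.+1%:R) / n.+1%:R.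
  rewrite (le_trans (pd_cut_le n i x))// le_eqVlt; apply/orP; left; apply/eqP.
  by field; rewrite gt_eqF.
have := cut_grad_bound (u x) (g i x) de0 n0 (cutC_ge0 R) (cut_ge0 n x) (cut_le1 n x) hd e0 e1.
have fE : far n i x = (`|coord i x| / n.+1%:R) ^+ 2.
  rewrite /far indicE mem_set// mul1r -[LHS]ger0_norm ?sqr_ge0// normrX normrM normfV.
  by rewrite (gtr0_norm n0).
rewrite -fE indicE mem_set// => h; apply: (le_trans h).
by rewrite le_eqVlt; apply/orP; left; apply/eqP; rewrite mulr1; ring.
Qed.

Lemma cut_energy (u : R4 R -> R) g : Hdot1 u g -> forall n i (de : R), 0 < de ->
  mu4.-integrable setT (EFin \o (fun x => cut_grad n u g i x ^+ 2)) /\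
  \int[mu4]_x (cut_grad n u g i x ^+ 2) <= (1 + de) * \int[mu4]_x (g i x ^+ 2) +
    ((1 + de^-1) * cutC R ^+ 2 * de^-1 ^+ 2 * \int[mu4]_x (u x ^+ 4 * far n i x) +
     16 * ((1 + de^-1) * cutC R ^+ 2 * de ^+ 2)).
Proof.
move=> H n i de de0; have n0 : (0 : R) < n.+1%:R by rewrite ltr0n.
have [i3 e3] := integral_indic_box n0.
have i1 := Hdot1_integrable_grad H i.
have i2 : mu4.-integrable setT (EFin \o (fun x => u x ^+ 4 * far n i x)).
  apply: (integrable_mulb (C := 1) (Hdot1_integrable H) (measurable_far n i)) => x.
  by have /andP[f0 f1] := far_le1 n i x; rewrite ger0_norm.
have i1' := integrableZR (1 + de) i1.
have i2' := integrableZR ((1 + de^-1) * cutC R ^+ 2 * de^-1 ^+ 2) i2.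
have i3' := integrableZR ((1 + de^-1) * cutC R ^+ 2 * (de ^+ 2 / n.+1%:R ^+ 4)) i3.
have iR := integrableDR i1' (integrableDR i2' i3').
have mG : measurable_fun setT (cut_grad n u g i).
  apply: measurable_funD; apply: measurable_funM.
  - exact: (smooth_measurable (smooth_cut R n)).
  - exact: (Hdot1_measurable_grad H i).
  - exact: (smooth_measurable (smooth_pd i (smooth_cut R n))).
  - exact: (Hdot1_measurable H).
have iG : mu4.-integrable setT (EFin \o (fun x => cut_grad n u g i x ^+ 2)).
  apply: (le_integrableR _ _ iR); first exact: (measurable_funX 2 mG).
  by move=> x; rewrite (ger0_norm (sqr_ge0 _)); exact: cut_grad_le.
split=> //.
have h := le_Rintegral measurableT iG iR (fun x _ => cut_grad_le n u g i x de0).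
apply: (le_trans h).
rewrite (RintegralD measurableT i1' (integrableDR i2' i3')).
rewrite (RintegralD measurableT i2' i3').
rewrite (RintegralZl _ measurableT i1) (RintegralZl _ measurableT i2) (RintegralZl _ measurableT i3).
rewrite e3 !lerD2l le_eqVlt; apply/orP; left; apply/eqP.
by move: (n.+1%:R : R) n0 => N N0; field; rewrite !gt_eqF.
Qed.

(** The inequality holds for u cut off at scale n; the energies of the cut-off functions eventually
    exceed that of u by at most any prescribed ep, and Fatou recovers the L^4 norm of u. *)
Lemma sobolev_Hdot1 (u : R4 R -> R) g : Hdot1 u g ->
  8 * Num.sqrt (bubble_mass R * \int[mu4]_x (u x ^+ 4)) <= \sum_(i < 4) \int[mu4]_x (g i x ^+ 2).
Proof.
move=> H; set K := \sum_(i < 4) _.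
have K0 : 0 <= K.
  by apply: sumr_ge0 => i _; apply: Rintegral_ge0 => x _; exact: sqr_ge0.
have mu_ := Hdot1_measurable H; have iu := Hdot1_integrable H.
have m0 := bubble_mass_gt0 R.
apply/ler_addgt0Pr => ep ep0.
pose C2 := cutC R ^+ 2; have C20 : 0 <= C2 by exact: sqr_ge0.
(* Makes de (K + 128 C2) at most ep / 3. Each of the four coordinates contributes an error 16 (1 +
   de^-1) C2 de^2, and (1 + de^-1) de^2 <= 2 de for de <= 1, whence 128 = 4 * 16 * 2. *)
pose D := 3 * (K + 128 * C2 + 1).
have D0 : 0 < D by rewrite /D; lra.
pose de := Num.min 1 (ep / D).
have de0 : 0 < de by rewrite lt_min ltr01 divr_gt0.
have de1 : de <= 1 by rewrite ge_min lexx.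
have dep : de * D <= ep by rewrite -ler_pdivlMr// ge_min lexx orbT.
pose b := (1 + de^-1) * C2 * de^-1 ^+ 2.
have hc : b * \sum_(i < 4) \int[mu4]_x (u x ^+ 4 * far n i x) @[n --> \oo] --> (0 : R).
  rewrite -[X in _ --> X](mulr0 b); apply: cvgM; first exact: cvg_cst.
  elim: (index_enum _) => [|i r IH].
    by under eq_fun do rewrite big_nil; exact: cvg_cst.
  have := cvgD (far_integral_cvg i iu) IH; rewrite addr0.
  have -> : (fun n => \sum_(j <- i :: r) \int[mu4]_x (u x ^+ 4 * far n j x)) =
    ((fun n => \int[mu4]_x (u x ^+ 4 * far n i x)) +
     (fun n => \sum_(j <- r) \int[mu4]_x (u x ^+ 4 * far n j x)))%R.
    by apply/funext => n; rewrite big_cons.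
  by move=> h; exact: h.
have [n0 _ hn0] : \forall n \near \oo,
    `|b * \sum_(i < 4) \int[mu4]_x (u x ^+ 4 * far n i x)| <= ep / 3.
  by apply: cvgr0_norm_le => //; rewrite divr_gt0.
have EK n : (n0 <= n)%N -> \sum_(i < 4) \int[mu4]_x (cut_grad n u g i x ^+ 2) <= K + ep.
  move=> nn; apply: (@le_trans _ _ ((1 + de) * K +
      (b * \sum_(i < 4) \int[mu4]_x (u x ^+ 4 * far n i x) +
       64 * ((1 + de^-1) * C2 * de ^+ 2)))).
    rewrite /K !mulr_sumr.
    have -> : 64 * ((1 + de^-1) * C2 * de ^+ 2) = \sum_(i < 4) 16 * ((1 + de^-1) * C2 * de ^+ 2).
      by rewrite sumr_const card_ord -mulr_natl; ring.
    rewrite -!big_split/=; apply: ler_sum => i _.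
    exact: (cut_energy H n i de0).2.
  have h1 := le_trans (ler_norm _) (hn0 n nn).
  have h2 : 64 * ((1 + de^-1) * C2 * de ^+ 2) <= 128 * C2 * de.
    have -> : 64 * ((1 + de^-1) * C2 * de ^+ 2) = 64 * C2 * de * (1 + de).
      by field; rewrite gt_eqF.
    have -> : 128 * C2 * de = 64 * C2 * de * 2 by ring.
    rewrite ler_wpM2l//; last by rewrite (_ : 2 = 1 + 1 :> R)// lerD2l.
    by rewrite mulr_ge0 ?(ltW de0)// mulr_ge0.
  move: h1 h2; move: (b * _) (64 * _) => q1 q2 h1 h2.
  have : de * K + 128 * C2 * de <= ep / 3.
    by rewrite ler_pdivlMr// (le_trans _ dep)// /D; nra.
  by lra.
have KE0 : 0 <= K + ep by rewrite addr_ge0// ltW.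
(* Fatou along the shifted sequence n0 + k, for which the energy bound [EK] holds at every index. *)
have hb : (\int[mu4]_x (u x ^+ 4)%:E <= (((K + ep) / 8) ^+ 2 / bubble_mass R)%:E)%E.
  apply: (@le_trans _ _ (limn_einf (fun k =>
      \int[mu4]_x ((cut (n0 + k) x * u x) ^+ 4)%:E))%E).
    apply: le_integral_limn_einf.
    - by apply/measurable_EFinP; exact: (measurable_funX 4 mu_).
    - by move=> x; rewrite lee_fin expr4_ge0.
    - move=> k; apply/measurable_EFinP; apply: (measurable_funX 4).
      by apply: measurable_funM => //; exact: (smooth_measurable (smooth_cut R _)).
    - by move=> k x; rewrite lee_fin expr4_ge0.
    apply: aeW => x.
    have h : ((cut (n0 + k) x * u x) ^+ 4)%:E @[k --> \oo] --> (u x ^+ 4)%:E.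
      apply: cvg_EFin; first exact: nearW.
      have h1 : (cut (n0 + k) x * u x) @[k --> \oo] --> u x.
        rewrite -[X in _ --> X](mul1r (u x)); apply: cvgM; last exact: cvg_cst.
        have := @cut_cvg R x; rewrite -(cvg_shiftn n0).
        by under eq_fun do rewrite addnC.
      exact: (cvg_comp _ (fun r : R => r ^+ 4) h1 (der_continuous (derX 4 (der_id (u x))))).
    by rewrite (cvg_limn_einf_sup h).1.
  apply: limn_einf_le => k; set n := (n0 + k)%N.
  have n1 : (0 : R) < n.+1%:R by rewrite ltr0n.
  have c0 x i : n.+1%:R < `|coord i x| -> cut n x = 0 by move=> /ltW; exact: cut_supp.
  have ih : mu4.-integrable setT (EFin \o (fun x => cut n x * u x)).
    have := mul_supp_integrable n1 mu_ (fun x => norm_le1X4 (u x)) iu (smooth_cut R n) c0.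
    by rewrite (_ : (fun x => u x * cut n x) = (fun x => cut n x * u x))//;
      apply/funext => x; rewrite mulrC.
  have hs := sobolev_supp (ltW n1) ih _ _ (fun i => (cut_energy H n i de0).1) (cut_weak H n).
  apply: (le_trans (hs _ _)).
  - by move=> i x /c0 ->; rewrite mul0r.
  - move=> i; apply: measurable_funD; apply: measurable_funM => //.
    + exact: (smooth_measurable (smooth_cut R n)).
    + exact: (Hdot1_measurable_grad H i).
    + exact: (smooth_measurable (smooth_pd i (smooth_cut R n))).
  rewrite lee_fin ler_wpM2r ?invr_ge0 ?(ltW m0)//.
  have := EK n (leq_addr _ _); set E := \sum_(i < 4) _ => hE.
  have E0 : 0 <= E.
    by apply: sumr_ge0 => i _; apply: Rintegral_ge0 => x _; exact: sqr_ge0.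
  by rewrite ler_pXn2r ?nnegrE ?divr_ge0// ler_wpM2r.
rewrite (integrable_RintegralE iu) lee_fin in hb.
have u0 : 0 <= \int[mu4]_x (u x ^+ 4).
  by apply: Rintegral_ge0 => x _; exact: expr4_ge0.
rewrite ler_pdivlMr// mulrC in hb.
have h := ler_wsqrtr hb; rewrite sqrtr_sqr ger0_norm ?divr_ge0// in h.
by rewrite mulrC -ler_pdivlMr.
Qed.

End sobolev_inequality2.

(** * Integrals of powers of 1 + |x|^2 *)

Section radial_integrals.
Variable R : realType.
Local Notation mT := (measurableTypeR R).
Local Notation mT4 := ((mT * mT) * (mT * mT))%type.
Local Notation mu := (@lebesgue_measure R).
Local Notation mu4 := (pow4 mu).

Definition isq (b : R) : R := (Num.sqrt b)^-1.

Lemma isq_gt0 (b : R) : 0 < b -> 0 < isq b.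
Proof. by move=> b0; rewrite invr_gt0 sqrtr_gt0. Qed.

Lemma isq_ge0 (b : R) : 0 <= isq b.
Proof. by rewrite invr_ge0 sqrtr_ge0. Qed.

Lemma isq_sqr (b : R) : 0 < b -> isq b ^+ 2 = b^-1.
Proof. by move=> b0; rewrite exprVn sqr_sqrtr// ltW. Qed.

Lemma isq_cont (b : R) : 0 < b -> {for b, continuous isq}.
Proof.
move=> b0; apply: cvgV; first by rewrite sqrtr_eq0 -ltNge.
exact: sqrt_continuous.
Qed.

Lemma measurable_isq : measurable_fun setT isq.
Proof.
apply: measurable_funVr.
by apply: continuous_measurable_fun => x; exact: sqrt_continuous.
Qed.

Definition cosmass k : R := 2 * primcos k (pi / 2).

Lemma cosmass_ge0 k : 0 <= cosmass k.
Proof. by rewrite mulr_ge0// ltW// primcos_gt0// pihalf_gt0. Qed.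

(** The substitution t = sqrt(b) tan(theta), in the form of the primitive [primcos m] of the
    arctangent, combined with the symmetry of the integrand. *)
Lemma integral_radial (b : R) m : 0 < b ->
  (\int[mu]_t (isq (b + t ^+ 2) ^+ m.+2)%:E = (isq b ^+ m.+1 * cosmass m)%:E)%E.
Proof.
move=> b0; set a := isq b; have a0 : 0 < a := isq_gt0 b0.
have bt (t : R) : 0 < b + t ^+ 2 by rewrite ltr_wpDr ?sqr_ge0.
pose f (t : R) := isq (b + t ^+ 2) ^+ m.+2.
pose F (t : R) := a ^+ m.+1 * primcos m (atan (t * a)).
have f0 t : 0 <= f t by rewrite exprn_ge0// isq_ge0.
have cf : continuous f.
  move=> t; have h1 : (b + s ^+ 2) @[s --> t] --> b + t ^+ 2.
    exact: (der_continuous (derD (der_cst b t) (derX 2 (der_id t)))).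
  have h2 := cvg_comp _ _ h1 (isq_cont (bt t)).
  exact: (cvg_comp _ (fun r : R => r ^+ m.+2) h2 (der_continuous (derX m.+2 (der_id _)))).
have dF (t : R) : is_derive t 1 F (f t).
  have h1 := derMr a (der_id t).
  have h2 := der_comp (f := fun s => s * a) (is_derive1_atan (t * a)) h1.
  have h3 := derMl (a ^+ m.+1) (der_comp (f := fun s => atan (s * a)) (der_primcos m _) h2).
  apply: (is_derive_eq h3); rewrite cos_atan mul1r.
  have e : 1 + (t * a) ^+ 2 = a ^+ 2 * (b + t ^+ 2).
    by rewrite /a isq_sqr// mulrDr mulVf ?gt_eqF// exprMn isq_sqr// mulrC.
  have -> : (Num.sqrt (1 + (t * a) ^+ 2))^-1 = a^-1 * isq (b + t ^+ 2).
    by rewrite e sqrtrM ?sqr_ge0// sqrtr_sqr (gtr0_norm a0) invfM.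
  have -> : f t = isq (b + t ^+ 2) ^+ m * isq (b + t ^+ 2) ^+ 2 by rewrite -exprD addn2.
  rewrite e invfM -(isq_sqr (bt t)) exprMn (exprVn a m) (exprSr a m).
  have am0 := expf_neq0 m (lt0r_neq0 a0).
  move: (a ^+ m) (isq _ ^+ m) (isq _ ^+ 2) am0 => am sm s2 am0.
  by field; rewrite am0 lt0r_neq0.
have lF : F t @[t --> +oo] --> a ^+ m.+1 * primcos m (pi / 2).
  apply: cvgM; first exact: cvg_cst.
  have h1 : atan (t * a) @[t --> +oo] --> (pi / 2 : R).
    apply: (cvg_comp (fun t => t * a) (@atan R) _ (@cvgy_atan R)).
    apply/cvgryPge => c; near=> t.
    rewrite -ler_pdivrMr//; near: t; exact: nbhs_pinfty_ge (num_real _).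
  exact: (cvg_comp _ _ h1 (@primcos_cont R m _)).
have ev : f =1 f \o -%R by move=> t; rewrite /f /= sqrrN.
transitivity (2%:E * \int[mu]_(t in [set t : R | (0 <= t)%R]) (f t)%:E)%E.
  exact: ge0_symfun_integralT.
have -> : (\int[mu]_(t in [set t : R | (0 <= t)%R]) (f t)%:E =
    (a ^+ m.+1 * primcos m (pi / 2))%:E - (F 0)%:E)%E.
  have cf' : {within `[0, +oo[, continuous f} by exact: continuous_subspaceT.
  have F0 : F t @[t --> 0^'+] --> F 0.
    by apply: cvg_at_right_filter; exact: (der_continuous (dF 0)).
  have dFE : {in `]0, +oo[, derive1 F =1 f} by move=> t _; exact: (der_derive1 (dF t)).2.
  rewrite -set_itvcy.
  exact: (ge0_continuous_FTC2y (fun t _ => f0 t) cf' lF (fun t _ => (der_derive1 (dF t)).1) F0 dFE).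
rewrite /F mul0r atan0 primcos0 mulr0 sube0 -EFinM /cosmass; congr EFin; ring.
Unshelve. all: by end_near. Qed.

Definition sumsq (x : R4 R) : R := 1 + x.1.1 ^+ 2 + x.1.2 ^+ 2 + x.2.1 ^+ 2 + x.2.2 ^+ 2.

Lemma sumsq_ge1 x : 1 <= sumsq x.
Proof. by rewrite /sumsq -!addrA lerDl !addr_ge0 ?sqr_ge0. Qed.

Lemma sumsq_gt0 x : 0 < sumsq x.
Proof. exact: lt_le_trans ltr01 (sumsq_ge1 x). Qed.

Lemma measurable_sumsq : measurable_fun setT sumsq.
Proof.
have mc j := measurable_funX 2 (@measurable_coord R j).
apply: measurable_funD; last exact: (mc (@Ordinal 4 3 isT)).
apply: measurable_funD; last exact: (mc (@Ordinal 4 2 isT)).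
apply: measurable_funD; last exact: (mc (@Ordinal 4 1 isT)).
by apply: measurable_funD; last exact: (mc (@Ordinal 4 0 isT)).
Qed.

Lemma measurable_isqX d (T : measurableType d) (f : T -> R) k : measurable_fun setT f ->
  measurable_fun setT (fun x => (isq (f x) ^+ k)%:E).
Proof.
move=> mf; apply/measurable_EFinP; apply: (measurable_funX k).
exact: (measurableT_comp measurable_isq mf).
Qed.

(** Integrating out one coordinate with [integral_radial] lowers the exponent by one and leaves a
    function of the same type in one variable less. These are the cosine integrals met in the
    transport, so the exponent 8 gives exactly [bubble_mass]. *)
Lemma integral_sumsq m : (\int[mu4]_x (isq (sumsq x) ^+ m.+4.+1)%:E =
  (cosmass m * cosmass m.+1 * cosmass m.+2 * cosmass m.+3)%:E)%E.
Proof.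
have e0 (b : R) k : (0 <= (isq b ^+ k)%:E)%E by rewrite lee_fin exprn_ge0// isq_ge0.
have pull (c : R) (g : R -> R) : 0 <= c -> measurable_fun setT g -> (forall t, 0 <= g t) ->
    (\int[mu]_t (g t * c)%:E = \int[mu]_t (g t)%:E * c%:E)%E.
  move=> c0 mg g0; under eq_integral do rewrite EFinM muleC.
  rewrite ge0_integralZl ?lee_fin//; first exact: muleC.
    exact/measurable_EFinP.
  by move=> t _; rewrite lee_fin.
have s (u v w : R) : 0 < 1 + u ^+ 2 + v ^+ 2 + w ^+ 2.
  by rewrite -!addrA ltr_wpDr// !addr_ge0 ?sqr_ge0.
rewrite (tonelli_ins mu (@Ordinal 4 3 isT) (measurable_isqX _ measurable_sumsq) (fun x => e0 _ _)).
pose r3 (y : mT * mT * mT) := 1 + y.1.1 ^+ 2 + y.1.2 ^+ 2 + y.2 ^+ 2.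
pose r2 (y : mT * mT) := 1 + y.1 ^+ 2 + y.2 ^+ 2.
have m11 : measurable_fun setT (fun z : (mT * mT) * mT => z.1.1).
  exact: (measurableT_comp measurable_fst measurable_fst).
have m12 : measurable_fun setT (fun z : (mT * mT) * mT => z.1.2).
  exact: (measurableT_comp measurable_snd measurable_fst).
have mr3 : measurable_fun setT r3.
  apply: measurable_funD; last exact: (measurable_funX 2 measurable_snd).
  apply: measurable_funD; last exact: (measurable_funX 2 m12).
  by apply: measurable_funD; last exact: (measurable_funX 2 m11).
have mr2 : measurable_fun setT r2.
  apply: measurable_funD; last exact: (measurable_funX 2 measurable_snd).
  by apply: measurable_funD; last exact: (measurable_funX 2 measurable_fst).
have mline (b : R) k : measurable_fun setT (fun t : mT => isq (b + t ^+ 2) ^+ k).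
  have := @measurable_isqX _ mT (fun t => b + t ^+ 2) k; move=> /(_ _)/measurable_EFinP; apply.
  by apply: measurable_funD => //; exact: (measurable_funX 2 (@measurable_id _ _ _)).
have g0 (b : R) k (t : R) : 0 <= isq (b + t ^+ 2) ^+ k by rewrite exprn_ge0// isq_ge0.
have c0 := cosmass_ge0.
transitivity (\int[pow3 mu]_y (isq (r3 y) ^+ m.+4 * cosmass m.+3)%:E)%E.
  by apply: eq_integral => y _; exact: (integral_radial m.+3 (s y.1.1 y.1.2 y.2)).
have mr3' : measurable_fun setT (fun y => (isq (r3 y) ^+ m.+4 * cosmass m.+3)%:E).
  apply/measurable_EFinP; apply: measurable_funM => //.
  exact: (measurable_funX m.+4 (measurableT_comp measurable_isq mr3)).
rewrite tonelli1 //; last by move=> y; rewrite lee_fin mulr_ge0// exprn_ge0// isq_ge0.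
transitivity (\int[pow2 mu]_y (isq (r2 y) ^+ m.+3 * (cosmass m.+2 * cosmass m.+3))%:E)%E.
  apply: eq_integral => y _.
  have := pull (cosmass m.+3) _ (c0 _) (mline (r2 y) m.+4) (g0 _ _).
  rewrite integral_radial; last by rewrite /r2 -addrA ltr_wpDr// addr_ge0 ?sqr_ge0.
  by rewrite -EFinM mulrA => <-.
have mr2' : measurable_fun setT (fun y => (isq (r2 y) ^+ m.+3 * (cosmass m.+2 * cosmass m.+3))%:E).
  apply/measurable_EFinP; apply: measurable_funM => //.
  exact: (measurable_funX m.+3 (measurableT_comp measurable_isq mr2)).
have c23 : 0 <= cosmass m.+2 * cosmass m.+3 by rewrite mulr_ge0.
rewrite tonelli1 //; last by move=> y; rewrite lee_fin mulr_ge0// exprn_ge0// isq_ge0.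
transitivity (\int[mu]_t (isq (1 + t ^+ 2) ^+ m.+2 * (cosmass m.+1 * (cosmass m.+2 * cosmass m.+3)))%:E)%E.
  apply: eq_integral => y _.
  have := pull _ _ c23 (mline (1 + y ^+ 2) m.+3) (g0 _ _).
  rewrite integral_radial; last by rewrite ltr_wpDr// sqr_ge0.
  by rewrite -EFinM mulrA => <-.
rewrite (pull _ _ (mulr_ge0 (c0 _) c23) (mline 1 m.+2) (g0 _ _)) (integral_radial m ltr01).
by rewrite -EFinM /isq sqrtr1 invr1 expr1n mul1r !mulrA.
Qed.

End radial_integrals.

(** * The bubble, its derivatives and their decay *)

Section bubble.
Variable R : realType.
Local Notation mT := (measurableTypeR R).
Local Notation mT4 := ((mT * mT) * (mT * mT))%type.
Local Notation mu := (@lebesgue_measure R).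
Local Notation mu4 := (pow4 mu).
Implicit Types (x : R4 R) (i : 'I_4).

(** The fundamental theorem of calculus gives 0 on every line. [box_line] yields only upper bounds,
    so it is applied to the derivative and to its opposite. *)
Lemma integral_pd0 (H : R4 R -> R) dH i (B L : R) : 0 < L -> has_grad H dH ->
  (forall y, continuous (fun t => dH i (ins i t y))) ->
  measurable_fun setT (dH i) -> (forall x, `|dH i x| <= B) ->
  (forall x j, L < `|coord j x| -> dH i x = 0) ->
  (forall x, L <= `|coord i x| -> H x = 0) ->
  \int[mu4]_x dH i x = 0.
Proof.
move=> L0 hH cH mH HB dH0 H0; rewrite -(Rintegral_box_supp mH dH0).
have line y : \int[mu]_(t in `[- L, L]) dH i (ins i t y) = 0.
  have hd := has_grad_ins hH i y.
  have LL : - L <= L by rewrite ge0_cp// ltW.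
  have := FTC2_itv (F := fun t => H (ins i t y)) (f := fun t => dH i (ins i t y)) LL
    (fun s _ => hd s) (fun s _ => der_continuous (hd s)) (fun s _ => cH y s).
  by move=> ->; rewrite !H0 ?subrr// coord_ins ?normrN ger0_norm// ltW.
have bH : bmeas (dH i) by split => //; exists B.
have h1 : \int[pow4 (muL L)]_x dH i x <= 0 * (2 * L) ^+ 3.
  by apply: (box_line (i := i)) => // y; rewrite line.
have h2 : \int[pow4 (muL L)]_x (- dH i x) <= 0 * (2 * L) ^+ 3.
  apply: (box_line (i := i)) => //; first exact: bmeasN.
  move=> y; have cy : forall s, - L <= s <= L -> {for s, continuous (fun t => dH i (ins i t y))}.
    by move=> s _; exact: cH.
  rewrite (_ : (fun t => - dH i (ins i t y)) = (fun t => -1 * dH i (ins i t y))).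
    by rewrite (RintegralZl _ _ (itv_integrable cy))// line mulr0.
  by apply/funext => t; rewrite mulN1r.
have iH := bmeas_integrable (pow4_muL_fin L0) bH.
have e : \int[pow4 (muL L)]_x (- dH i x) = - \int[pow4 (muL L)]_x dH i x.
  transitivity (\int[pow4 (muL L)]_x (-1 * dH i x)).
    by apply: eq_Rintegral => x _; rewrite mulN1r.
  by rewrite (RintegralZl _ measurableT iH) mulN1r.
rewrite e mul0r oppr_le0 in h2; rewrite mul0r in h1.
by apply/eqP; rewrite eq_le h1 h2.
Qed.

Definition bub x : R := (sumsq x)^-1.
Definition dbub i x : R := - (2 * coord i x) * (bub x * bub x).

Lemma bub_gt0 x : 0 < bub x. Proof. by rewrite invr_gt0 sumsq_gt0. Qed.

Lemma bub_le1 x : bub x <= 1.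
Proof. by rewrite invf_le1 ?sumsq_gt0// sumsq_ge1. Qed.

Lemma bub_isq x : bub x = isq (sumsq x) ^+ 2.
Proof. by rewrite isq_sqr// sumsq_gt0. Qed.

Lemma smooth_sumsq : smooth (@sumsq R).
Proof.
have s2 j : smooth (fun x : R4 R => coord j x ^+ 2).
  under eq_fun do rewrite expr2.
  by apply: smoothM; exact: smooth_coord.
exact: (smoothD (smoothD (smoothD (smoothD (@smooth_cst R 1) (s2 (@Ordinal 4 0 isT)))
  (s2 (@Ordinal 4 1 isT))) (s2 (@Ordinal 4 2 isT))) (s2 (@Ordinal 4 3 isT))).
Qed.

Lemma smooth_bub : smooth bub.
Proof. exact: (smoothV smooth_sumsq (@sumsq_gt0 R)). Qed.

Lemma smooth_dbub i : smooth (dbub i).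
Proof.
apply: smoothM; last by apply: smoothM; exact: smooth_bub.
apply: smooth_opp; apply: smoothM; [exact: smooth_cst|exact: smooth_coord].
Qed.

Lemma has_grad_sumsq : has_grad (@sumsq R) (fun i x => 2 * coord i x).
Proof.
move=> i x.
have : is_derive (0 : R) 1 (fun t => sumsq x + (2 * coord i x * t + t ^+ 2)) (2 * coord i x).
  have h := derD (der_cst (sumsq x) 0)
    (derD (derMl (2 * coord i x) (der_id 0)) (derX 2 (der_id 0))).
  by apply: (is_derive_eq h); rewrite /=; ring.
congr is_derive; apply/funext => t.
by case: i => -[|[|[|[|?]]]] // i4; rewrite /sumsq /shift /coord /=; ring.
Qed.

Lemma has_grad_bub : has_grad bub dbub.
Proof. exact: (has_gradV (@sumsq_gt0 R) has_grad_sumsq). Qed.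

Definition ddbub i x : R := - 2 * bub x ^+ 2 + 8 * coord i x ^+ 2 * bub x ^+ 3.

Lemma pd_dbub i x : pd i (dbub i) x = ddbub i x.
Proof.
have h1 : has_grad (fun x => - (2 * coord i x)) (fun k _ => - (2 * (k == i)%:R)).
  by move=> k z; exact: derN (derMl 2 (has_grad_coord i k z)).
rewrite (has_grad_pd (has_gradM h1 (has_gradM has_grad_bub has_grad_bub)) i) eqxx.
by rewrite /dbub /ddbub mulr1; ring.
Qed.

Lemma sumsqE x : sumsq x = 1 + \sum_(i < 4) coord i x ^+ 2.
Proof. by rewrite !big_ord_recl big_ord0 /sumsq /coord /=; ring. Qed.

(** The equation - Delta w = 8 w^3 in pointwise form; |x|^2 is eliminated through (1 + |x|^2) w =
    1. *)
Lemma sum_ddbub x : \sum_(i < 4) ddbub i x = - 8 * bub x ^+ 3.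
Proof.
rewrite big_split/= sumr_const card_ord -mulr_suml -mulr_sumr.
have -> : \sum_(i < 4) coord i x ^+ 2 = sumsq x - 1 by rewrite sumsqE; ring.
have : sumsq x * bub x = 1 by rewrite mulfV// gt_eqF// sumsq_gt0.
move: (sumsq x) (bub x) => s w sw.
have -> : 8 * (s - 1) * w ^+ 3 = 8 * (s * w) * w ^+ 2 - 8 * w ^+ 3 by ring.
by rewrite sw -mulr_natl; ring.
Qed.

Lemma coord_bub i x : coord i x ^+ 2 * bub x <= 1.
Proof.
rewrite ler_pdivrMr ?sumsq_gt0// mul1r sumsqE (bigD1 i)//= addrCA lerDl.
by rewrite addr_ge0// sumr_ge0// => j _; exact: sqr_ge0.
Qed.

Lemma ddbub_le i x : `|ddbub i x| <= 10 * bub x ^+ 2.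
Proof.
have b0 := bub_gt0 x; have := coord_bub i x; have := sqr_ge0 (coord i x).
rewrite /ddbub; move: (coord i x ^+ 2) (bub x) b0 => c w w0 c0 cw.
have -> : - 2 * w ^+ 2 + 8 * c * w ^+ 3 = (- 2 + 8 * (c * w)) * w ^+ 2 by ring.
rewrite normrM (ger0_norm (sqr_ge0 w)) ler_wpM2r ?sqr_ge0//.
have : 0 <= c * w by rewrite mulr_ge0// ltW.
by rewrite ler_norml; lra.
Qed.

Lemma dbub_sqr_le i x : dbub i x ^+ 2 <= 4 * bub x ^+ 3.
Proof.
have b0 := bub_gt0 x; have := coord_bub i x.
rewrite /dbub; move: (coord i x) (bub x) b0 => c w w0 cw.
have -> : (- (2 * c) * (w * w)) ^+ 2 = 4 * w ^+ 3 * (c ^+ 2 * w) by ring.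
by rewrite ler_piMr// mulr_ge0// exprn_ge0// ltW.
Qed.

Lemma measurable_bub : measurable_fun setT bub.
Proof. exact: (smooth_measurable smooth_bub). Qed.

Lemma measurable_dbub i : measurable_fun setT (dbub i).
Proof. exact: (smooth_measurable (smooth_dbub i)). Qed.

Lemma isq_integrable m :
  mu4.-integrable setT (EFin \o (fun x => isq (sumsq x) ^+ m.+4.+1)).
Proof.
apply: ge0_integrableR.
- exact: (measurable_funX _ (measurableT_comp (@measurable_isq R) (@measurable_sumsq R))).
- by move=> x; rewrite exprn_ge0// isq_ge0.
- by rewrite integral_sumsq ltry.
Qed.

Lemma bub4_integral : (\int[mu4]_x (bub x ^+ 4)%:E = (bubble_mass R)%:E)%E.
Proof.
transitivity (\int[mu4]_x (isq (sumsq x) ^+ 8)%:E)%E; last exact: (integral_sumsq R 3).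
by apply: eq_integral => x _; rewrite bub_isq -exprM.
Qed.

Lemma bub3_integrable : mu4.-integrable setT (EFin \o (fun x => bub x ^+ 3)).
Proof.
have := isq_integrable 1; congr (_.-integrable _ _).
by apply/funext => x; rewrite /= bub_isq -exprM.
Qed.

Lemma bub4_integrable : mu4.-integrable setT (EFin \o (fun x => bub x ^+ 4)).
Proof.
have := isq_integrable 3; congr (_.-integrable _ _).
by apply/funext => x; rewrite /= bub_isq -exprM.
Qed.

Lemma dbub_integrable i : mu4.-integrable setT (EFin \o (fun x => dbub i x ^+ 2)).
Proof.
apply: (le_integrableR _ _ (integrableZR 4 bub3_integrable)).
  exact: (measurable_funX 2 (measurable_dbub i)).
by move=> x; rewrite (ger0_norm (sqr_ge0 _)) dbub_sqr_le.
Qed.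

(* if |f| <= q^-1 then |f| q^-4 <= q^-5, otherwise |f| q^-4 <= |f|^4 *)
Lemma mul_bub2_le (f : R) x : `|f| * bub x ^+ 2 <= f ^+ 4 + isq (sumsq x) ^+ 5.
Proof.
have q0 : 0 < isq (sumsq x) by rewrite isq_gt0// sumsq_gt0.
have q1 : isq (sumsq x) <= 1.
  by rewrite invf_le1 ?sqrtr_gt0 ?sumsq_gt0// -sqrtr1 ler_wsqrtr// sumsq_ge1.
rewrite bub_isq -exprM; move: (isq _) q0 q1 => q q0 q1.
have [fq|fq] := lerP `|f| q.
  rewrite (_ : q ^+ 5 = q * q ^+ (2 * 2)); last by rewrite -exprS.
  rewrite (le_trans (ler_wpM2r _ fq)) ?exprn_ge0 ?(ltW q0)//.
  by rewrite lerDr expr4_ge0.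
rewrite -[f ^+ 4]ger0_norm ?expr4_ge0// normrX (exprS _ 3).
apply: (@le_trans _ _ (`|f| * `|f| ^+ 3)).
  rewrite ler_wpM2l//; apply: (@le_trans _ _ (q ^+ 3)).
    by rewrite (_ : q ^+ (2 * 2) = q * q ^+ 3) ?ler_piMl ?exprn_ge0 ?(ltW q0)// -exprS.
  by rewrite ler_pXn2r ?nnegrE// ?(ltW q0)// ltW.
by rewrite lerDl exprn_ge0// ltW.
Qed.

(** An L^4 function is integrable against decay |x|^-4: [mul_bub2_le] gives the majorant f^4 plus a
    power (1 + |x|^2)^(-5/2), which is integrable in dimension four. *)
Lemma mul_bub2_integrable (f h : R4 R -> R) (C : R) : measurable_fun setT f ->
  mu4.-integrable setT (EFin \o (fun x => f x ^+ 4)) ->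
  measurable_fun setT h -> (forall x, `|h x| <= C * bub x ^+ 2) -> 0 <= C ->
  mu4.-integrable setT (EFin \o (fun x => f x * h x)).
Proof.
move=> mf if4 mh hC C0.
apply: (le_integrableR _ _ (integrableZR C (integrableDR if4 (isq_integrable 0)))).
  exact: measurable_funM.
move=> x; rewrite normrM (le_trans (ler_wpM2l (normr_ge0 _) (hC x)))//.
by rewrite mulrCA ler_wpM2l// mul_bub2_le.
Qed.

End bubble.

(** * The bubble in the Sobolev space and its weak equation *)

Section bubble_equation.
Variable R : realType.
Local Notation mT := (measurableTypeR R).
Local Notation mT4 := ((mT * mT) * (mT * mT))%type.
Local Notation mu := (@lebesgue_measure R).
Local Notation mu4 := (pow4 mu).
Implicit Types (x : R4 R) (i : 'I_4).

Lemma test_fun_has_grad (phi : R4 R -> R) : test_fun phi -> has_grad phi (fun i => pd i phi).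
Proof.
by move=> [d _] i x; apply: DeriveDef; [exact: (d [::] i x)|rewrite /pd derive1E].
Qed.

Lemma Hdot1_bub : Hdot1 (@bub R) (@dbub R).
Proof.
split; first exact: measurable_bub.
split.
  have h : (\int[mu4]_x (`|bub x| ^+ 4)%:E < +oo)%E.
    under eq_integral do rewrite (gtr0_norm (bub_gt0 _)).
    by rewrite bub4_integral ltry.
  exact: h.
move=> i; split; first exact: measurable_dbub.
split.
  have h : (\int[mu4]_x (dbub i x ^+ 2)%:E < +oo)%E.
    by rewrite (integrable_RintegralE (dbub_integrable R i)) ltry.
  exact: h.
move=> phi tphi; have hphi := test_fun_has_grad tphi.
case: tphi => [_ [cphi [M phi0]]].
(* The support bound M of a test function may be negative; L is positive and strictly larger than
   M. *)
pose L := `|M| + 1; have L0 : 0 < L by rewrite ltr_wpDl.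
have ML : M < L by rewrite (le_lt_trans (ler_norm _))// ltrDl.
have p0 x j : L <= `|coord j x| -> phi x = 0.
  by move=> Lx; apply: phi0; exists j; exact: lt_le_trans ML Lx.
have p0' x j : L < `|coord j x| -> phi x = 0 by move=> /ltW; exact: p0.
have dp0 k x j : L < `|coord j x| -> pd k phi x = 0 by exact: (pd_supp hphi p0').
have cp : continuous phi := cphi [::].
have cdp : continuous (pd i phi) := cphi [:: i].
have cb := smooth_continuous (smooth_bub R); have cdb := smooth_continuous (smooth_dbub R i).
have c1 : continuous (fun x => bub x * pd i phi x).
  by move=> x; apply: cvgM; [exact: cb|exact: cdp].
have c2 : continuous (fun x => dbub i x * phi x).
  by move=> x; apply: cvgM; [exact: cdb|exact: cp].
have z1 x j : L < `|coord j x| -> bub x * pd i phi x = 0 by move=> /dp0 ->; rewrite mulr0.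
have z2 x j : L < `|coord j x| -> dbub i x * phi x = 0 by move=> /p0' ->; rewrite mulr0.
have m1 := sepcont_measurable (continuous_sepcont c1).
have m2 := sepcont_measurable (continuous_sepcont c2).
have [B1 hB1] := continuous_supp_bounded c1 z1.
have [B2 hB2] := continuous_supp_bounded c2 z2.
have i1 := bounded_supp_integrable L0 m1 hB1 z1.
have i2 := bounded_supp_integrable L0 m2 hB2 z2.
have H0 : \int[mu4]_x (dbub i x * phi x + bub x * pd i phi x) = 0.
  have c3 : continuous (fun x => dbub i x * phi x + bub x * pd i phi x).
    by move=> x; apply: cvgD; [exact: c2|exact: c1].
  have c3' := continuous_sepcont c3.
  apply: (integral_pd0 (dH := fun i x => dbub i x * phi x + bub x * pd i phi x)
    (H := fun x => bub x * phi x) (B := B2 + B1) L0).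
  - exact: (has_gradM (@has_grad_bub R) hphi).
  - exact: (c3' i).
  - exact: (sepcont_measurable c3').
  - by move=> x; rewrite (le_trans (ler_normD _ _))// lerD.
  - by move=> x j Lx; rewrite (z1 x j Lx) (z2 x j Lx) addr0.
  - by move=> x /p0 ->; rewrite mulr0.
rewrite (RintegralD measurableT i2 i1) in H0.
have e1 := integrable_RintegralE i1; have e2 := integrable_RintegralE i2.
apply: (etrans e1); apply: esym; apply: (etrans (congr1 oppe e2)).
rewrite -EFinN; congr EFin.
by apply/eqP; rewrite eq_sym -subr_eq0 opprK addrC H0.
Qed.

Lemma Rintegral_dominated (F : nat -> R4 R -> R) (G D : R4 R -> R) :
  (forall n, measurable_fun setT (F n)) ->
  (forall x, F n x @[n --> \oo] --> G x) ->
  mu4.-integrable setT (EFin \o D) -> (forall n x, `|F n x| <= D x) ->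
  \int[mu4]_x F n x @[n --> \oo] --> \int[mu4]_x G x.
Proof.
move=> mF FG iD FD.
have mG : measurable_fun setT G.
  by apply: (measurable_fun_cvg (h := F)) => // x _; exact: FG.
have D0 x : 0 <= D x := le_trans (normr_ge0 _) (FD 0%N x).
have GD x : `|G x| <= D x.
  apply: (ler_cvg_to (cvg_norm (FG x)) (cvg_cst (D x))).
  by apply: nearW => n; exact: FD.
have iG : mu4.-integrable setT (EFin \o G) by apply: (le_integrableR _ _ iD).
have h : (\int[mu4]_x (F n x)%:E)%E @[n --> \oo] --> (\int[mu4]_x (G x)%:E)%E.
  apply: (dominated_cvg measurableT _ _ _ iD).
  - by move=> n; apply/measurable_EFinP; exact: mF.
  - by move=> x _; apply: cvg_EFin; [exact: nearW|exact: FG].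
  - by [].
  - by move=> n x _; rewrite /= lee_fin.
rewrite (integrable_RintegralE iG) in h; exact: (fine_cvg h).
Qed.

Lemma cut_integral_cvg (q : R4 R -> R) : mu4.-integrable setT (EFin \o q) ->
  \int[mu4]_x (q x * cut n x) @[n --> \oo] --> \int[mu4]_x q x.
Proof.
move=> iq; apply: (Rintegral_dominated _ _ (integrable_normR iq)).
- move=> n; apply: measurable_funM; first exact: (integrable_measurable iq).
  exact: (smooth_measurable (smooth_cut R n)).
- move=> x; rewrite -[X in _ --> X](mulr1 (q x)); apply: cvgM; first exact: cvg_cst.
  exact: cut_cvg.
- by move=> n x; rewrite normrM ler_piMr// (ger0_norm (cut_ge0 n x)) cut_le1.
Qed.

(** On the support of the cutoff the factors |x_i| coming from both derivatives are absorbed by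
    (n+1)^-2. The bound is uniform in n, so it serves as a majorant when n tends to infinity. *)
Lemma pd_cut_dbub_le n i x : `|pd i (cut n) x * dbub i x| <= 2 * cutC R * bub x ^+ 2.
Proof.
have n0 : (0 : R) < n.+1%:R by rewrite ltr0n.
have C0 := cutC_ge0 R; have b0 := bub_gt0 x.
have w0 : 0 <= 2 * cutC R * bub x ^+ 2.
  by apply: mulr_ge0; [exact: mulr_ge0|exact: sqr_ge0].
have [nx|nx] := lerP n.+1%:R `|coord i x|.
  by rewrite (pd_cut_supp i nx) mul0r normr0.
rewrite normrM; apply: (le_trans (ler_wpM2r (normr_ge0 _) (pd_cut_le n i x))).
rewrite /dbub normrM normrN normrM (ger0_norm (ltW (mulr_gt0 b0 b0))) (ger0_norm (ler0n _ 2)).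
have h : (`|coord i x| / n.+1%:R) ^+ 2 <= 1.
  by rewrite exprn_ile1 ?divr_ge0 ?(ltW n0)// ler_pdivrMr// mul1r ltW.
have -> : cutC R * `|coord i x| / n.+1%:R ^+ 2 * (2 * `|coord i x| * (bub x * bub x)) =
  2 * cutC R * bub x ^+ 2 * (`|coord i x| / n.+1%:R) ^+ 2 by field; rewrite gt_eqF.
by rewrite ler_piMr.
Qed.

Lemma pd_cut_cvg i x : pd i (cut n) x @[n --> \oo] --> (0 : R).
Proof.
have h : (cutC R * `|coord i x| * n.+1%:R^-1) @[n --> \oo] --> (0 : R).
  rewrite -[X in _ --> X](mulr0 (cutC R * `|coord i x|)); apply: cvgM.
    exact: cvg_cst.
  exact: cvg_harmonic.
apply: norm_cvg0; apply: (squeeze_cvgr _ (cvg_cst 0) h); apply: nearW => n.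
have n0 : (0 : R) < n.+1%:R by rewrite ltr0n.
have h2 : (n.+1%:R ^+ 2)^-1 <= n.+1%:R^-1 :> R.
  by rewrite lef_pV2 ?posrE ?exprn_gt0// expr2 ler_peMr ?(ltW n0)// ler1n.
rewrite normr_ge0/= (le_trans (pd_cut_le n i x))//.
exact: (ler_wpM2l (mulr_ge0 (cutC_ge0 R) (normr_ge0 _)) h2).
Qed.

(** The derivative of the bubble is not compactly supported, so the weak formulation is tested with
    its product with the cutoff. As n grows, the term with the gradient of the cutoff vanishes and
    the other two converge, by dominated convergence. *)
Lemma bub_weak_coord (f : R4 R -> R) g : Hdot1 f g -> forall i,
  \int[mu4]_x (f x * ddbub i x) = - \int[mu4]_x (g i x * dbub i x).
Proof.
move=> H i; have mf := Hdot1_measurable H; have mg := Hdot1_measurable_grad H i.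
have if4 := Hdot1_integrable H; have ig2 := Hdot1_integrable_grad H i.
have C0 := cutC_ge0 R.
have sdb := @smooth_dbub R i; have sdd : smooth (@ddbub R i).
  have e : pd i (dbub i) = @ddbub R i by apply/funext => x; exact: pd_dbub.
  by rewrite -e; exact: smooth_pd.
have mdd := smooth_measurable sdd; have mdb := smooth_measurable sdb.
have i1 : mu4.-integrable setT (EFin \o (fun x => f x * ddbub i x)).
  exact: (mul_bub2_integrable mf if4 mdd (@ddbub_le R i) (ler0n _ 10)).
have i2 : mu4.-integrable setT (EFin \o (fun x => g i x * dbub i x)).
  apply: (le_integrableR _ _ (integrableDR ig2 (dbub_integrable R i))).
    exact: measurable_funM.
  move=> x; rewrite normrM.
  have := sqr_ge0 (`|g i x| - `|dbub i x|).
  rewrite -[g i x ^+ 2]ger0_norm ?sqr_ge0// -[dbub i x ^+ 2]ger0_norm ?sqr_ge0// !normrX.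
  have := normr_ge0 (g i x); have := normr_ge0 (dbub i x).
  by move: `|g i x| `|dbub i x| => a b; nra.
have m3 n : measurable_fun setT (fun x : mT4 => pd i (cut n) x * dbub i x).
  by apply: measurable_funM => //; exact: (smooth_measurable (smooth_pd i (smooth_cut R n))).
have i3 n : mu4.-integrable setT (EFin \o (fun x => f x * (pd i (cut n) x * dbub i x))).
  apply: (mul_bub2_integrable mf if4 (m3 n) (pd_cut_dbub_le n i)).
  by rewrite mulr_ge0.
have i4 n : mu4.-integrable setT (EFin \o (fun x => f x * ddbub i x * cut n x)).
  apply: (integrable_mulb (C := 1) i1 (smooth_measurable (smooth_cut R n))).
  by move=> x; rewrite (ger0_norm (cut_ge0 n x)) cut_le1.
have e n : \int[mu4]_x (f x * (pd i (cut n) x * dbub i x)) +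
    \int[mu4]_x (f x * ddbub i x * cut n x) = - \int[mu4]_x (g i x * dbub i x * cut n x).
  have sc := smooth_cut R n.
  have z x j : n.+1%:R < `|coord j x| -> cut n x * dbub i x = 0.
    by move=> /ltW h; rewrite (cut_supp h) mul0r.
  have := Hdot1_weak H i (smoothM sc sdb) z.
  rewrite (has_grad_pd (has_gradM (smooth_has_grad sc) (smooth_has_grad sdb)) i).
  have -> : \int[mu4]_x (g i x * (cut n x * dbub i x)) = \int[mu4]_x (g i x * dbub i x * cut n x).
    by apply: eq_Rintegral => x _; ring.
  move=> <-; rewrite -(RintegralD measurableT (i3 n) (i4 n)).
  by apply: eq_Rintegral => x _; rewrite pd_dbub; ring.
have l1 : \int[mu4]_x (f x * (pd i (cut n) x * dbub i x)) @[n --> \oo] --> (0 : R).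
  have z0 : 0 = \int[mu4]_x (0 : R) by rewrite /Rintegral integral0.
  rewrite [X in _ --> X]z0.
  apply: (Rintegral_dominated _ _ (integrableZR (2 * cutC R)
    (integrableDR if4 (isq_integrable R 0)))).
  - by move=> n; exact: (measurable_funM mf (m3 n)).
  - move=> x; have h : (pd i (cut n) x * dbub i x) @[n --> \oo] --> (0 : R).
      rewrite -[X in _ --> X](mul0r (dbub i x)); apply: cvgM; last exact: cvg_cst.
      exact: pd_cut_cvg.
    by rewrite -[X in _ --> X](mulr0 (f x)); apply: cvgM; [exact: cvg_cst|exact: h].
  - move=> n x; rewrite normrM (le_trans (ler_wpM2l (normr_ge0 _) (pd_cut_dbub_le n i x)))//.
    by rewrite mulrCA; apply: ler_wpM2l; [exact: mulr_ge0|exact: mul_bub2_le].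
have l2 := cut_integral_cvg i1; have l3 := cut_integral_cvg i2.
pose A n := \int[mu4]_x (f x * (pd i (cut n) x * dbub i x)) +
  \int[mu4]_x (f x * ddbub i x * cut n x).
have l4 : A n @[n --> \oo] --> \int[mu4]_x (f x * ddbub i x).
  by have := cvgD l1 l2; rewrite add0r; exact.
have l5 : A n @[n --> \oo] --> - \int[mu4]_x (g i x * dbub i x).
  have -> : A = (fun n => - \int[mu4]_x (g i x * dbub i x * cut n x)).
    by apply/funext => n; exact: e.
  exact: cvgN.
exact: (cvg_unique _ l4 l5).
Qed.

End bubble_equation.

(** * The weak bubble equation and scaling of Sobolev functions *)

Section ground_state_energy.
Variable R : realType.
Local Notation mT := (measurableTypeR R).
Local Notation mT4 := ((mT * mT) * (mT * mT))%type.
Local Notation mu := (@lebesgue_measure R).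
Local Notation mu4 := (pow4 mu).
Implicit Types (x : R4 R) (i : 'I_4).

Lemma mul_grad_integrable (g h : R4 R -> R) :
  measurable_fun setT g -> measurable_fun setT h ->
  mu4.-integrable setT (EFin \o (fun x => g x ^+ 2)) ->
  mu4.-integrable setT (EFin \o (fun x => h x ^+ 2)) ->
  mu4.-integrable setT (EFin \o (fun x => g x * h x)).
Proof.
move=> mg mh ig ih; apply: (le_integrableR _ _ (integrableDR ig ih)).
  exact: (measurable_funM mg mh).
move=> x; rewrite normrM.
have := sqr_ge0 (`|g x| - `|h x|).
rewrite -[g x ^+ 2]ger0_norm ?sqr_ge0// -[h x ^+ 2]ger0_norm ?sqr_ge0// !normrX.
have := normr_ge0 (g x); have := normr_ge0 (h x).
by move: `|g x| `|h x| => a b; nra.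
Qed.

(** The weak form of - Delta w = 8 w^3 against every function of the Sobolev space, by summing
    [bub_weak_coord] over the coordinates and using [sum_ddbub]. Taking f = w also evaluates the
    energy of the bubble. *)
Lemma bub_weak (f : R4 R -> R) g : Hdot1 f g ->
  [/\ mu4.-integrable setT (EFin \o (fun x => \sum_(i < 4) dbub i x * g i x)),
      mu4.-integrable setT (EFin \o (fun x => bub x ^+ 3 * f x)) &
      \int[mu4]_x (\sum_(i < 4) dbub i x * g i x) = 8 * \int[mu4]_x (bub x ^+ 3 * f x)].
Proof.
move=> H; have mf := Hdot1_measurable H; have if4 := Hdot1_integrable H.
have i1 i : mu4.-integrable setT (EFin \o (fun x => dbub i x * g i x)).
  exact: (mul_grad_integrable (@measurable_dbub R i) (Hdot1_measurable_grad H i)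
    (dbub_integrable R i) (Hdot1_integrable_grad H i)).
have i2 : mu4.-integrable setT (EFin \o (fun x => f x * bub x ^+ 3)).
  apply: (mul_bub2_integrable (C := 1) mf if4); last exact: ler01.
    exact: (measurable_funX 3 (@measurable_bub R)).
  move=> x; have b0 := bub_gt0 x; rewrite mul1r ger0_norm ?exprn_ge0 ?(ltW b0)//.
  by rewrite exprS ler_piMl ?bub_le1// sqr_ge0.
have i3 i : mu4.-integrable setT (EFin \o (fun x => f x * ddbub i x)).
  apply: (mul_bub2_integrable (C := 10) mf if4 _ (@ddbub_le R i)) => //.
  rewrite (_ : ddbub i = pd i (dbub i)); first exact: (smooth_measurable (smooth_pd i (@smooth_dbub R i))).
  by apply/funext => x; rewrite pd_dbub.
have [j1 e1] := Rintegral_sum (index_enum _) i1.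
have [j3 e3] := Rintegral_sum (index_enum _) i3.
have E : (fun x => bub x ^+ 3 * f x) = (fun x => f x * bub x ^+ 3).
  by apply/funext => x; rewrite mulrC.
split=> //; first by rewrite E.
rewrite e1 E -(RintegralZl _ measurableT i2).
transitivity (- \sum_(i < 4) \int[mu4]_x (f x * ddbub i x)).
  rewrite -sumrN; apply: eq_bigr => i _; rewrite (bub_weak_coord H) opprK.
  by apply: eq_Rintegral => x _; rewrite mulrC.
rewrite -e3 -mulN1r -(RintegralZl _ measurableT j3).
apply: eq_Rintegral => x _; rewrite -mulr_sumr sum_ddbub; ring.
Qed.

Lemma Hdot1_scale (c : R) u g : 0 <= c -> Hdot1 u g ->
  Hdot1 (fun x => c * u x) (fun i x => c * g i x).
Proof.
move=> c0 H; have mu_ := Hdot1_measurable H; have mg := Hdot1_measurable_grad H.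
have iu := Hdot1_integrable H; have ig := Hdot1_integrable_grad H.
split; first by apply: measurable_funM.
split.
  have h : (\int[mu4]_x (`|c * u x| ^+ 4)%:E < +oo)%E.
    have := integrableZR (c ^+ 4) iu => /integrable_RintegralE e.
    under eq_integral do rewrite -normrX (ger0_norm (expr4_ge0 _)) exprMn.
    by rewrite e ltry.
  exact: h.
move=> i; split; first by apply: measurable_funM => //; exact: mg.
split.
  have h : (\int[mu4]_x ((c * g i x) ^+ 2)%:E < +oo)%E.
    have := integrableZR (c ^+ 2) (ig i) => /integrable_RintegralE e.
    under eq_integral do rewrite exprMn.
    by rewrite e ltry.
  exact: h.
move=> phi tphi; case: (H) => _ [_ /(_ i)[_ [_ /(_ phi tphi) w]]].
case: tphi => _ [cphi _].
have mp := sepcont_measurable (continuous_sepcont (cphi [::])).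
have mdp := sepcont_measurable (continuous_sepcont (cphi [:: i])).
have e1 : (\int[mu4]_x (c * u x * pd i phi x)%:E = c%:E * \int[mu4]_x (u x * pd i phi x)%:E)%E.
  by under eq_integral do rewrite -mulrA;
    exact: (ge0_integralZR mu4 c0 (measurable_funM mu_ mdp)).
have e2 : (\int[mu4]_x (c * g i x * phi x)%:E = c%:E * \int[mu4]_x (g i x * phi x)%:E)%E.
  by under eq_integral do rewrite -mulrA;
    exact: (ge0_integralZR mu4 c0 (measurable_funM (mg i) mp)).
apply: (etrans e1); apply: (etrans (congr1 (mule c%:E) w)).
by rewrite muleN; congr oppe; exact: esym e2.
Qed.

End ground_state_energy.

(** * Algebraic and integral bounds for the nonlinearity *)

Section solutions.
Variable R : realType.
Local Notation mT := (measurableTypeR R).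
Local Notation mT4 := ((mT * mT) * (mT * mT))%type.
Local Notation mu := (@lebesgue_measure R).
Local Notation mu4 := (pow4 mu).
Implicit Types (x : R4 R) (i : 'I_4).

Lemma ae0_integral4 (u : R4 R -> R) : measurable_fun setT u ->
  {ae mu4, forall x, u x = 0} <-> (\int[mu4]_x (u x ^+ 4)%:E = 0)%E.
Proof.
move=> mu_; have m4 : measurable_fun setT (fun x : mT4 => (u x ^+ 4)%:E).
  by apply/measurable_EFinP; exact: (measurable_funX 4 mu_).
have h := ae_eq_integral_abs mu4 measurableT m4.
have e : (\int[mu4]_x `|(u x ^+ 4)%:E| = \int[mu4]_x (u x ^+ 4)%:E)%E.
  by apply: eq_integral => x _; rewrite /= (ger0_norm (expr4_ge0 _)).
rewrite -e; split => [u0|/h u0].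
  apply/h; move: u0; apply: negligibleS => x /= + hx; apply.
  by move=> _; rewrite hx expr0n.
move: u0; apply: negligibleS => x /= + hx; apply.
by have [] := hx I => /eqP; rewrite expf_eq0/= => /eqP.
Qed.

Lemma Hdot1_0 : Hdot1 (fun _ : R4 R => 0 : R) (fun _ _ => 0).
Proof.
have := Hdot1_scale (lexx 0) (@Hdot1_bub R); congr Hdot1.
  by apply/funext => x; rewrite mul0r.
by apply/funext => i; apply/funext => x; rewrite mul0r.
Qed.

Definition energy (g : 'I_4 -> R4 R -> R) : R := \sum_(i < 4) \int[mu4]_x (g i x ^+ 2).

Lemma energy_ge0 g : 0 <= energy g.
Proof. by apply: sumr_ge0 => i _; apply: Rintegral_ge0 => x _; exact: sqr_ge0. Qed.

Lemma monomial_bound (p q : R) :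
  [/\ `|p ^+ 2 * q ^+ 2| <= p ^+ 4 + q ^+ 4 & `|p ^+ 3 * q| <= p ^+ 4 + q ^+ 4].
Proof.
have P0 := sqr_ge0 p; have Q0 := sqr_ge0 q.
have h1 : p ^+ 2 * q ^+ 2 <= p ^+ 4 + q ^+ 4.
  by rewrite !sqr_sqrE; move: (p ^+ 2) (q ^+ 2) P0 Q0 => a b a0 b0; nra.
split; first by rewrite ger0_norm// mulr_ge0.
have h2 : `|p * q| <= (p ^+ 2 + q ^+ 2) / 2.
  rewrite ler_norml; have := sqr_ge0 (p + q); have := sqr_ge0 (p - q).
  by rewrite sqrrB sqrrD; move: (p ^+ 2) (q ^+ 2) (p * q) => a b c; lra.
rewrite (_ : p ^+ 3 * q = p ^+ 2 * (p * q)); last by ring.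
rewrite normrM (ger0_norm P0) (le_trans (ler_wpM2l P0 h2))// !sqr_sqrE.
by move: (p ^+ 2) (q ^+ 2) P0 Q0 => a b a0 b0; nra.
Qed.

(** The difference factors as p^2 times a positive definite quadratic form, so equality holds
    exactly when p = 0. This is why a pair with vanishing first component can be extremal. *)
Lemma quartic_bound (p q : R) : p ^+ 4 / 36 + 9 / 4 * q ^+ 4 + p ^+ 2 * q ^+ 2 + p ^+ 3 * q / 9 <=
  9 / 4 * (p ^+ 4 + q ^+ 4 + 2 * (p ^+ 2 * q ^+ 2)).
Proof.
rewrite -subr_ge0.
have -> : 9 / 4 * (p ^+ 4 + q ^+ 4 + 2 * (p ^+ 2 * q ^+ 2)) -
    (p ^+ 4 / 36 + 9 / 4 * q ^+ 4 + p ^+ 2 * q ^+ 2 + p ^+ 3 * q / 9) =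
  p ^+ 2 * ((p - q) ^+ 2 / 18 + 39 / 18 * p ^+ 2 + 62 / 18 * q ^+ 2) by field.
rewrite mulr_ge0 ?sqr_ge0//.
have := sqr_ge0 (p - q); have := sqr_ge0 p; have := sqr_ge0 q; lra.
Qed.

(** Cauchy-Schwarz for u^2 and v^2, by integrating Young's inequality with a free weight l and then
    optimising l. *)
Lemma mixed_integral_le (u v : R4 R -> R) : measurable_fun setT u -> measurable_fun setT v ->
  mu4.-integrable setT (EFin \o (fun x => u x ^+ 4)) ->
  mu4.-integrable setT (EFin \o (fun x => v x ^+ 4)) ->
  mu4.-integrable setT (EFin \o (fun x => u x ^+ 2 * v x ^+ 2)) /\
  \int[mu4]_x (u x ^+ 2 * v x ^+ 2) <=
    Num.sqrt (\int[mu4]_x (u x ^+ 4)) * Num.sqrt (\int[mu4]_x (v x ^+ 4)).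
Proof.
move=> mu_ mv iu iv.
have i2 : mu4.-integrable setT (EFin \o (fun x => u x ^+ 2 * v x ^+ 2)).
  apply: (le_integrableR _ _ (integrableDR iu iv)).
    exact: (measurable_funM (measurable_funX 2 mu_) (measurable_funX 2 mv)).
  by move=> x; have [] := monomial_bound (u x) (v x).
split=> //; set c := \int[mu4]_x (u x ^+ 2 * v x ^+ 2).
set p := \int[mu4]_x (u x ^+ 4); set q := \int[mu4]_x (v x ^+ 4).
have p0 : 0 <= p by apply: Rintegral_ge0 => x _; exact: expr4_ge0.
have q0 : 0 <= q by apply: Rintegral_ge0 => x _; exact: expr4_ge0.
have key (l : R) : 0 < l -> 2 * c <= l * p + l^-1 * q.
  move=> l0; have i3 := integrableZR 2 i2.
  have i4 := integrableZR l iu; have i5 := integrableZR l^-1 iv.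
  rewrite -(RintegralZl _ measurableT i2) -(RintegralZl _ measurableT iu).
  rewrite -(RintegralZl _ measurableT iv) -(RintegralD measurableT i4 i5).
  apply: (le_Rintegral measurableT i3 (integrableDR i4 i5)) => x _.
  rewrite -subr_ge0 (_ : _ - _ = l * (u x ^+ 2 - l^-1 * v x ^+ 2) ^+ 2).
    by rewrite mulr_ge0 ?sqr_ge0// ltW.
  by field; rewrite gt_eqF.
have a0 := sqrtr_ge0 p; have b0 := sqrtr_ge0 q.
rewrite -(sqr_sqrtr p0) -(sqr_sqrtr q0) in key.
move: (Num.sqrt p) (Num.sqrt q) a0 b0 key => a b a0 b0 key.
apply/ler_addgt0Pr => ep ep0.
(* The optimal weight is b / a; shifting both numbers by e avoids division by zero at the cost of an
   error e (a + b) / 2 <= ep. *)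
pose e := 2 * ep / (a + b + 1); have ab : 0 < a + b + 1 by lra.
have e0 : 0 < e by rewrite divr_gt0// mulr_gt0.
have ae : 0 < a + e by lra.
have be : 0 < b + e by lra.
have := key ((b + e) / (a + e)) (divr_gt0 be ae).
have h1 : (b + e) / (a + e) * a ^+ 2 <= (b + e) * a.
  rewrite mulrAC ler_pdivrMr// expr2 -mulrA ler_wpM2l ?(ltW be)//.
  by rewrite ler_wpM2l// lerDl ltW.
have h2 : ((b + e) / (a + e))^-1 * b ^+ 2 <= (a + e) * b.
  rewrite invf_div mulrAC ler_pdivrMr// expr2 -mulrA ler_wpM2l ?(ltW ae)//.
  by rewrite ler_wpM2l// lerDl ltW.
have h3 : e * (a + b) <= 2 * ep.
  rewrite /e mulrAC ler_pdivrMr// ler_wpM2l ?mulr_ge0 ?(ltW ep0)//.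
  by rewrite lerDl.
move: h1 h2; move: (_ * a ^+ 2) (_ * b ^+ 2) => X Y h1 h2 h4; nra.
Qed.

Lemma cubic_mul_integrable (u v : R4 R -> R) : measurable_fun setT u -> measurable_fun setT v ->
  mu4.-integrable setT (EFin \o (fun x => u x ^+ 4)) ->
  mu4.-integrable setT (EFin \o (fun x => v x ^+ 4)) ->
  mu4.-integrable setT (EFin \o (fun x => u x ^+ 3 * v x)).
Proof.
move=> mu_ mv iu iv; apply: (le_integrableR _ _ (integrableDR iu iv)).
  exact: (measurable_funM (measurable_funX 3 mu_) mv).
by move=> x; have [] := monomial_bound (u x) (v x).
Qed.

End solutions.

(** * Energy identities and the lower bound for solutions *)

Section ground_states.
Variable R : realType.
Local Notation mT := (measurableTypeR R).
Local Notation mT4 := ((mT * mT) * (mT * mT))%type.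
Local Notation mu := (@lebesgue_measure R).
Local Notation mu4 := (pow4 mu).
Implicit Types (x : R4 R) (i : 'I_4).

Lemma quartic_integral (u v : R4 R -> R) (a b c d : R) :
  measurable_fun setT u -> measurable_fun setT v ->
  mu4.-integrable setT (EFin \o (fun x => u x ^+ 4)) ->
  mu4.-integrable setT (EFin \o (fun x => v x ^+ 4)) ->
  mu4.-integrable setT (EFin \o (fun x => a * u x ^+ 4 + (b * v x ^+ 4 +
    (c * (u x ^+ 2 * v x ^+ 2) + d * (u x ^+ 3 * v x))))) /\
  \int[mu4]_x (a * u x ^+ 4 + (b * v x ^+ 4 +
    (c * (u x ^+ 2 * v x ^+ 2) + d * (u x ^+ 3 * v x)))) =
  a * \int[mu4]_x (u x ^+ 4) + (b * \int[mu4]_x (v x ^+ 4) +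
    (c * \int[mu4]_x (u x ^+ 2 * v x ^+ 2) + d * \int[mu4]_x (u x ^+ 3 * v x))).
Proof.
move=> mu_ mv iu iv; have [i2 _] := mixed_integral_le mu_ mv iu iv.
have i3 := cubic_mul_integrable mu_ mv iu iv.
have j1 := integrableZR a iu; have j2 := integrableZR b iv.
have j3 := integrableZR c i2; have j4 := integrableZR d i3.
have k3 := integrableDR j3 j4; have k2 := integrableDR j2 k3.
split; first exact: (integrableDR j1 k2).
rewrite (RintegralD measurableT j1 k2) (RintegralD measurableT j2 k3).
rewrite (RintegralD measurableT j3 j4) (RintegralZl _ measurableT iu).
by rewrite (RintegralZl _ measurableT iv) (RintegralZl _ measurableT i2)
  (RintegralZl _ measurableT i3).
Qed.

Lemma energyE (u : R4 R -> R) g : Hdot1 u g ->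
  mu4.-integrable setT (EFin \o (fun x => \sum_(i < 4) g i x ^+ 2)) /\
  \int[mu4]_x (\sum_(i < 4) g i x ^+ 2) = energy g.
Proof. by move=> H; exact: (Rintegral_sum (index_enum _) (Hdot1_integrable_grad H)). Qed.

Lemma Kfun_energy (P Q : R4 R -> R) gP gQ : Hdot1 P gP -> Hdot1 Q gQ ->
  Kfun gP gQ = (energy gP + energy gQ)%:E.
Proof.
move=> HP HQ; have [iP eP] := energyE HP; have [iQ eQ] := energyE HQ.
have h : (\int[mu4]_x (\sum_(i < 4) (gP i x ^+ 2 + gQ i x ^+ 2))%:E =
    (energy gP + energy gQ)%:E)%E.
  under eq_integral do rewrite big_split/=.
  by rewrite (integrable_RintegralE (integrableDR iP iQ)) (RintegralD measurableT iP iQ) eP eQ.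
exact: h.
Qed.

(** Testing the two equations with P and Q and adding gives K = 4 N, because the nonlinearity is the
    gradient of a polynomial homogeneous of degree four. The upper bound on K then follows from
    [quartic_bound] and Cauchy-Schwarz. *)
Lemma solution_identities (P Q : R4 R -> R) gP gQ : is_solution P gP Q gQ ->
  Nfun P Q = ((energy gP + energy gQ) / 4)%:E /\
  energy gP + energy gQ <=
    9 * (Num.sqrt (\int[mu4]_x (P x ^+ 4)) + Num.sqrt (\int[mu4]_x (Q x ^+ 4))) ^+ 2.
Proof.
move=> [HP [HQ sol]].
have mP := Hdot1_measurable HP; have mQ := Hdot1_measurable HQ.
have iP := Hdot1_integrable HP; have iQ := Hdot1_integrable HQ.
have e1 : \int[mu4]_x (\sum_(i < 4) gP i x * gP i x) = \int[mu4]_x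
    ((P x ^+ 3 / 9 + 2 * Q x ^+ 2 * P x + P x ^+ 2 * Q x / 3) * P x).
  exact: (congr1 fine (sol P gP HP).1).
have e2 : \int[mu4]_x (\sum_(i < 4) gQ i x * gQ i x) = \int[mu4]_x
    ((9 * Q x ^+ 3 + 2 * P x ^+ 2 * Q x + P x ^+ 3 / 9) * Q x).
  exact: (congr1 fine (sol Q gQ HQ).2).
have sq (u : R4 R -> R) g : Hdot1 u g -> \int[mu4]_x (\sum_(i < 4) g i x * g i x) = energy g.
  by move=> H; rewrite -(energyE H).2; apply: eq_Rintegral => x _; apply: eq_bigr => i _; rewrite expr2.
rewrite (sq _ _ HP) in e1; rewrite (sq _ _ HQ) in e2.
(* Coefficients of P^4, Q^4, P^2 Q^2 and P^3 Q in the first right-hand side times P, in the second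
   times Q, and in the density of N; the sum of the first two lists is four times the third. *)
have [_ r1] := quartic_integral (9^-1) 0 2 (3^-1) mP mQ iP iQ.
have [_ r2] := quartic_integral 0 9 2 (9^-1) mP mQ iP iQ.
have [iN rN] := quartic_integral (36^-1) (9 / 4) 1 (9^-1) mP mQ iP iQ.
have r1' : energy gP = \int[mu4]_x (9^-1 * P x ^+ 4 + (0 * Q x ^+ 4 +
    (2 * (P x ^+ 2 * Q x ^+ 2) + 3^-1 * (P x ^+ 3 * Q x)))).
  by rewrite e1; apply: eq_Rintegral => x _; ring.
have r2' : energy gQ = \int[mu4]_x (0 * P x ^+ 4 + (9 * Q x ^+ 4 +
    (2 * (P x ^+ 2 * Q x ^+ 2) + 9^-1 * (P x ^+ 3 * Q x)))).
  by rewrite e2; apply: eq_Rintegral => x _; ring.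
rewrite r1 in r1'; rewrite r2 in r2'.
have eN : \int[mu4]_x (36^-1 * P x ^+ 4 + (9 / 4 * Q x ^+ 4 +
    (1 * (P x ^+ 2 * Q x ^+ 2) + 9^-1 * (P x ^+ 3 * Q x)))) = (energy gP + energy gQ) / 4.
  by rewrite rN r1' r2'; field.
split.
  have h : (\int[mu4]_x (P x ^+ 4 / 36 + 9 / 4 * Q x ^+ 4 + P x ^+ 2 * Q x ^+ 2
      + P x ^+ 3 * Q x / 9)%:E = ((energy gP + energy gQ) / 4)%:E)%E.
    rewrite -eN -(integrable_RintegralE iN); apply: eq_integral => x _.
    by congr EFin; ring.
  exact: h.
(* The majorant 9/4 (P^2 + Q^2)^2. *)
have [iM rM] := quartic_integral (9 / 4) (9 / 4) (9 / 2) 0 mP mQ iP iQ.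
have hN : (energy gP + energy gQ) / 4 <= 9 / 4 * \int[mu4]_x (P x ^+ 4) +
   (9 / 4 * \int[mu4]_x (Q x ^+ 4) + (9 / 2 * \int[mu4]_x (P x ^+ 2 * Q x ^+ 2) +
    0 * \int[mu4]_x (P x ^+ 3 * Q x))).
  rewrite -eN -rM; apply: (le_Rintegral measurableT iN iM) => x _.
  apply: le_trans (le_trans (quartic_bound (P x) (Q x)) _).
    by rewrite le_eqVlt; apply/orP; left; apply/eqP; ring.
  by rewrite le_eqVlt; apply/orP; left; apply/eqP; field.
have [_ hm] := mixed_integral_le mP mQ iP iQ.
have p0 : 0 <= \int[mu4]_x (P x ^+ 4) by apply: Rintegral_ge0 => x _; exact: expr4_ge0.
have q0 : 0 <= \int[mu4]_x (Q x ^+ 4) by apply: Rintegral_ge0 => x _; exact: expr4_ge0.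
rewrite mul0r addr0 in hN; rewrite -{1}(sqr_sqrtr p0) -{1}(sqr_sqrtr q0) in hN.
move: (Num.sqrt _) (Num.sqrt _) (\int[mu4]_x (P x ^+ 2 * Q x ^+ 2)) (energy gP + energy gQ) hm hN.
by move=> a b m K hm hN; rewrite sqrrD -mulr_natl; lra.
Qed.

Lemma Sfun_solution (P Q : R4 R -> R) gP gQ : is_solution P gP Q gQ ->
  Sfun P gP Q gQ = ((energy gP + energy gQ) / 4)%:E.
Proof.
move=> sol; case: (sol) => HP [HQ _].
rewrite /Sfun (Kfun_energy HP HQ) (solution_identities sol).1 -EFinM -EFinB.
by congr EFin; field.
Qed.

(** From 64 I A^2 <= K^2 and K <= 9 A^2 one gets 64 I K <= 9 K^2, and K > 0 can be cancelled. *)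
Lemma energy_lower (I A K : R) : 0 < I -> 0 < K -> 0 <= A ->
  8 * Num.sqrt I * A <= K -> K <= 9 * A ^+ 2 -> 64 * I / 9 <= K.
Proof.
move=> I0 K0 A0 h1 h2.
have s0 : 0 <= 8 * Num.sqrt I * A by rewrite mulr_ge0// mulr_ge0// sqrtr_ge0.
have h3 : (8 * Num.sqrt I * A) ^+ 2 <= K ^+ 2 by rewrite ler_pXn2r ?nnegrE// ltW.
rewrite !exprMn sqr_sqrtr ?(ltW I0)// in h3.
rewrite ler_pdivrMr//.
have h4 : 64 * I * K <= K * 9 * K.
  apply: (@le_trans _ _ (64 * I * (9 * A ^+ 2))).
    by rewrite ler_wpM2l// mulr_ge0// ltW.
  by move: (A ^+ 2) h3 => A2; rewrite expr2 [K ^+ 2]expr2 => h3; lra.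
by rewrite ler_pM2r// in h4.
Qed.

(** Sobolev for P and for Q, added, bounds K from below by a multiple of A = ||P||_4^2 + ||Q||_4^2,
    while [solution_identities] gives K <= 9 A^2; [energy_lower] combines the two. *)
Lemma solution_lower_bound (P Q : R4 R -> R) gP gQ : is_solution P gP Q gQ ->
  nontrivial P Q -> 64 * bubble_mass R / 9 <= energy gP + energy gQ.
Proof.
move=> sol nt; have [_ h2] := solution_identities sol; case: (sol) => HP [HQ _].
have mP := Hdot1_measurable HP; have mQ := Hdot1_measurable HQ.
have iP := Hdot1_integrable HP; have iQ := Hdot1_integrable HQ.
have I0 := bubble_mass_gt0 R; have sI : 0 < Num.sqrt (bubble_mass R) by rewrite sqrtr_gt0.
have sP := sobolev_Hdot1 HP; have sQ := sobolev_Hdot1 HQ.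
rewrite sqrtrM ?(ltW I0)// -/(energy gP) in sP.
rewrite sqrtrM ?(ltW I0)// -/(energy gQ) in sQ.
have p0 : 0 <= \int[mu4]_x (P x ^+ 4) by apply: Rintegral_ge0 => x _; exact: expr4_ge0.
have q0 : 0 <= \int[mu4]_x (Q x ^+ 4) by apply: Rintegral_ge0 => x _; exact: expr4_ge0.
have a0 := sqrtr_ge0 (\int[mu4]_x (P x ^+ 4)); have b0 := sqrtr_ge0 (\int[mu4]_x (Q x ^+ 4)).
have KP := energy_ge0 gP; have KQ := energy_ge0 gQ.
have h1 : 8 * Num.sqrt (bubble_mass R) *
    (Num.sqrt (\int[mu4]_x (P x ^+ 4)) + Num.sqrt (\int[mu4]_x (Q x ^+ 4))) <= energy gP + energy gQ.
  by rewrite mulrDr; apply: lerD; rewrite -mulrA.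
apply: (energy_lower I0 _ (addr_ge0 a0 b0) h1 h2).
(* Positivity of K: if K = 0, the Sobolev inequality makes both L^4 norms vanish, so P and Q are
   zero almost everywhere. *)
rewrite lt_neqAle addr_ge0// andbT eq_sym; apply/negP => /eqP K0.
rewrite K0 in h1.
have zero (u : R4 R -> R) : measurable_fun setT u ->
    mu4.-integrable setT (EFin \o (fun x => u x ^+ 4)) -> 0 <= \int[mu4]_x (u x ^+ 4) ->
    Num.sqrt (\int[mu4]_x (u x ^+ 4)) <= 0 -> {ae mu4, forall x, u x = 0}.
  move=> mu_ iu u0 su; apply/(ae0_integral4 mu_); rewrite (integrable_RintegralE iu).
  have /eqP : Num.sqrt (\int[mu4]_x (u x ^+ 4)) = 0.
    by apply/eqP; rewrite eq_le su sqrtr_ge0.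
  by rewrite sqrtr_eq0 => u1; congr EFin; apply/eqP; rewrite eq_le u1 u0.
have h3 : Num.sqrt (\int[mu4]_x (P x ^+ 4)) + Num.sqrt (\int[mu4]_x (Q x ^+ 4)) <= 0.
  by rewrite -(pmulr_rle0 _ (mulr_gt0 (ltr0n _ 8) sI)).
apply: nt; split.
  by apply: (zero P mP iP p0); rewrite (le_trans _ h3)// lerDl.
by apply: (zero Q mQ iQ q0); rewrite (le_trans _ h3)// lerDr.
Qed.

End ground_states.

Theorem theorem1p3 (R : realType) :
  exists (P : R4 R -> R) (gP : 'I_4 -> R4 R -> R)
         (Q : R4 R -> R) (gQ : 'I_4 -> R4 R -> R),
    ground_state P gP Q gQ.
Proof.
pose mu4 := pow4 (@lebesgue_measure R).
(* With - Delta w = 8 w^3, the function r w solves - Delta Q = 9 Q^3 exactly when 8 r = 9 r^3. *)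
pose r : R := Num.sqrt (8 / 9).
have r0 : 0 < r by rewrite sqrtr_gt0 divr_gt0.
have r2 : r ^+ 2 = 8 / 9 by rewrite sqr_sqrtr// divr_ge0.
pose Q x := r * @bub R x; pose gQ i x := r * @dbub R i x.
have HQ : Hdot1 Q gQ by exact: Hdot1_scale (ltW r0) (@Hdot1_bub R).
have sol : is_solution (fun=> 0) (fun _ _ => 0) Q gQ.
  split; first exact: Hdot1_0.
  split; first exact: HQ.
  move=> f gf Hf; split.
    have e1 : (\int[mu4]_x (\sum_(i < 4) 0 * gf i x)%:E = 0)%E.
      by under eq_integral do (rewrite big1; last by move=> i _; rewrite mul0r);
        rewrite integral0.
    have e2 : (\int[mu4]_x ((0 ^+ 3 / 9 + 2 * Q x ^+ 2 * 0 + 0 ^+ 2 * Q x / 3) * f x)%:E = 0)%E.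
      transitivity (\int[mu4]_x (0 : \bar R))%E; last exact: integral0.
      by apply: eq_integral => x _; congr EFin; ring.
    exact: etrans e1 (esym e2).
  have [i1 i2 e] := bub_weak Hf.
  have e1 : (\int[mu4]_x (\sum_(i < 4) gQ i x * gf i x)%:E =
      (r * (8 * \int[mu4]_x (bub x ^+ 3 * f x)))%:E)%E.
    rewrite -e -(RintegralZl _ measurableT i1) -(integrable_RintegralE (integrableZR r i1)).
    apply: eq_integral => x _; congr EFin; rewrite mulr_sumr.
    by apply: eq_bigr => i _; rewrite /gQ mulrA.
  have e2 : (\int[mu4]_x ((9 * Q x ^+ 3 + 2 * 0 ^+ 2 * Q x + 0 ^+ 3 / 9) * f x)%:E =
      (8 * r * \int[mu4]_x (bub x ^+ 3 * f x))%:E)%E.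
    rewrite -(RintegralZl _ measurableT i2) -(integrable_RintegralE (integrableZR (8 * r) i2)).
    apply: eq_integral => x _; congr EFin; rewrite /Q.
    have -> : (r * bub x) ^+ 3 = r ^+ 2 * r * bub x ^+ 3 by ring.
    by rewrite r2; field.
  apply: (etrans e1); apply: (etrans _ (esym e2)).
  by congr EFin; ring.
(* The weak equation tested with the bubble itself gives it the energy 8 I, which is multiplied by
   r^2 = 8/9; the result is the lower bound of [solution_lower_bound]. *)
have Eb : energy gQ = 64 * bubble_mass R / 9.
  have [_ _ e] := bub_weak (@Hdot1_bub R).
  rewrite -(energyE HQ).2.
  transitivity (\int[mu4]_x (r ^+ 2 * (\sum_(i < 4) dbub i x * dbub i x))).
    apply: eq_Rintegral => x _; rewrite mulr_sumr; apply: eq_bigr => i _.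
    by rewrite /gQ exprMn [dbub i x ^+ 2]expr2.
  have [i1 _ _] := bub_weak (@Hdot1_bub R).
  rewrite (RintegralZl _ measurableT i1) e r2.
  have -> : \int[mu4]_x (bub x ^+ 3 * bub x) = bubble_mass R.
    transitivity (\int[mu4]_x (@bub R x ^+ 4)).
      by apply: eq_Rintegral => x _; rewrite -exprSr.
    by rewrite /Rintegral bub4_integral.
  by field.
have E0 : energy (fun (_ : 'I_4) (_ : R4 R) => 0 : R) = 0.
  rewrite /energy big1// => i _.
  by under eq_Rintegral do rewrite expr0n; rewrite /Rintegral integral0.
have nt : nontrivial (fun=> 0) Q.
  move=> [_ Q0]; have mQ := Hdot1_measurable HQ.
  have := (ae0_integral4 mQ).1 Q0; rewrite /Q.
  have -> : (\int[mu4]_x ((r * bub x) ^+ 4)%:E = (r ^+ 4 * bubble_mass R)%:E)%E.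
    under eq_integral do rewrite exprMn.
    rewrite (ge0_integralZR mu4 (expr4_ge0 r)); last first.
      exact: (measurable_funX 4 (@measurable_bub R)).
    by rewrite bub4_integral.
  by move=> [] /eqP; rewrite gt_eqF// mulr_gt0 ?exprn_gt0// bubble_mass_gt0.
exists (fun=> 0), (fun _ _ => 0), Q, gQ; split; [exact: sol|split; first exact: nt].
(* The value is a lower bound of all admissible values because S = K / 4 on solutions, and it is
   itself one of them. *)
apply/eqP; rewrite eq_le; apply/andP; split.
  apply: le_ereal_inf_tmp => _ [P' [gP' [Q' [gQ' [sol' nt' ->]]]]].
  rewrite (Sfun_solution sol) (Sfun_solution sol') E0 add0r Eb lee_fin ler_wpM2r//.
  exact: solution_lower_bound sol' nt'.
apply: ereal_inf_lbound; exists (fun=> 0), (fun _ _ => 0), Q, gQ; split => //.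
Qed.
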